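(* Let $R>0$ and let $\mathbf{f}\in L_2(B_R;\mathcal{A};\mathbb{R})$ be monogenic in $B_R$ and orthogonal (with respect to the real inner product) to the non-trivial hyperholomorphic constants. Then for $0\le r<R$, $$\mathcal{M}(\mathbf{f}-\mathbf{f}(0),r)\le\sqrt{\tfrac23}\,\frac{2r\,A(r,R)}{(R-r)^4}\sup_{|\xi|<R}|\mathbf{Sc}\{\mathbf{f}(\xi)-\mathbf{f}(0)\}|,\qquad A(r,R)=(3R-r)(3R^2-Rr+r^2).$$
   Context: Quaternions $\mathbb{H}$ have basis $1,\mathbf{e}_1,\mathbf{e}_2,\mathbf{e}_3$ with Hamilton multiplication; $\mathbf{Sc}$ is the real part, conjugation flips the signs of the imaginary parts, $|\cdot|$ is the Euclidean norm. Reduced quaternions: $\mathcal{A}=\mathrm{span}_\mathbb{R}\{1,\mathbf{e}_1,\mathbf{e}_2\}$, with $x=(x_0,x_1,x_2)\in\mathbb{R}^3$ identified with $x_0+x_1\mathbf{e}_1+x_2\mathbf{e}_2$. $D=\partial_{x_0}+\mathbf{e}_1\partial_{x_1}+\mathbf{e}_2\partial_{x_2}$, $\overline{D}=\partial_{x_0}-\mathbf{e}_1\partial_{x_1}-\mathbf{e}_2\partial_{x_2}$; an $\mathcal{A}$-valued $C^1$ function is monogenic if $D\mathbf{f}=0$. $B_R$ is the open ball of radius $R$ centered at $0$; $L_2(B_R;\mathcal{A};\mathbb{R})$ carries the real inner product $\langle\mathbf{f},\mathbf{g}\rangle=\int_{B_R}\mathbf{Sc}(\overline{\mathbf{f}}\mathbf{g})\,dV$.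 $\mathcal{M}(\mathbf{f},r)=\max_{|x|=r}|\mathbf{f}(x)|$. Spherical coordinates $x_0=r\cos\theta_1$, $x_1=r\sin\theta_1\cos\theta_2$, $x_2=r\sin\theta_1\sin\theta_2$; $P^m_n(t)=(1-t^2)^{m/2}\frac{d^m}{dt^m}P_n(t)$, $T_k,U_k$ Chebyshev polynomials of first and second kind; $U^{n+1}_{n+1}=P^{n+1}_{n+1}(\cos\theta_1)T_{n+1}(\cos\theta_2)$, $V^{n+1}_{n+1}=P^{n+1}_{n+1}(\cos\theta_1)\sin\theta_2U_{n}(\cos\theta_2)$. The non-trivial hyperholomorphic constants are the polynomials $\mathbf{X}^{n+1,\dagger}_n:=\tfrac12\overline{D}(r^{n+1}U^{n+1}_{n+1})$ and $\mathbf{Y}^{n+1,\dagger}_n:=\tfrac12\overline{D}(r^{n+1}V^{n+1}_{n+1})$ for $n\ge1$; ''orthogonal to the non-trivial hyperholomorphic constants'' means $\langle\mathbf{f},\mathbf{X}^{n+1,\dagger}_n\rangle=\langle\mathbf{f},\mathbf{Y}^{n+1,\dagger}_n\rangle=0$ for all $n\ge1$. *)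

(* Defs.v *)
From Stdlib Require Import Reals Lra Classical ClassicalEpsilon Arith Factorial.
Open Scope R_scope.

(* Points of R^3, identified with reduced quaternions x0 + x1 e1 + x2 e2. *)
Record pt := mkpt { c0 : R; c1 : R; c2 : R }.
Definition origin : pt := mkpt 0 0 0.
Definition psub (x y : pt) : pt := mkpt (c0 x - c0 y) (c1 x - c1 y) (c2 x - c2 y).

Record quat := mkq { q0 : R; q1 : R; q2 : R; q3 : R }.
Definition qadd (a b : quat) : quat :=
  mkq (q0 a + q0 b) (q1 a + q1 b) (q2 a + q2 b) (q3 a + q3 b).
Definition qmul (a b : quat) : quat :=
  mkq (q0 a * q0 b - q1 a * q1 b - q2 a * q2 b - q3 a * q3 b)
      (q0 a * q1 b + q1 a * q0 b + q2 a * q3 b - q3 a * q2 b)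
      (q0 a * q2 b - q1 a * q3 b + q2 a * q0 b + q3 a * q1 b)
      (q0 a * q3 b + q1 a * q2 b - q2 a * q1 b + q3 a * q0 b).
Definition qconj (a : quat) : quat := mkq (q0 a) (- q1 a) (- q2 a) (- q3 a).
Definition Sc (a : quat) : R := q0 a.
Definition qnorm (a : quat) : R := sqrt (q0 a ^ 2 + q1 a ^ 2 + q2 a ^ 2 + q3 a ^ 2).
Definition qzero : quat := mkq 0 0 0 0.
Definition e1 : quat := mkq 0 1 0 0.
Definition e2 : quat := mkq 0 0 1 0.
Definition toQ (x : pt) : quat := mkq (c0 x) (c1 x) (c2 x) 0.
Definition pnorm (x : pt) : R := qnorm (toQ x).

Definition deriv1 (g : R -> R) (t : R) : R :=
  match excluded_middle_informative (exists l, derivable_pt_lim g t l) with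
  | left H => proj1_sig (constructive_indefinite_description _ H)
  | right _ => 0
  end.
Fixpoint nderiv (m : nat) (g : R -> R) : R -> R :=
  match m with O => g | S k => deriv1 (nderiv k g) end.

Definition line0 (x : pt) (t : R) := mkpt t (c1 x) (c2 x).
Definition line1 (x : pt) (t : R) := mkpt (c0 x) t (c2 x).
Definition line2 (x : pt) (t : R) := mkpt (c0 x) (c1 x) t.
Definition pd0 (g : pt -> R) (x : pt) : R := deriv1 (fun t => g (line0 x t)) (c0 x).
Definition pd1 (g : pt -> R) (x : pt) : R := deriv1 (fun t => g (line1 x t)) (c1 x).
Definition pd2 (g : pt -> R) (x : pt) : R := deriv1 (fun t => g (line2 x t)) (c2 x).

Definition pdA (pd : (pt -> R) -> pt -> R) (F : pt -> pt) (x : pt) : pt :=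
  mkpt (pd (fun y => c0 (F y)) x) (pd (fun y => c1 (F y)) x) (pd (fun y => c2 (F y)) x).

Definition Dop (F : pt -> pt) (x : pt) : quat :=
  qadd (toQ (pdA pd0 F x))
       (qadd (qmul e1 (toQ (pdA pd1 F x))) (qmul e2 (toQ (pdA pd2 F x)))).

Definition Dbar_scalar (h : pt -> R) (x : pt) : pt :=
  mkpt (pd0 h x) (- pd1 h x) (- pd2 h x).

Definition in_ball (Rad : R) (x : pt) : Prop := pnorm x < Rad.

Definition cont_on_ball (Rad : R) (g : pt -> R) : Prop :=
  forall x, in_ball Rad x -> forall eps, 0 < eps -> exists delta, 0 < delta /\
    forall y, pnorm (psub y x) < delta -> Rabs (g y - g x) < eps.

Definition C1_on_ball (Rad : R) (F : pt -> pt) : Prop :=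
  forall (k : pt -> R), (k = c0 \/ k = c1 \/ k = c2) ->
    (forall x, in_ball Rad x ->
       (exists l, derivable_pt_lim (fun t => k (F (line0 x t))) (c0 x) l) /\
       (exists l, derivable_pt_lim (fun t => k (F (line1 x t))) (c1 x) l) /\
       (exists l, derivable_pt_lim (fun t => k (F (line2 x t))) (c2 x) l)) /\
    cont_on_ball Rad (pd0 (fun y => k (F y))) /\
    cont_on_ball Rad (pd1 (fun y => k (F y))) /\
    cont_on_ball Rad (pd2 (fun y => k (F y))).

Definition monogenic (Rad : R) (F : pt -> pt) : Prop :=
  C1_on_ball Rad F /\ forall x, in_ball Rad x -> Dop F x = qzero.

(* Riemann integral (0 if not Riemann integrable; value is proof-independent). *)
Definition Rint (g : R -> R) (a b : R) : R :=
  match excluded_middle_informative (exists _ : Riemann_integrable g a b, True) with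
  | left H => RiemannInt (proj1_sig (constructive_indefinite_description _ H))
  | right _ => 0
  end.

(* Integral over the closed ball of radius rho (iterated Riemann integral;
   equals the Lebesgue integral for functions continuous on the closed ball). *)
Definition ballint (h : pt -> R) (rho : R) : R :=
  Rint (fun x0 =>
    Rint (fun x1 =>
      Rint (fun x2 => h (mkpt x0 x1 x2))
           (- sqrt (rho ^ 2 - x0 ^ 2 - x1 ^ 2)) (sqrt (rho ^ 2 - x0 ^ 2 - x1 ^ 2)))
      (- sqrt (rho ^ 2 - x0 ^ 2)) (sqrt (rho ^ 2 - x0 ^ 2)))
    (- rho) rho.

Definition sc_prod (F G : pt -> pt) (x : pt) : R :=
  Sc (qmul (qconj (toQ (F x))) (toQ (G x))).

(* f in L_2(B_R): (for continuous f) the integrals of |f|^2 over B_rho, rho<R, are bounded. *)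
Definition in_L2 (Rad : R) (F : pt -> pt) : Prop :=
  exists M, forall rho, 0 <= rho < Rad -> ballint (fun x => pnorm (F x) ^ 2) rho <= M.

Definition L2_inner_is (Rad : R) (F G : pt -> pt) (v : R) : Prop :=
  forall eps, 0 < eps -> exists delta, 0 < delta /\
    forall rho, Rad - delta < rho < Rad -> Rabs (ballint (sc_prod F G) rho - v) < eps.

Definition Legendre (n : nat) (t : R) : R :=
  / (2 ^ n * INR (fact n)) * nderiv n (fun s => (s ^ 2 - 1) ^ n) t.
Definition assocLegendre (m n : nat) (t : R) : R :=
  (sqrt (1 - t ^ 2)) ^ m * nderiv m (Legendre n) t.
Fixpoint ChebT (k : nat) (t : R) : R :=
  match k with
  | O => 1
  | S O => t
  | S ((S j) as k') => 2 * t * ChebT k' t - ChebT j t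
  end.
Fixpoint ChebU (k : nat) (t : R) : R :=
  match k with
  | O => 1
  | S O => 2 * t
  | S ((S j) as k') => 2 * t * ChebU k' t - ChebU j t
  end.

(* Spherical coordinates of x: x0 = r cos th1, x1 = r sin th1 cos th2,
   x2 = r sin th1 sin th2 (angle conventions at degenerate points are
   irrelevant for the functions below, which vanish there). *)
Definition rad (x : pt) : R := pnorm x.
Definition cos_th1 (x : pt) : R := if Req_EM_T (rad x) 0 then 1 else c0 x / rad x.
Definition rho12 (x : pt) : R := sqrt (c1 x ^ 2 + c2 x ^ 2).
Definition cos_th2 (x : pt) : R := if Req_EM_T (rho12 x) 0 then 1 else c1 x / rho12 x.
Definition sin_th2 (x : pt) : R := if Req_EM_T (rho12 x) 0 then 0 else c2 x / rho12 x.

Definition rU (n : nat) (x : pt) : R :=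
  rad x ^ (S n) * assocLegendre (S n) (S n) (cos_th1 x) * ChebT (S n) (cos_th2 x).
Definition rV (n : nat) (x : pt) : R :=
  rad x ^ (S n) * assocLegendre (S n) (S n) (cos_th1 x) * (sin_th2 x * ChebU n (cos_th2 x)).

Definition half (p : pt) : pt := mkpt (c0 p / 2) (c1 p / 2) (c2 p / 2).
Definition Xc (n : nat) (x : pt) : pt := half (Dbar_scalar (rU n) x).
Definition Yc (n : nat) (x : pt) : pt := half (Dbar_scalar (rV n) x).

Definition orth_hyper_consts (Rad : R) (F : pt -> pt) : Prop :=
  forall n : nat, (1 <= n)%nat -> L2_inner_is Rad F (Xc n) 0 /\ L2_inner_is Rad F (Yc n) 0.

Definition Acoef (r Rad : R) : R := (3 * Rad - r) * (3 * Rad ^ 2 - Rad * r + r ^ 2).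

(* Main.v *)
From Stdlib Require Import Reals Lra Lia Psatz ClassicalEpsilon FunctionalExtensionality Arith.
From Coquelicot Require Import Coquelicot.
Require Import Defs.
Open Scope R_scope.

(* Write [v = (f0 - f0(0), -f1, -f2)]: the Riesz system says that [v] is curl and divergence free.
   On concentric spheres the Euler operator then acts on [v] as a combination of the infinitesimal
   rotations [Lij = w_i d_j - w_j d_i], which are antisymmetric for the surface measure. Hence the
   projections [int P_N(x.w) v(t w) dw] onto the spherical harmonics of degree [N] are multiples of
   [t^N], for [v] only C^1. Rotating [x] about the axis 0 by an angle [s], the
   projections [a_N], [b_N] of [v1], [v2] satisfy [N a + b' = alpha], [N b - a' = beta], where [alpha]
   and [beta] are rotational derivatives of the projection of [v0]; orthogonality to the
   hyperholomorphic constants says that the [N]-th Fourier mode of [a - i b], the kernel of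
   this system, vanishes. This bounds [|v_N|] by [(2N+1) sqrt(1 + pi^2 N(N+1)) (r/R)^N sup|v0|], and these
   bounds sum to less than the required one. The series is reached through the positive kernels
   [(k+1) ((1 + x.w)/2)^k], which are combinations of the [(2N+1) P_N] with weights in [[0,1]]. *)

(** The required constant is itself a power series: with [tau = r / Rad], [2 r A / (Rad - r)^4] is
    the sum over [N >= 1] of [(N+1)(2N+1)(N+2) tau^N], because the sum from 0 is
    [(2 + 10 tau) / (1 - tau)^4] and its first term is 2. The estimate thus reduces to one
    inequality per degree, [sqrt (1 + pi^2 N(N+1)) <= sqrt (2/3) (N+1)(N+2)]. There, 1 comes from
    the scalar component, [N(N+1)] from Sonin's inequality for the derivative of [P_N], and [pi]
    from bounding a function with mean zero over a full turn by its derivative. Two obstacles shape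
    the rest. First, [v] has no second derivatives to work with: Laplace's equation is replaced by
    two first-order Euler relations, for moments against [P_N] and against [P_N'] times a rotation
    coefficient. Second, the inner product is a limit of iterated Riemann integrals in Cartesian
    coordinates, which two planar polar substitutions turn into integrals over spheres. As [v] has
    no boundary values on [|x| = Rad], its moments are bounded at radii [t < Rad], carried down to
    [r] by homogeneity, and only then [t] tends to [Rad]. *)

(* Coquelicot states equalities between integrals in the carrier of a normed module, which
   [ring] does not recognise as [R]. *)
Ltac eqR := match goal with |- @eq _ ?x ?y => change (@eq R x y) end.

(** * Integrals depending on parameters *)

Lemma continuous_R_mult {U : UniformSpace} (f g : U -> R) (u : U) :
  continuous f u -> continuous g u -> continuous (fun x => f x * g x) u.
Proof. intros Hf Hg. exact (continuous_mult (K := R_AbsRing) f g u Hf Hg). Qed.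

Lemma continuous_R_plus {U : UniformSpace} (f g : U -> R) (u : U) :
  continuous f u -> continuous g u -> continuous (fun x => f x + g x) u.
Proof. intros Hf Hg. exact (continuous_plus (V := R_NormedModule) f g u Hf Hg). Qed.

Lemma continuous_R_opp {U : UniformSpace} (f : U -> R) (u : U) :
  continuous f u -> continuous (fun x => - f x) u.
Proof. intros Hf. exact (continuous_opp (V := R_NormedModule) f u Hf). Qed.

Lemma continuous_R_minus {U : UniformSpace} (f g : U -> R) (u : U) :
  continuous f u -> continuous g u -> continuous (fun x => f x - g x) u.
Proof. intros Hf Hg. exact (continuous_minus (V := R_NormedModule) f g u Hf Hg). Qed.

Lemma continuous_R_comp {U : UniformSpace} (f : U -> R) (h : R -> R) (u : U) :
  continuous f u -> (forall y, continuous h y) -> continuous (fun x => h (f x)) u.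
Proof. intros Hf Hh. apply (continuous_comp f h); auto. Qed.

Lemma continuous_R_pow {U : UniformSpace} (f : U -> R) (n : nat) (u : U) :
  continuous f u -> continuous (fun x => f x ^ n) u.
Proof.
  intros Hf. induction n as [|n IH]; simpl.
  - apply continuous_const.
  - now apply continuous_R_mult.
Qed.

Lemma is_derive_continuous (f : R -> R) (x l : R) : is_derive f x l -> continuous f x.
Proof. intros H. apply (ex_derive_continuous (K := R_AbsRing) (V := R_NormedModule) f x). now exists l. Qed.

Lemma sin_cos_sqr (x : R) : sin x * sin x + cos x * cos x = 1.
Proof. exact (sin2_cos2 x). Qed.

Lemma continuous_sin_all (x : R) : continuous sin x.
Proof. apply (is_derive_continuous _ _ (cos x)). auto_derive; trivial. ring. Qed.

Lemma continuous_cos_all (x : R) : continuous cos x.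
Proof. apply (is_derive_continuous _ _ (- sin x)). auto_derive; trivial. ring. Qed.

Create HintDb cont.
#[export] Hint Resolve continuous_sin_all continuous_cos_all : cont.

Lemma continuous_pair {U V W : UniformSpace} (f : U -> V) (g : U -> W) (u : U) :
  continuous f u -> continuous g u -> continuous (fun x => (f x, g x)) u.
Proof.
  intros Hf Hg. apply (continuous_comp_2 f g pair u Hf Hg).
  apply continuous_ext with (fun p => p); [now intros [] | apply continuous_id].
Qed.

Ltac cont :=
  lazymatch goal with
  | |- continuous (fun _ => ?c) _ => apply continuous_const
  | |- continuous (fun p => p) _ => apply continuous_id
  | |- continuous (Rmult ?c) ?u => change (continuous (fun p => c * p) u); cont
  | |- continuous (fun p => fst p) _ => apply continuous_fst
  | |- continuous fst _ => apply continuous_fst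
  | |- continuous snd _ => apply continuous_snd
  | |- continuous (fun p => snd p) _ => apply continuous_snd
  | |- continuous (fun p => fst (@?f p)) _ => apply (continuous_comp f fst); [cont | apply continuous_fst]
  | |- continuous (fun p => snd (@?f p)) _ => apply (continuous_comp f snd); [cont | apply continuous_snd]
  | |- continuous (fun p => (@?f p, @?g p)) _ => apply (continuous_pair f g); cont
  | |- continuous (fun p => @?f p + @?g p) _ => apply (continuous_R_plus f g); cont
  | |- continuous (fun p => @?f p - @?g p) _ => apply (continuous_R_minus f g); cont
  | |- continuous (fun p => @?f p * @?g p) _ => apply (continuous_R_mult f g); cont
  | |- continuous (fun p => - @?f p) _ => apply (continuous_R_opp f); cont
  | |- continuous (fun p => @?f p ^ ?n) _ => apply (continuous_R_pow f n); cont
  | |- continuous (fun p => ?h (@?f p)) _ =>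
      first [apply (continuous_R_comp f h); [cont | solve [auto with cont]] | auto with cont]
  | _ => auto with cont
  end.

Lemma continuous_R_eps {U : UniformSpace} (f : U -> R) (u : U) :
  continuous f u <->
  forall eps : posreal, exists d : posreal, forall x, ball u d x -> Rabs (f x - f u) < eps.
Proof.
  split.
  - intros H eps.
    destruct (H (fun y => ball (f u) eps y) (locally_ball _ _)) as [d Hd].
    exists d. intros x Hx. exact (Hd x Hx).
  - intros H P [e He]. destruct (H e) as [d Hd]. exists d.
    intros x Hx. apply He. exact (Hd x Hx).
Qed.

(** Joint continuity gives a radius at each point of [[a, b]], and compactness a common one;
    comparing [F u s] and [F u0 s] with the same centre value [F u0 t] costs [eps / 2] each. *)
Lemma compact_uniform {U : UniformSpace} (F : U -> R -> R) (a b : R) (u0 : U) (eps : posreal) :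
  (forall s, a <= s <= b -> continuous (fun p : U * R => F (fst p) (snd p)) (u0, s)) ->
  exists d : posreal, forall u s, ball u0 d u -> a <= s <= b -> Rabs (F u s - F u0 s) < eps.
Proof.
  intros HF.
  assert (Hd : forall s, exists d : posreal, a <= s <= b ->
    forall u s', ball u0 d u -> Rabs (s' - s) < d -> Rabs (F u s' - F u0 s) < eps / 2).
  { intros s. destruct (excluded_middle_informative (a <= s <= b)) as [Hs|Hs].
    - destruct (proj1 (continuous_R_eps _ _) (HF s Hs) (pos_div_2 eps)) as [d Hd].
      exists d. intros _ u s' Hu Hs'. apply (Hd (u, s')). split; [exact Hu | exact Hs'].
    - exists (mkposreal 1 Rlt_0_1). tauto. }
  set (delta := fun s => proj1_sig (constructive_indefinite_description _ (Hd s))).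
  assert (Hdelta : forall s, a <= s <= b ->
    forall u s', ball u0 (delta s) u -> Rabs (s' - s) < delta s -> Rabs (F u s' - F u0 s) < eps / 2)
    by (intros s; exact (proj2_sig (constructive_indefinite_description _ (Hd s)))).
  destruct (compactness_value_1d a b delta) as [d Hc].
  exists d. intros u s Hu Hs.
  (* [compactness_value_1d] yields its centre [t] only under a double negation, hence the detour
     through a decidable inequality. *)
  destruct (Rlt_dec (Rabs (F u s - F u0 s)) eps) as [|Hn]; [assumption | exfalso].
  apply (Hc s Hs). intros [t [Ht [Hst Hdt]]]. apply Hn.
  assert (H1 : Rabs (F u s - F u0 t) < eps / 2).
  { apply (Hdelta t Ht); [|exact Hst]. apply ball_le with (2 := Hu). exact Hdt. }
  assert (H2 : Rabs (F u0 s - F u0 t) < eps / 2).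
  { apply (Hdelta t Ht); [|exact Hst]. apply ball_center. }
  replace (F u s - F u0 s) with ((F u s - F u0 t) - (F u0 s - F u0 t)) by ring.
  eapply Rle_lt_trans. apply Rabs_triang. rewrite Rabs_Ropp. lra.
Qed.

(** The [+ 1] in the denominator keeps the share meaningful when [a = b]. *)
Lemma share_lt (a b eps : R) : a <= b -> 0 < eps -> (b - a) * (eps / (b - a + 1)) < eps.
Proof.
  intros Hab He. replace ((b - a) * (eps / (b - a + 1))) with (eps * ((b - a) / (b - a + 1))) by (field; lra).
  rewrite <- (Rmult_1_r eps) at 2. apply Rmult_lt_compat_l; auto.
  apply Rmult_lt_reg_r with (b - a + 1). lra. field_simplify; lra.
Qed.

Lemma continuous_slice_r {U : UniformSpace} (F : U -> R -> R) (u : U) (s : R) :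
  continuous (fun p : U * R => F (fst p) (snd p)) (u, s) -> continuous (F u) s.
Proof.
  intros H. apply (continuous_comp_2 (fun _ : R => u) (fun x : R => x) F s); [cont | cont | exact H].
Qed.

Lemma continuous_slice (F : R -> R -> R) (u s : R) :
  continuous (fun p : R * R => F (fst p) (snd p)) (u, s) -> continuous (F u) s.
Proof. exact (continuous_slice_r (U := R_UniformSpace) F u s). Qed.

Lemma ex_RInt_cont (f : R -> R) (a b : R) :
  a <= b -> (forall z, a <= z <= b -> continuous f z) -> ex_RInt f a b.
Proof.
  intros Hab H. apply (ex_RInt_continuous (V := R_CompleteNormedModule)).
  rewrite Rmin_left, Rmax_right by assumption. exact H.
Qed.

Lemma continuous_RInt_param {U : UniformSpace} (F : U -> R -> R) (a b : R) (u0 : U) :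
  a <= b ->
  locally u0 (fun u => forall s, a <= s <= b ->
    continuous (fun p : U * R => F (fst p) (snd p)) (u, s)) ->
  continuous (fun u => RInt (F u) a b) u0.
Proof.
  intros Hab HF. apply continuous_R_eps. intros eps.
  assert (He : 0 < eps / (b - a + 1)).
  { apply Rdiv_lt_0_compat. apply eps. lra. }
  destruct (compact_uniform F a b u0 (mkposreal _ He) (locally_singleton _ _ HF)) as [d1 H1].
  assert (Hex : locally u0 (fun u => ex_RInt (F u) a b)).
  { revert HF. apply filter_imp. intros u Hu. apply ex_RInt_cont; auto. intros z Hz. now apply continuous_slice_r, Hu. }
  assert (H0 := locally_singleton _ _ Hex).
  destruct Hex as [d2 H2].
  exists (mkposreal _ (Rmin_stable_in_posreal d1 d2)). simpl. intros u Hu.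
  specialize (H2 u (ball_le _ _ _ (Rmin_r _ _) _ Hu)).
  replace (RInt (F u) a b - RInt (F u0) a b) with (RInt (fun s => F u s - F u0 s) a b).
  2: exact (RInt_minus (V := R_CompleteNormedModule) (F u) (F u0) a b H2 H0).
  eapply Rle_lt_trans; [|apply (share_lt a b); [exact Hab | apply eps]].
  apply abs_RInt_le_const; auto.
  - exact (ex_RInt_minus (V := R_NormedModule) (F u) (F u0) a b H2 H0).
  - intros t Ht. left. exact (H1 u t (ball_le _ _ _ (Rmin_l _ _) _ Hu) Ht).
Qed.

Lemma RInt_constant (a b c : R) : RInt (fun _ => c) a b = (b - a) * c.
Proof. exact (RInt_const (V := R_CompleteNormedModule) a b c). Qed.

Lemma RInt_ext_R (f g : R -> R) (a b : R) :
  (forall x, f x = g x) -> RInt f a b = RInt g a b.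
Proof. intros H. apply (RInt_ext (V := R_CompleteNormedModule)). intros; apply H. Qed.

Lemma RInt_ext_in (f g : R -> R) (a b : R) :
  a <= b -> (forall x, a < x < b -> f x = g x) -> RInt f a b = RInt g a b.
Proof.
  intros Hab H. apply (RInt_ext (V := R_CompleteNormedModule)).
  now rewrite Rmin_left, Rmax_right.
Qed.

Lemma RInt_R_scal (f : R -> R) (a b c : R) : ex_RInt f a b ->
  @eq R (RInt (fun x => c * f x) a b) (c * RInt f a b).
Proof. exact (RInt_scal (V := R_CompleteNormedModule) f a b c). Qed.

Lemma RInt_R_swap (f : R -> R) (a b : R) : ex_RInt f a b -> @eq R (- RInt f a b) (RInt f b a).
Proof. exact (opp_RInt_swap (V := R_CompleteNormedModule) f a b). Qed.

Lemma RInt_lin (f g : R -> R) (a b c d : R) : ex_RInt f c d -> ex_RInt g c d ->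
  @eq R (RInt (fun x => a * f x + b * g x) c d) (a * RInt f c d + b * RInt g c d).
Proof.
  intros Hf Hg.
  assert (Ef := ex_RInt_scal (V := R_NormedModule) f c d a Hf).
  assert (Eg := ex_RInt_scal (V := R_NormedModule) g c d b Hg).
  etransitivity. exact (RInt_plus (V := R_CompleteNormedModule) _ _ c d Ef Eg).
  now apply (f_equal2 Rplus); apply RInt_R_scal.
Qed.

Lemma ex_RInt_lin (f g : R -> R) (a b c d : R) : ex_RInt f c d -> ex_RInt g c d ->
  ex_RInt (fun x => a * f x + b * g x) c d.
Proof.
  intros Hf Hg. apply (ex_RInt_plus (V := R_NormedModule));
  now apply (ex_RInt_scal (V := R_NormedModule)).
Qed.

Lemma ex_RInt_everywhere (f : R -> R) (a b : R) : (forall z, continuous f z) -> ex_RInt f a b.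
Proof. intros H. apply (ex_RInt_continuous (V := R_CompleteNormedModule)). intros z _. apply H. Qed.

Lemma MVT_derive (f df : R -> R) (a b : R) :
  (forall z, Rmin a b <= z <= Rmax a b -> is_derive f z (df z)) ->
  exists c, Rmin a b <= c <= Rmax a b /\ f b - f a = df c * (b - a).
Proof.
  intros H. apply MVT_gen.
  - intros z Hz. apply H. lra.
  - intros z Hz. apply derivable_continuous_pt. exists (df z). now apply is_derive_Reals, H.
Qed.

Lemma between_dist (a b z : R) : Rmin a b <= z <= Rmax a b -> Rabs (z - a) <= Rabs (b - a).
Proof. unfold Rmin, Rmax. destruct Rle_dec; intros; unfold Rabs; repeat destruct Rcase_abs; lra. Qed.

(** By the mean value theorem the difference quotient at [s] is [dF c s] for some [c] within [h] of
    [x]; [compact_uniform] makes [dF c s - dF x s] small for all [s] at once, however [c] depends on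
    [s]. *)
Lemma is_derive_RInt_param (F dF : R -> R -> R) (a b x : R) :
  a <= b ->
  locally x (fun y => forall s, a <= s <= b ->
    is_derive (fun z => F z s) y (dF y s) /\ continuous (F y) s) ->
  (forall s, a <= s <= b -> continuous (fun p : R * R => dF (fst p) (snd p)) (x, s)) ->
  is_derive (fun y => RInt (F y) a b) x (RInt (dF x) a b).
Proof.
  intros Hab [d Hd] Hc. apply is_derive_Reals. intros eps Heps.
  assert (He : 0 < eps / (b - a + 1)).
  { apply Rdiv_lt_0_compat; lra. }
  destruct (compact_uniform (U := R_UniformSpace) dF a b x (mkposreal _ He) Hc) as [d1 H1].
  simpl in H1.
  exists (mkposreal _ (Rmin_stable_in_posreal d d1)). simpl. intros h Hh0 Hh.
  assert (Bd : forall y, Rabs (y - x) <= Rabs h -> ball x d y /\ ball x d1 y).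
  { intros y Hy. split; apply Rle_lt_trans with (1 := Hy); apply Rlt_le_trans with (1 := Hh).
    apply Rmin_l. apply Rmin_r. }
  assert (exF : forall y, ball x d y -> ex_RInt (F y) a b).
  { intros y Hy. apply ex_RInt_cont; auto. intros z Hz. now apply Hd. }
  assert (Ex := exF x (ball_center _ _)).
  assert (Exh : ex_RInt (F (x + h)) a b).
  { apply exF. apply Bd. replace (x + h - x) with h by ring. lra. }
  assert (EdF : ex_RInt (dF x) a b).
  { apply ex_RInt_cont; auto. intros z Hz.
    exact (continuous_slice dF x z (Hc z Hz)). }
  assert (E1 := ex_RInt_lin _ _ (/ h) (- / h) a b Exh Ex).
  assert (E3 := ex_RInt_lin _ _ 1 (-1) a b E1 EdF).
  replace ((RInt (F (x + h)) a b - RInt (F x) a b) / h - RInt (dF x) a b)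
    with (RInt (fun s => 1 * (/ h * F (x + h) s + - / h * F x s) + -1 * dF x s) a b)
    by (rewrite !RInt_lin by auto; eqR; field; auto).
  eapply Rle_lt_trans.
  - apply abs_RInt_le_const with (M := eps / (b - a + 1)); auto.
    intros t Ht. left.
    assert (I : forall z, Rmin x (x + h) <= z <= Rmax x (x + h) -> Rabs (z - x) <= Rabs h).
    { intros z Hz. generalize (between_dist _ _ _ Hz). now replace (x + h - x) with h by ring. }
    destruct (MVT_derive (fun z => F z t) (fun z => dF z t) x (x + h)) as [c [Hc1 Hc2]].
    + intros z Hz. apply Hd; auto. now apply Bd, I.
    + replace (1 * (/ h * F (x + h) t + - / h * F x t) + -1 * dF x t)
        with (/ h * (F (x + h) t - F x t) - dF x t) by ring.
      rewrite Hc2. replace (/ h * (dF c t * (x + h - x)) - dF x t) with (dF c t - dF x t)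
        by (field; auto).
      apply H1; auto. now apply Bd, I.
  - now apply share_lt.
Qed.

Lemma RInt_FTC (f df : R -> R) (a b : R) :
  a <= b ->
  (forall x, a <= x <= b -> is_derive f x (df x)) ->
  (forall x, a <= x <= b -> continuous df x) ->
  RInt df a b = f b - f a.
Proof.
  intros Hab H1 H2. apply is_RInt_unique.
  apply (is_RInt_derive f df a b); rewrite Rmin_left, Rmax_right by assumption; assumption.
Qed.

(** The right side with [b] replaced by [t] vanishes at [t = a] and has derivative [RInt (F t) c d];
    the fundamental theorem of calculus then identifies it with the left side. *)
Lemma fubini (F : R -> R -> R) (a b c d : R) :
  a <= b -> c <= d ->
  (forall x y, continuous (fun p : R * R => F (fst p) (snd p)) (x, y)) ->
  RInt (fun x => RInt (fun y => F x y) c d) a b = RInt (fun y => RInt (fun x => F x y) a b) c d.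
Proof.
  intros Hab Hcd HF.
  assert (HF' : forall x y, continuous (fun p : R * R => F (snd p) (fst p)) (x, y)).
  { intros x y. apply (continuous_comp_2 (fun p : R * R => snd p) (fun p : R * R => fst p) F).
    - cont.
    - cont.
    - apply HF. }
  assert (Hin : forall x, continuous (fun x => RInt (fun y => F x y) c d) x).
  { intros x. apply (continuous_RInt_param (U := R_UniformSpace) F c d x Hcd).
    apply filter_forall. intros u s _. apply HF. }
  set (J := fun t => RInt (fun y => RInt (fun x => F x y) a t) c d).
  assert (HJ : forall t, a <= t <= b -> is_derive J t (RInt (fun y => F t y) c d)).
  { intros t Ht. unfold J.
    apply (is_derive_RInt_param (fun t y => RInt (fun x => F x y) a t) F c d t Hcd).
    - apply filter_forall. intros u s _. split.
      + apply (is_derive_RInt (V := R_NormedModule) (fun x => F x s) (fun t => RInt (fun x => F x s) a t) a u).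
        * apply filter_forall. intros z. apply (RInt_correct (V := R_CompleteNormedModule)).
          apply ex_RInt_everywhere. intros w. apply (continuous_slice (fun y x => F x y)). apply HF'.
        * apply (continuous_slice (fun y x => F x y)). apply HF'.
      (* [continuous_RInt_param] wants ordered end points, so the case [u < a] goes through the
         reversed integral. *)
      + destruct (Rle_dec a u) as [Hu|Hu].
        * apply (continuous_RInt_param (U := R_UniformSpace) (fun y x => F x y) a u s Hu).
          apply filter_forall. intros z w _. apply HF'.
        * apply continuous_ext with (fun y => - RInt (fun x => F x y) u a).
          { intros y. apply (RInt_R_swap (fun x => F x y) u a), ex_RInt_everywhere.
            intros w. apply (continuous_slice (fun y x => F x y)). apply HF'. }
          apply continuous_R_opp.
          apply (continuous_RInt_param (U := R_UniformSpace) (fun y x => F x y) u a s). lra.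
          apply filter_forall. intros z w _. apply HF'.
    - intros s _. apply HF. }
  rewrite (RInt_FTC J _ a b Hab HJ).
  - unfold J. rewrite (RInt_ext_R (fun y => RInt (fun x => F x y) a a) (fun _ => 0)).
    + rewrite RInt_constant. eqR. ring.
    + intros y. apply (RInt_point (V := R_CompleteNormedModule)).
  - intros x _. apply Hin.
Qed.

(** The radius attached to [(u, v)] is also kept below [1 / (1 + |F u v|)], so that the uniform
    lower bound [e] of the radii used bounds [|F|] at their centres by [1 / e]. *)
Lemma bounded_rectangle (F : R -> R -> R) (a b c d : R) :
  (forall x y, continuous (fun p : R * R => F (fst p) (snd p)) (x, y)) ->
  exists M, 0 < M /\ forall x y, a <= x <= b -> c <= y <= d -> Rabs (F x y) <= M.
Proof.
  intros HF.
  assert (Hd : forall u v, exists e : posreal, (forall x y, Rabs (x - u) < e -> Rabs (y - v) < e ->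
     Rabs (F x y - F u v) < 1) /\ e * (1 + Rabs (F u v)) <= 1).
  { intros u v. destruct (proj1 (continuous_R_eps _ _) (HF u v) (mkposreal 1 Rlt_0_1)) as [e He].
    simpl in He. assert (Hp : 0 < / (1 + Rabs (F u v))).
    { apply Rinv_0_lt_compat. generalize (Rabs_pos (F u v)); lra. }
    exists (mkposreal _ (Rmin_stable_in_posreal e (mkposreal _ Hp))). simpl. split.
    - intros x y Hx Hy. apply (He (x, y)). split; eapply Rlt_le_trans; eauto using Rmin_l.
    - assert (0 < 1 + Rabs (F u v)) by (generalize (Rabs_pos (F u v)); lra).
      apply Rle_trans with (/ (1 + Rabs (F u v)) * (1 + Rabs (F u v))).
      + apply Rmult_le_compat_r. lra. apply Rmin_r.
      + right. field. lra. }
  set (delta := fun u v => proj1_sig (constructive_indefinite_description _ (Hd u v))).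
  assert (Hdelta : forall u v, (forall x y, Rabs (x - u) < delta u v -> Rabs (y - v) < delta u v ->
     Rabs (F x y - F u v) < 1) /\ delta u v * (1 + Rabs (F u v)) <= 1)
    by (intros u v; exact (proj2_sig (constructive_indefinite_description _ (Hd u v)))).
  destruct (compactness_value_2d a b c d delta) as [e Hc].
  exists (1 + / e). assert (Hpe := cond_pos e). assert (Hie := Rinv_0_lt_compat _ Hpe).
  split. lra.
  intros x y Hx Hy. destruct (Rle_dec (Rabs (F x y)) (1 + / e)) as [|Hn]; [assumption|exfalso].
  apply (Hc x y Hx Hy). intros (u & v & _ & _ & Hxu & Hyv & Hde). apply Hn.
  destruct (Hdelta u v) as [H1 H2]. specialize (H1 x y Hxu Hyv).
  assert (Rabs (F u v) <= / e).
  { apply Rmult_le_reg_l with e. lra. rewrite Rinv_r by lra.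
    assert (P := Rabs_pos (F u v)). nra. }
  replace (F x y) with (F x y - F u v + F u v) by ring.
  eapply Rle_trans. apply Rabs_triang. lra.
Qed.

Lemma is_derive_eq (f : R -> R) (x l l' : R) : is_derive f x l -> l = l' -> is_derive f x l'.
Proof. now intros H <-. Qed.

Lemma is_derive_R_const (c x : R) : is_derive (fun _ => c) x 0.
Proof. exact (is_derive_const (K := R_AbsRing) (V := R_NormedModule) c x). Qed.

Lemma is_derive_R_plus (f g : R -> R) (x l m : R) :
  is_derive f x l -> is_derive g x m -> is_derive (fun t => f t + g t) x (l + m).
Proof. exact (is_derive_plus (V := R_NormedModule) f g x l m). Qed.

Lemma is_derive_R_opp (f : R -> R) (x l : R) :
  is_derive f x l -> is_derive (fun t => - f t) x (- l).
Proof. exact (is_derive_opp (V := R_NormedModule) f x l). Qed.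

Lemma is_derive_R_pow (n : nat) (x : R) : is_derive (fun t => t ^ n) x (INR n * x ^ pred n).
Proof.
  eapply is_derive_eq.
  - apply (is_derive_pow (fun t => t) n x 1). apply (is_derive_id (K := R_AbsRing)).
  - ring.
Qed.

Lemma is_derive_R_minus (f g : R -> R) (x l m : R) :
  is_derive f x l -> is_derive g x m -> is_derive (fun t => f t - g t) x (l - m).
Proof. exact (is_derive_minus (V := R_NormedModule) f g x l m). Qed.

Lemma is_derive_R_mult (f g : R -> R) (x l m : R) :
  is_derive f x l -> is_derive g x m -> is_derive (fun t => f t * g t) x (l * g x + f x * m).
Proof.
  intros Hf Hg. apply is_derive_Reals. apply derivable_pt_lim_mult; now apply is_derive_Reals.
Qed.

Lemma is_derive_R_comp (f g : R -> R) (x l m : R) :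
  is_derive f (g x) l -> is_derive g x m -> is_derive (fun t => f (g t)) x (l * m).
Proof.
  intros Hf Hg. apply is_derive_Reals. apply (derivable_pt_lim_comp g f); now apply is_derive_Reals.
Qed.

(** * Legendre polynomials *)

(* [P n], [P n'] and [P n''], generated simultaneously by the two-term recursions
   [P' (n+1) = (n+1) P n + u P' n] and [(n+1) P (n+1) = (n+1) u P n + (u^2-1) P' n]. *)
Fixpoint leg_jet (n : nat) (u : R) : R * R * R :=
  match n with
  | O => (1, 0, 0)
  | S m =>
    let '(p, d, e) := leg_jet m u in
    (u * p + (u ^ 2 - 1) * d / (INR m + 1), (INR m + 1) * p + u * d, (INR m + 2) * d + u * e)
  end.

Definition leg (n : nat) (u : R) : R := fst (fst (leg_jet n u)).
Definition leg' (n : nat) (u : R) : R := snd (fst (leg_jet n u)).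
Definition leg'' (n : nat) (u : R) : R := snd (leg_jet n u).

Lemma leg_S (n : nat) (u : R) :
  leg (S n) u = u * leg n u + (u ^ 2 - 1) * leg' n u / (INR n + 1).
Proof. unfold leg, leg'; simpl. now destruct (leg_jet n u) as [[p d] e]. Qed.

Lemma leg'_S (n : nat) (u : R) : leg' (S n) u = (INR n + 1) * leg n u + u * leg' n u.
Proof. unfold leg, leg'; simpl. now destruct (leg_jet n u) as [[p d] e]. Qed.

Lemma leg''_S (n : nat) (u : R) : leg'' (S n) u = (INR n + 2) * leg' n u + u * leg'' n u.
Proof. unfold leg'', leg'; simpl. now destruct (leg_jet n u) as [[p d] e]. Qed.

(** The three claims go through one induction: differentiating the recursion for [leg (S n)]
    produces [(1 - u^2) leg'' n], which Legendre's equation at [n] reduces to the recursion for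
    [leg']. *)
Lemma legendre_ode (n : nat) (u : R) :
  is_derive (leg n) u (leg' n u) /\ is_derive (leg' n) u (leg'' n u) /\
  (1 - u ^ 2) * leg'' n u = 2 * u * leg' n u - INR n * (INR n + 1) * leg n u.
Proof.
  revert u. induction n as [|n IH]; intros u.
  - split; [|split].
    + exact (is_derive_R_const 1 u).
    + exact (is_derive_R_const 0 u).
    + unfold leg, leg', leg''; simpl. ring.
  - destruct (IH u) as (H1 & H2 & H3). assert (Hn := pos_INR n).
    assert (X1 : ex_derive (leg n) u) by (eexists; exact H1).
    assert (X2 : ex_derive (leg' n) u) by (eexists; exact H2).
    assert (Y1 := is_derive_unique _ _ _ H1). assert (Y2 := is_derive_unique _ _ _ H2).
    split; [|split].
    + apply (is_derive_ext (fun u => u * leg n u + (u ^ 2 - 1) * leg' n u / (INR n + 1))).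
      { intros t. now rewrite leg_S. }
      auto_derive; [tauto|].
      change (fun x => leg n x) with (leg n). change (fun x => leg' n x) with (leg' n).
      rewrite Y1, Y2, leg'_S.
      transitivity (leg n u + u * leg' n u
        + (2 * u * leg' n u - (1 - u ^ 2) * leg'' n u) / (INR n + 1)); [field; lra|].
      rewrite H3. field. lra.
    + apply (is_derive_ext (fun u => (INR n + 1) * leg n u + u * leg' n u)).
      { intros t. now rewrite leg'_S. }
      auto_derive; [tauto|].
      change (fun x => leg n x) with (leg n). change (fun x => leg' n x) with (leg' n).
      rewrite Y1, Y2, leg''_S. ring.
    + rewrite leg''_S, leg'_S, leg_S, S_INR.
      replace ((1 - u ^ 2) * ((INR n + 2) * leg' n u + u * leg'' n u))
        with ((1 - u ^ 2) * (INR n + 2) * leg' n u + u * ((1 - u ^ 2) * leg'' n u)) by ring.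
      rewrite H3. field. lra.
Qed.

Lemma leg_derive (n : nat) (u : R) : is_derive (leg n) u (leg' n u).
Proof. apply legendre_ode. Qed.

Lemma leg'_derive (n : nat) (u : R) : is_derive (leg' n) u (leg'' n u).
Proof. apply legendre_ode. Qed.

Lemma leg_continuous (n : nat) (u : R) : continuous (leg n) u.
Proof. exact (is_derive_continuous _ _ _ (leg_derive n u)). Qed.

Lemma leg'_continuous (n : nat) (u : R) : continuous (leg' n) u.
Proof. exact (is_derive_continuous _ _ _ (leg'_derive n u)). Qed.

Lemma leg''_continuous (n : nat) (u : R) : continuous (leg'' n) u.
Proof.
  revert u. induction n as [|n IH]; intros u.
  - apply (continuous_ext (fun _ => 0)); [reflexivity|]. apply continuous_const.
  - eapply continuous_ext; [intros t; symmetry; apply leg''_S | cont]. apply leg'_continuous.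
Qed.

#[export] Hint Resolve leg_continuous leg'_continuous leg''_continuous : cont.

Lemma leg_at_1 (n : nat) : leg n 1 = 1.
Proof.
  induction n as [|n IH]; [reflexivity|]. rewrite leg_S, IH.
  generalize (pos_INR n); intros. field. lra.
Qed.

(** Squaring hides the sign [(-1)^n]. *)
Lemma leg_at_m1 (n : nat) : leg n (-1) ^ 2 = 1.
Proof.
  induction n as [|n IH]; [unfold leg; simpl; ring|]. rewrite leg_S.
  replace ((-1) ^ 2 - 1) with 0 by ring.
  generalize (pos_INR n); intros. rewrite <- IH. field. lra.
Qed.

Lemma bonnet (n : nat) (u : R) :
  (INR n + 2) * leg (S (S n)) u = (2 * INR n + 3) * u * leg (S n) u - (INR n + 1) * leg n u.
Proof.
  generalize (pos_INR n); intros Hn.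
  assert (H : (u ^ 2 - 1) * leg' n u = (INR n + 1) * (leg (S n) u - u * leg n u)).
  { rewrite leg_S. field. lra. }
  rewrite (leg_S (S n)), leg'_S, S_INR.
  replace ((INR n + 2) * (u * leg (S n) u +
    (u ^ 2 - 1) * ((INR n + 1) * leg n u + u * leg' n u) / (INR n + 1 + 1)))
    with ((INR n + 2) * u * leg (S n) u + (u ^ 2 - 1) * (INR n + 1) * leg n u
          + u * ((u ^ 2 - 1) * leg' n u)) by (field; lra).
  rewrite H. ring.
Qed.

(** At [n = 0] the convention [pred 0 = 0] is absorbed by the factor [INR n]. *)
Lemma leg_mult_id (n : nat) (u : R) :
  (2 * INR n + 1) * (u * leg n u) = (INR n + 1) * leg (S n) u + INR n * leg (pred n) u.
Proof.
  destruct n as [|n].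
  - simpl. rewrite leg_S. unfold leg, leg'; simpl. field.
  - generalize (bonnet n u). rewrite S_INR. simpl pred. lra.
Qed.

(* Sonin's function [n(n+1) P^2 + (1-u^2) P'^2] has derivative [2 u P'^2] by Legendre's equation,
   hence on [-1,1] it is maximal at the end points. *)
Lemma sonin_bound (n : nat) (u : R) : -1 <= u <= 1 ->
  INR n * (INR n + 1) * leg n u ^ 2 + (1 - u ^ 2) * leg' n u ^ 2 <= INR n * (INR n + 1).
Proof.
  set (G := fun u => INR n * (INR n + 1) * leg n u ^ 2 + (1 - u ^ 2) * leg' n u ^ 2).
  assert (HG : forall u, is_derive G u (2 * u * leg' n u ^ 2)).
  { intros t. unfold G.
    assert (X1 : ex_derive (leg n) t) by (eexists; apply leg_derive).
    assert (X2 : ex_derive (leg' n) t) by (eexists; apply leg'_derive).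
    auto_derive; [tauto|].
    change (fun x => leg n x) with (leg n). change (fun x => leg' n x) with (leg' n).
    rewrite (is_derive_unique _ _ _ (leg_derive n t)), (is_derive_unique _ _ _ (leg'_derive n t)).
    destruct (legendre_ode n t) as (_ & _ & E).
    transitivity (2 * INR n * (INR n + 1) * leg n t * leg' n t - 2 * t * leg' n t ^ 2
      + 2 * leg' n t * ((1 - t ^ 2) * leg'' n t)); [ring|]. rewrite E. ring. }
  assert (HM : forall a b, exists c, Rmin a b <= c <= Rmax a b /\ G b - G a = 2 * c * leg' n c ^ 2 * (b - a)).
  { intros a b. apply (MVT_derive G (fun u => 2 * u * leg' n u ^ 2)). intros; apply HG. }
  intros Hu. change (G u <= INR n * (INR n + 1)).
  destruct (Rle_dec 0 u) as [H0|H0].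
  - destruct (HM u 1) as (c & Hc & E). rewrite Rmin_left in Hc by lra.
    replace (G 1) with (INR n * (INR n + 1)) in E by (unfold G; rewrite leg_at_1; ring).
    assert (0 <= c * leg' n c ^ 2 * (1 - u)).
    { apply Rmult_le_pos; [|lra]. apply Rmult_le_pos; [lra|]. apply pow2_ge_0. }
    lra.
  - destruct (HM (-1) u) as (c & Hc & E). rewrite Rmax_right in Hc by lra.
    replace (G (-1)) with (INR n * (INR n + 1)) in E by (unfold G; rewrite leg_at_m1; ring).
    assert (0 <= (- c) * leg' n c ^ 2 * (u - -1)).
    { apply Rmult_le_pos; [|lra]. apply Rmult_le_pos; [lra|]. apply pow2_ge_0. }
    lra.
Qed.

(** Sonin's inequality without its derivative term, divided by [n(n+1)]; degree 0, where this factor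
    vanishes, is the constant 1. *)
Lemma leg_le_1 (n : nat) (u : R) : -1 <= u <= 1 -> Rabs (leg n u) <= 1.
Proof.
  intros Hu. destruct n as [|n].
  - unfold leg; simpl. rewrite Rabs_R1. lra.
  - assert (H := sonin_bound (S n) u Hu).
    assert (Hn := pos_INR n). rewrite S_INR in H.
    assert (0 <= (1 - u ^ 2) * leg' (S n) u ^ 2).
    { apply Rmult_le_pos; [nra | apply pow2_ge_0]. }
    rewrite <- (Rabs_R1). apply Rsqr_le_abs_0. unfold Rsqr. nra.
Qed.

(* [(k+1) ((1+u)/2)^k = sum_N (2N+1) kernel_coef k N * P N u];
   in closed form [kernel_coef k N = k! (k+1)! / ((k-N)! (k+N+1)!)]. *)
Fixpoint kernel_coef (k N : nat) : R :=
  match N with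
  | O => 1
  | S M => kernel_coef k M * ((INR k - INR M) / (INR k + INR M + 2))
  end.

Lemma kernel_coef_0 (k N : nat) : (k < N)%nat -> kernel_coef k N = 0.
Proof.
  induction N as [|N IH]; intros H; [lia|]. simpl.
  destruct (Nat.eq_dec k N) as [->|Hk].
  - replace (INR N - INR N) with 0 by ring. unfold Rdiv. ring.
  - rewrite IH by lia. ring.
Qed.

Lemma kernel_coef_bound (k N : nat) : 0 <= kernel_coef k N <= 1.
Proof.
  destruct (le_lt_dec N k) as [H|H]; [|rewrite kernel_coef_0 by assumption; lra].
  induction N as [|N IH]; simpl; [lra|].
  assert (H' : (N <= k)%nat) by lia. specialize (IH H').
  assert (HN : INR N <= INR k) by now apply le_INR.
  assert (0 <= INR N) by apply pos_INR.
  assert (0 <= (INR k - INR N) / (INR k + INR N + 2) <= 1).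
  { split.
    - apply Rdiv_le_0_compat; lra.
    - apply Rmult_le_reg_r with (INR k + INR N + 2); [lra|]. field_simplify; lra. }
  nra.
Qed.

Lemma kernel_coef_SS (k N : nat) :
  kernel_coef (S k) (S N) =
  kernel_coef k N * ((INR k + 1) * (INR k + 2) / ((INR k + INR N + 2) * (INR k + INR N + 3))).
Proof.
  assert (Hk := pos_INR k).
  induction N as [|N IH].
  - cbn [kernel_coef]. rewrite S_INR. simpl (INR 0). field. lra.
  - assert (HN := pos_INR N).
    change (kernel_coef (S k) (S (S N))) with
      (kernel_coef (S k) (S N) * ((INR (S k) - INR (S N)) / (INR (S k) + INR (S N) + 2))).
    rewrite IH. cbn [kernel_coef]. rewrite !S_INR. field. lra.
Qed.

(** Compares the coefficients of [P_N] when the expansion of [((1+u)/2)^k] is multiplied by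
    [(1+u)/2] and each [u P_j] is expanded by [leg_mult_id]: the neighbours [N-1] and [N+1]
    contribute with factors [N] and [N+1]. *)
Lemma kernel_coef_rec (k N : nat) :
  (2 * INR N + 1) * kernel_coef (S k) N / (INR k + 2) =
  ((2 * INR N + 1) * kernel_coef k N + INR N * kernel_coef k (pred N)
   + (INR N + 1) * kernel_coef k (S N)) / (2 * (INR k + 1)).
Proof.
  assert (Hk := pos_INR k).
  destruct N as [|N].
  - cbn [kernel_coef pred]. simpl (INR 0). field. lra.
  - assert (HN := pos_INR N). rewrite kernel_coef_SS. cbn [kernel_coef pred].
    rewrite !S_INR. field. lra.
Qed.

Definition kernel_sum (k M : nat) (u : R) : R :=
  sum_f_R0 (fun N => (2 * INR N + 1) * kernel_coef k N / (INR k + 1) * leg N u) M.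

(** Truncation at degree [M] leaves a boundary term, kept explicit so that the identity goes by
    induction on [M]; it vanishes once [M > k]. *)
Lemma kernel_sum_step (k M : nat) (u : R) :
  kernel_sum (S k) M u = (1 + u) / 2 * kernel_sum k M u
    + (INR M + 1) * (kernel_coef k (S M) * leg M u - kernel_coef k M * leg (S M) u)
      / (2 * (INR k + 1)).
Proof.
  assert (Hk := pos_INR k). unfold kernel_sum.
  assert (T : forall N, (2 * INR N + 1) * kernel_coef (S k) N / (INR (S k) + 1) * leg N u
    = ((2 * INR N + 1) * kernel_coef k N + INR N * kernel_coef k (pred N)
   + (INR N + 1) * kernel_coef k (S N)) / (2 * (INR k + 1)) * leg N u).
  { intros N. rewrite <- kernel_coef_rec, S_INR. field. lra. }
  induction M as [|M IH].
  - cbv beta iota delta [sum_f_R0]. rewrite T.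
    assert (L0 : leg 0 u = 1) by reflexivity.
    assert (L1 : leg 1 u = u) by (rewrite leg_S; unfold leg, leg'; simpl; field).
    rewrite L0, L1. cbn [kernel_coef pred]. simpl (INR 0). field. lra.
  - rewrite !tech5, IH. cbv beta. rewrite T.
    assert (L := leg_mult_id (S M) u). simpl pred in *.
    rewrite !S_INR in *.
    assert (HM := pos_INR M).
    set (a := kernel_coef k M). set (b := kernel_coef k (S M)). set (c := kernel_coef k (S (S M))).
    set (s := sum_f_R0 _ M).
    set (p0 := leg M u) in *. set (p1 := leg (S M) u) in *. set (p2 := leg (S (S M)) u) in *.
    assert (L' : (INR M + 2) * p2 = (2 * INR M + 3) * (u * p1) - (INR M + 1) * p0) by lra.
    transitivity ((1 + u) / 2 * s + ((2 * INR M + 3) * b * (1 + u) * p1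
      + (INR M + 2) * c * p1 - b * ((2 * INR M + 3) * (u * p1) - (INR M + 1) * p0))
      / (2 * (INR k + 1))).
    + field. lra.
    + rewrite <- L'. field. lra.
Qed.

Lemma kernel_expansion (k : nat) (u : R) : ((1 + u) / 2) ^ k = kernel_sum k k u.
Proof.
  (* Every [M >= k] is allowed because the step from [k] to [S k] keeps the truncation degree
     [M]. *)
  assert (H : forall M, (k <= M)%nat -> ((1 + u) / 2) ^ k = kernel_sum k M u).
  { induction k as [|k IH]; intros M HM.
    - unfold kernel_sum. induction M as [|M IHM].
      + simpl. unfold leg; simpl. field.
      + rewrite tech5, <- IHM by lia. rewrite (kernel_coef_0 0 (S M)) by lia.
        simpl. unfold Rdiv. ring.
    - rewrite kernel_sum_step, <- IH by lia.
      rewrite (kernel_coef_0 k (S M)), (kernel_coef_0 k M) by lia.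
      simpl. unfold Rdiv. ring. }
  now apply H.
Qed.

(** * Integration over the unit sphere *)

Inductive axis := X0 | X1 | X2.

Definition dot (x y : axis -> R) : R := x X0 * y X0 + x X1 * y X1 + x X2 * y X2.

Definition dir (th ph : R) (i : axis) : R :=
  match i with X0 => cos th | X1 => sin th * cos ph | X2 => sin th * sin ph end.

Definition cont2 (k : R -> R -> R) : Prop :=
  forall x y, continuous (fun p : R * R => k (fst p) (snd p)) (x, y).

Definition sphere_int (k : R -> R -> R) : R :=
  RInt (fun th => RInt (fun ph => sin th * k th ph) 0 (2 * PI)) 0 PI.

Lemma dir_norm (th ph : R) : dot (dir th ph) (dir th ph) = 1.
Proof.
  unfold dot, dir. assert (H := sin_cos_sqr th). assert (H' := sin_cos_sqr ph).
  transitivity (cos th * cos th + sin th * sin th * (sin ph * sin ph + cos ph * cos ph)); [ring|].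
  rewrite H'. lra.
Qed.

Lemma cont2_const (c : R) : cont2 (fun _ _ => c).
Proof. intros x y. apply continuous_const. Qed.

Lemma cont2_l (f : R -> R) : (forall x, continuous f x) -> cont2 (fun x _ => f x).
Proof. intros H x y. apply continuous_R_comp; [apply continuous_fst | exact H]. Qed.

Lemma cont2_r (f : R -> R) : (forall x, continuous f x) -> cont2 (fun _ y => f y).
Proof. intros H x y. apply continuous_R_comp; [apply continuous_snd | exact H]. Qed.

Lemma cont2_mult (k l : R -> R -> R) : cont2 k -> cont2 l -> cont2 (fun x y => k x y * l x y).
Proof. intros H1 H2 x y. now apply continuous_R_mult. Qed.

Lemma cont2_plus (k l : R -> R -> R) : cont2 k -> cont2 l -> cont2 (fun x y => k x y + l x y).
Proof. intros H1 H2 x y. now apply continuous_R_plus. Qed.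

Lemma cont2_minus (k l : R -> R -> R) : cont2 k -> cont2 l -> cont2 (fun x y => k x y - l x y).
Proof. intros H1 H2 x y. now apply continuous_R_minus. Qed.

Lemma cont2_opp (k : R -> R -> R) : cont2 k -> cont2 (fun x y => - k x y).
Proof. intros H1 x y. now apply continuous_R_opp. Qed.

Lemma cont2_comp (f : R -> R) (k : R -> R -> R) :
  (forall x, continuous f x) -> cont2 k -> cont2 (fun x y => f (k x y)).
Proof. intros H1 H2 x y. now apply continuous_R_comp. Qed.

Ltac cont2s :=
  lazymatch goal with
  | |- cont2 (fun _ _ => ?c) => apply cont2_const
  | |- cont2 (fun x _ => @?f x) => apply (cont2_l f); intros; cont
  | |- cont2 (fun _ y => @?f y) => apply (cont2_r f); intros; cont
  | |- cont2 (fun x y => @?k x y + @?l x y) => apply (cont2_plus k l); cont2s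
  | |- cont2 (fun x y => @?k x y - @?l x y) => apply (cont2_minus k l); cont2s
  | |- cont2 (fun x y => @?k x y * @?l x y) => apply (cont2_mult k l); cont2s
  | |- cont2 (fun x y => - @?k x y) => apply (cont2_opp k); cont2s
  | |- cont2 (fun x y => dot (@?k x y) (@?l x y)) => unfold dot; cont2s
  | _ => auto with cont
  end.

Lemma cont2_dir (i : axis) : cont2 (fun th ph => dir th ph i).
Proof. destruct i; simpl; cont2s. Qed.

#[export] Hint Resolve cont2_dir cont2_comp : cont.

Lemma cont2_slice_r (k : R -> R -> R) (x y : R) : cont2 k -> continuous (k x) y.
Proof. intros H. apply continuous_slice, H. Qed.

Lemma cont2_RInt (k : R -> R -> R) (a b : R) : a <= b -> cont2 k ->
  forall x, continuous (fun x => RInt (k x) a b) x.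
Proof.
  intros Hab H x. apply (continuous_RInt_param (U := R_UniformSpace)); auto.
  apply filter_forall. intros u s _. apply H.
Qed.

Lemma ex_RInt_cont2 (k : R -> R -> R) (x a b : R) : cont2 k -> ex_RInt (k x) a b.
Proof. intros H. apply ex_RInt_everywhere. intros z. now apply cont2_slice_r. Qed.

Lemma two_PI_pos : 0 <= 2 * PI.
Proof. generalize PI_RGT_0; lra. Qed.

Lemma PI_nonneg : 0 <= PI.
Proof. generalize PI_RGT_0; lra. Qed.

Lemma cont2_weight (k : R -> R -> R) : cont2 k -> cont2 (fun th ph => sin th * k th ph).
Proof. intros H. cont2s. Qed.

Lemma ex_sphere_inner (k : R -> R -> R) : cont2 k ->
  ex_RInt (fun th => RInt (fun ph => sin th * k th ph) 0 (2 * PI)) 0 PI.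
Proof.
  intros H. apply ex_RInt_cont. apply PI_nonneg. intros z _.
  apply cont2_RInt. apply two_PI_pos. now apply cont2_weight.
Qed.

Lemma sphere_int_ext (k l : R -> R -> R) :
  (forall th ph, k th ph = l th ph) -> sphere_int k = sphere_int l.
Proof.
  intros H. unfold sphere_int. apply RInt_ext_R. intros th. apply RInt_ext_R. intros ph.
  now rewrite H.
Qed.

Lemma sphere_int_lin (k l : R -> R -> R) (a b : R) : cont2 k -> cont2 l ->
  sphere_int (fun th ph => a * k th ph + b * l th ph) = a * sphere_int k + b * sphere_int l.
Proof.
  intros Hk Hl. unfold sphere_int.
  rewrite <- RInt_lin by now apply ex_sphere_inner.
  apply RInt_ext_R. intros th.
  rewrite <- (RInt_lin (fun ph => sin th * k th ph) (fun ph => sin th * l th ph))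
    by now apply ex_RInt_cont2 with (k := fun th ph => sin th * _ th ph), cont2_weight.
  apply RInt_ext_R. intros ph. ring.
Qed.

Lemma sphere_int_scal (k : R -> R -> R) (a : R) : cont2 k ->
  sphere_int (fun th ph => a * k th ph) = a * sphere_int k.
Proof.
  intros Hk. rewrite <- (Rplus_0_r (a * _)), <- (Rmult_0_l (sphere_int k)), <- sphere_int_lin by auto.
  apply sphere_int_ext. intros; ring.
Qed.

Lemma sphere_int_plus (k l : R -> R -> R) : cont2 k -> cont2 l ->
  sphere_int (fun th ph => k th ph + l th ph) = sphere_int k + sphere_int l.
Proof.
  intros Hk Hl. rewrite <- (Rmult_1_l (sphere_int k)), <- (Rmult_1_l (sphere_int l)), <- sphere_int_lin by auto.
  apply sphere_int_ext. intros; ring.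
Qed.

Lemma sphere_int_minus (k l : R -> R -> R) : cont2 k -> cont2 l ->
  sphere_int (fun th ph => k th ph - l th ph) = sphere_int k - sphere_int l.
Proof.
  intros Hk Hl. transitivity (1 * sphere_int k + (-1) * sphere_int l); [|ring].
  rewrite <- sphere_int_lin by auto.
  apply sphere_int_ext. intros; ring.
Qed.

Lemma sphere_int_opp (k : R -> R -> R) : cont2 k ->
  sphere_int (fun th ph => - k th ph) = - sphere_int k.
Proof.
  intros Hk. transitivity ((-1) * sphere_int k); [|ring].
  rewrite <- sphere_int_scal by auto. apply sphere_int_ext. intros; ring.
Qed.

Lemma sphere_int_const (c : R) : sphere_int (fun _ _ => c) = 4 * PI * c.
Proof.
  unfold sphere_int. rewrite (RInt_ext_R _ (fun th => 2 * PI * c * sin th)).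
  - rewrite (RInt_FTC (fun th => - (2 * PI * c) * cos th) (fun th => 2 * PI * c * sin th)).
    + rewrite cos_PI, cos_0. ring.
    + apply PI_nonneg.
    + intros x _. auto_derive; trivial. ring.
    + intros x _. cont.
  - intros th. etransitivity; [apply RInt_constant | simpl; ring].
Qed.

Lemma sphere_int_le (k l : R -> R -> R) : cont2 k -> cont2 l ->
  (forall th ph, 0 <= th <= PI -> 0 <= ph <= 2 * PI -> k th ph <= l th ph) ->
  sphere_int k <= sphere_int l.
Proof.
  intros Hk Hl H. unfold sphere_int. apply RInt_le; try now apply ex_sphere_inner. apply PI_nonneg.
  intros th Hth. apply RInt_le.
  - apply two_PI_pos.
  - apply (ex_RInt_cont2 (fun th ph => sin th * k th ph)). now apply cont2_weight.
  - apply (ex_RInt_cont2 (fun th ph => sin th * l th ph)). now apply cont2_weight.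
  - intros ph Hph. apply Rmult_le_compat_l. apply sin_ge_0; lra. apply H; lra.
Qed.

Lemma sphere_int_abs_le (k l : R -> R -> R) : cont2 k -> cont2 l ->
  (forall th ph, 0 <= th <= PI -> 0 <= ph <= 2 * PI -> Rabs (k th ph) <= l th ph) ->
  Rabs (sphere_int k) <= sphere_int l.
Proof.
  intros Hk Hl H. apply Rabs_le. split.
  - rewrite <- sphere_int_opp by auto. apply sphere_int_le; auto. cont2s.
    intros th ph H1 H2. generalize (H th ph H1 H2) (Rle_abs (- k th ph)).
    rewrite Rabs_Ropp. lra.
  - apply sphere_int_le; auto. intros th ph H1 H2.
    generalize (H th ph H1 H2) (Rle_abs (k th ph)). lra.
Qed.

Lemma sphere_int_abs_const (k : R -> R -> R) (M : R) : cont2 k ->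
  (forall th ph, 0 <= th <= PI -> 0 <= ph <= 2 * PI -> Rabs (k th ph) <= M) ->
  Rabs (sphere_int k) <= 4 * PI * M.
Proof.
  intros Hk H. rewrite <- sphere_int_const. apply sphere_int_abs_le; auto. cont2s.
Qed.

(* [g] is the gradient of some extension of the function [G] on the sphere to a neighbourhood;
   the two derivatives are the chain rule along the meridians and the parallels. *)
Definition smooth (G : R -> R -> R) (g : axis -> R -> R -> R) : Prop :=
  cont2 G /\ (forall i, cont2 (g i)) /\
  (forall th ph, is_derive (fun u => G u ph) th
     (- sin th * g X0 th ph + cos th * cos ph * g X1 th ph + cos th * sin ph * g X2 th ph)) /\
  (forall th ph, is_derive (fun u => G th u) ph
     (- sin th * sin ph * g X1 th ph + sin th * cos ph * g X2 th ph)) /\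
  (forall th, G th (2 * PI) = G th 0).

Lemma smooth_const (c : R) : smooth (fun _ _ => c) (fun _ _ _ => 0).
Proof.
  split; [apply cont2_const|]. split; [intros; apply cont2_const|].
  split; [|split]; intros; trivial; auto_derive; trivial; ring.
Qed.

Lemma smooth_dir (j : axis) :
  smooth (fun th ph => dir th ph j)
    (fun i _ _ => match i, j with X0, X0 => 1 | X1, X1 => 1 | X2, X2 => 1 | _, _ => 0 end).
Proof.
  split; [apply cont2_dir|]. split; [intros; apply cont2_const|].
  destruct j; (split; [|split]); intros; simpl; try (auto_derive; trivial; ring); trivial.
  - now rewrite cos_2PI, cos_0.
  - now rewrite sin_2PI, sin_0.
Qed.

Lemma smooth_plus (F G : R -> R -> R) (f g : axis -> R -> R -> R) :
  smooth F f -> smooth G g ->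
  smooth (fun th ph => F th ph + G th ph) (fun i th ph => f i th ph + g i th ph).
Proof.
  intros (F1 & F2 & F3 & F4 & F5) (G1 & G2 & G3 & G4 & G5).
  split; [cont2s|]. split; [intros; cont2s|].
  split; [|split].
  - intros th ph. eapply is_derive_eq; [exact (is_derive_R_plus _ _ _ _ _ (F3 th ph) (G3 th ph)) | ring].
  - intros th ph. eapply is_derive_eq; [exact (is_derive_R_plus _ _ _ _ _ (F4 th ph) (G4 th ph)) | ring].
  - intros th. now rewrite F5, G5.
Qed.

Lemma smooth_mult (F G : R -> R -> R) (f g : axis -> R -> R -> R) :
  smooth F f -> smooth G g ->
  smooth (fun th ph => F th ph * G th ph) (fun i th ph => f i th ph * G th ph + F th ph * g i th ph).
Proof.
  intros (F1 & F2 & F3 & F4 & F5) (G1 & G2 & G3 & G4 & G5).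
  split; [cont2s|]. split; [intros; cont2s|].
  split; [|split].
  - intros th ph. eapply is_derive_eq; [exact (is_derive_R_mult _ _ _ _ _ (F3 th ph) (G3 th ph)) | cbv beta; ring].
  - intros th ph. eapply is_derive_eq; [exact (is_derive_R_mult _ _ _ _ _ (F4 th ph) (G4 th ph)) | cbv beta; ring].
  - intros th. now rewrite F5, G5.
Qed.

Lemma smooth_comp (p p' : R -> R) (G : R -> R -> R) (g : axis -> R -> R -> R) :
  (forall u, is_derive p u (p' u)) -> (forall u, continuous p' u) -> smooth G g ->
  smooth (fun th ph => p (G th ph)) (fun i th ph => p' (G th ph) * g i th ph).
Proof.
  intros Hp Hc (G1 & G2 & G3 & G4 & G5).
  split; [apply cont2_comp; auto; intros u; exact (is_derive_continuous _ _ _ (Hp u))|].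
  split; [intros; cont2s|].
  split; [|split].
  - intros th ph. eapply is_derive_eq;
    [exact (is_derive_R_comp p (fun u => G u ph) _ _ _ (Hp _) (G3 th ph)) | cbv beta; ring].
  - intros th ph. eapply is_derive_eq;
    [exact (is_derive_R_comp p (fun u => G th u) _ _ _ (Hp _) (G4 th ph)) | cbv beta; ring].
  - intros th. now rewrite G5.
Qed.

Lemma smooth_ext (G G' : R -> R -> R) (g g' : axis -> R -> R -> R) :
  (forall th ph, G th ph = G' th ph) -> (forall i th ph, g i th ph = g' i th ph) ->
  smooth G g -> smooth G' g'.
Proof.
  intros E e (G1 & G2 & G3 & G4 & G5).
  split; [|split; [|split; [|split]]].
  - intros x y. eapply continuous_ext; [|apply G1]. intros; apply E.
  - intros i x y. eapply continuous_ext; [|apply (G2 i)]. intros; apply e.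
  - intros th ph. rewrite <- !e. eapply is_derive_ext; [|apply G3]. intros; apply E.
  - intros th ph. rewrite <- !e. eapply is_derive_ext; [|apply G4]. intros; apply E.
  - intros th. rewrite <- !E. apply G5.
Qed.

Lemma smooth_dot (x : axis -> R) : smooth (fun th ph => dot x (dir th ph)) (fun i _ _ => x i).
Proof.
  unfold dot.
  eapply smooth_ext; [intros; reflexivity | | apply smooth_plus; [apply smooth_plus|];
    (apply smooth_mult; [apply smooth_const | apply smooth_dir])].
  intros i th ph. destruct i; simpl; ring.
Qed.

(** Integrations by parts are performed modulo [null] functions: [sphere_int_eq_mod] reduces each to
    a pointwise identity with one [null] summand per rotation that is moved. *)
Definition null (m : R -> R -> R) : Prop := cont2 m /\ sphere_int m = 0.

(** The integrand is the [th]-derivative of [sin th * G], and [sin] vanishes at both poles. *)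
Lemma null_meridian (G : R -> R -> R) (Gt : R -> R -> R) :
  cont2 G -> cont2 Gt -> (forall th ph, is_derive (fun u => G u ph) th (Gt th ph)) ->
  RInt (fun th => RInt (fun ph => sin th * Gt th ph + cos th * G th ph) 0 (2 * PI)) 0 PI = 0.
Proof.
  intros H1 H2 H3.
  assert (C : cont2 (fun th ph => sin th * Gt th ph + cos th * G th ph)).
  { cont2s. }
  rewrite (RInt_FTC (fun th => RInt (fun ph => sin th * G th ph) 0 (2 * PI))).
  - rewrite sin_PI, sin_0.
    rewrite (RInt_ext_R (fun ph => 0 * G PI ph) (fun _ => 0)) by (intros; simpl; ring).
    rewrite (RInt_ext_R (fun ph => 0 * G 0 ph) (fun _ => 0)) by (intros; simpl; ring).
    apply Rminus_diag_eq. reflexivity.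
  - apply PI_nonneg.
  - intros th _. apply (is_derive_RInt_param (fun th ph => sin th * G th ph)
      (fun th ph => sin th * Gt th ph + cos th * G th ph)).
    + apply two_PI_pos.
    + apply filter_forall. intros y s _. split.
      * eapply is_derive_eq; [apply (is_derive_R_mult sin (fun u => G u s) y (cos y) (Gt y s)); auto|ring].
        auto_derive; trivial; ring.
      * apply (cont2_slice_r (fun th ph => sin th * G th ph)). now apply cont2_weight.
    + intros s _. apply C.
  - intros th _. apply (cont2_RInt (fun th ph => sin th * Gt th ph + cos th * G th ph)); auto.
    apply two_PI_pos.
Qed.

(** A [ph]-derivative integrates to zero over a period, whatever weight [c th] stands in front. *)
Lemma null_parallel (c : R -> R) (G Gp : R -> R -> R) :
  cont2 Gp -> (forall th ph, is_derive (fun u => G th u) ph (Gp th ph)) ->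
  (forall th, G th (2 * PI) = G th 0) ->
  RInt (fun th => RInt (fun ph => c th * Gp th ph) 0 (2 * PI)) 0 PI = 0.
Proof.
  intros H1 H2 H3.
  rewrite (RInt_ext_R _ (fun _ => 0)).
  - etransitivity; [apply RInt_constant | simpl; ring].
  - intros th.
    etransitivity; [apply (RInt_FTC (fun ph => c th * G th ph) (fun ph => c th * Gp th ph))|].
    + apply two_PI_pos.
    + intros ph _. eapply is_derive_eq.
      apply (is_derive_R_mult (fun _ => c th) (fun u => G th u) ph 0 (Gp th ph)); auto.
      apply is_derive_R_const. ring.
    + intros ph _. cont. now apply cont2_slice_r.
    + rewrite H3. apply Rminus_diag_eq. reflexivity.
Qed.

Lemma sphere_int_split (k A B : R -> R -> R) : cont2 A -> cont2 B ->
  (forall th ph, sin th * k th ph = A th ph + B th ph) ->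
  RInt (fun th => RInt (A th) 0 (2 * PI)) 0 PI = 0 ->
  RInt (fun th => RInt (B th) 0 (2 * PI)) 0 PI = 0 -> sphere_int k = 0.
Proof.
  intros HA HB H IA IB. unfold sphere_int.
  assert (X : forall k, cont2 k -> ex_RInt (fun th => RInt (k th) 0 (2 * PI)) 0 PI).
  { intros l Hl. apply ex_RInt_everywhere. apply cont2_RInt; auto using two_PI_pos. }
  transitivity (RInt (fun th => 1 * RInt (A th) 0 (2 * PI) + 1 * RInt (B th) 0 (2 * PI)) 0 PI).
  - apply RInt_ext_R. intros th. rewrite <- RInt_lin by now apply ex_RInt_cont2.
    apply RInt_ext_R. intros ph. rewrite H. ring.
  - rewrite RInt_lin, IA, IB by auto. ring.
Qed.

(* The infinitesimal rotations [w_i d_j - w_j d_i] preserve the measure: on the sphere they are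
   divergences in the coordinates [(th, ph)], once multiplied by [sin th]. *)
Lemma null_rotation (G : R -> R -> R) (g : axis -> R -> R -> R) (i j : axis) :
  smooth G g -> null (fun th ph => dir th ph i * g j th ph - dir th ph j * g i th ph).
Proof.
  intros HG. assert (HG' := HG). destruct HG as (C & c & Dt & Dp & P).
  split; [cont2s|].
  set (gt := fun th ph => - sin th * g X0 th ph + cos th * cos ph * g X1 th ph + cos th * sin ph * g X2 th ph).
  set (gp := fun th ph => - sin th * sin ph * g X1 th ph + sin th * cos ph * g X2 th ph).
  assert (Ct : cont2 gt) by (unfold gt; cont2s).
  assert (Cp : cont2 gp) by (unfold gp; cont2s).
  assert (H12 : sphere_int (fun th ph => dir th ph X1 * g X2 th ph - dir th ph X2 * g X1 th ph) = 0).
  { unfold sphere_int.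
    etransitivity; [|exact (null_parallel sin G gp Cp Dp P)].
    apply RInt_ext_R. intros th. apply RInt_ext_R. intros ph. unfold gp, dir. ring. }
  (* [e = cos] gives the rotation [L01] and [e = sin] gives [L02]; [e'] is the derivative of [e]. *)
  assert (T : forall e e', (forall u, is_derive e u (e' u)) -> (forall u, is_derive e' u (- e u)) ->
    e (2 * PI) = e 0 -> e' (2 * PI) = e' 0 ->
    sphere_int (fun th ph => cos th * (e ph * (cos ph * g X1 th ph + sin ph * g X2 th ph)
      + e' ph * (cos ph * g X2 th ph - sin ph * g X1 th ph)) - sin th * e ph * g X0 th ph) = 0).
  { intros e e' He He' P0 P1.
    assert (Ce : forall u, continuous e u) by (intros u; exact (is_derive_continuous _ _ _ (He u))).
    assert (Ce' : forall u, continuous e' u) by (intros u; exact (is_derive_continuous _ _ _ (He' u))).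
    (* Multiplied by [sin th], the rotation is [d/dth (sin th e G) + d/dph (cos th e' G)]; the
       undifferentiated terms cancel because [e'' = - e]. *)
    apply (sphere_int_split _ (fun th ph => sin th * (e ph * gt th ph) + cos th * (e ph * G th ph))
      (fun th ph => cos th * (- e ph * G th ph + e' ph * gp th ph))); [cont2s | cont2s | | |].
    - intros th ph. unfold gt, gp. ring.
    - apply (null_meridian (fun th ph => e ph * G th ph) (fun th ph => e ph * gt th ph)); [cont2s | cont2s |].
      intros th ph. eapply is_derive_eq; [exact (is_derive_R_mult _ _ _ _ _ (is_derive_R_const (e ph) th) (Dt th ph))|].
      fold (gt th ph). cbv beta. ring.
    - apply (null_parallel cos (fun th ph => e' ph * G th ph) (fun th ph => - e ph * G th ph + e' ph * gp th ph)); [cont2s | |].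
      + intros th ph. exact (is_derive_R_mult e' (fun u => G th u) ph _ _ (He' ph) (Dp th ph)).
      + intros th. now rewrite P1, P. }
  assert (H01 : sphere_int (fun th ph => dir th ph X0 * g X1 th ph - dir th ph X1 * g X0 th ph) = 0).
  { rewrite <- (T cos (fun u => - sin u)).
    - apply sphere_int_ext. intros th ph. unfold dir.
      transitivity ((sin ph * sin ph + cos ph * cos ph) * cos th * g X1 th ph - sin th * cos ph * g X0 th ph);
        [rewrite sin_cos_sqr|]; ring.
    - intros; auto_derive; trivial; eqR; ring.
    - intros; auto_derive; trivial; eqR; ring.
    - now rewrite cos_2PI, cos_0.
    - now rewrite sin_2PI, sin_0. }
  assert (H02 : sphere_int (fun th ph => dir th ph X0 * g X2 th ph - dir th ph X2 * g X0 th ph) = 0).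
  { rewrite <- (T sin cos).
    - apply sphere_int_ext. intros th ph. unfold dir.
      transitivity ((sin ph * sin ph + cos ph * cos ph) * cos th * g X2 th ph - sin th * sin ph * g X0 th ph);
        [rewrite sin_cos_sqr|]; ring.
    - intros; auto_derive; trivial; eqR; ring.
    - intros; auto_derive; trivial; eqR; ring.
    - now rewrite sin_2PI, sin_0.
    - now rewrite cos_2PI, cos_0. }
  assert (Z : forall i j, sphere_int (fun th ph => dir th ph i * g j th ph - dir th ph j * g i th ph) = 0 ->
    sphere_int (fun th ph => dir th ph j * g i th ph - dir th ph i * g j th ph) = 0).
  { intros a b H. rewrite <- Ropp_0, <- H, <- sphere_int_opp.
    - apply sphere_int_ext. intros; ring.
    - cont2s. }
  assert (Z0 : forall i, sphere_int (fun th ph => dir th ph i * g i th ph - dir th ph i * g i th ph) = 0).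
  { intros a. rewrite <- (Rmult_0_r (4 * PI)), <- (sphere_int_const 0).
    apply sphere_int_ext. intros; ring. }
  destruct i, j; first [apply Z0 | assumption | apply Z; assumption].
Qed.

Lemma null_plus (k l : R -> R -> R) : null k -> null l -> null (fun th ph => k th ph + l th ph).
Proof. intros [Ck Ik] [Cl Il]. split; [cont2s|]. rewrite sphere_int_plus, Ik, Il by auto. ring. Qed.

Lemma sphere_int_eq_mod (k k' m : R -> R -> R) :
  null m -> cont2 k' -> (forall th ph, k th ph = k' th ph + m th ph) -> sphere_int k = sphere_int k'.
Proof. intros [Cm Im] Hk' H. rewrite (sphere_int_ext _ _ H), sphere_int_plus, Im by auto. ring. Qed.

(** * Differentiable functions on the ball *)

Definition coord (i : axis) (x : pt) : R :=
  match i with X0 => c0 x | X1 => c1 x | X2 => c2 x end.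

Definition line (i : axis) (x : pt) (t : R) : pt :=
  match i with X0 => line0 x t | X1 => line1 x t | X2 => line2 x t end.

Definition point (c : axis -> R) : pt := mkpt (c X0) (c X1) (c X2).

Lemma pnorm_sqr (x : pt) : pnorm x ^ 2 = c0 x ^ 2 + c1 x ^ 2 + c2 x ^ 2.
Proof.
  unfold pnorm, qnorm, toQ; simpl q0; simpl q1; simpl q2; simpl q3.
  rewrite pow2_sqrt; [ring|]. nra.
Qed.

Lemma pnorm_nonneg (x : pt) : 0 <= pnorm x.
Proof. apply sqrt_pos. Qed.

Lemma pnorm_le (x : pt) (a : R) : 0 <= a -> c0 x ^ 2 + c1 x ^ 2 + c2 x ^ 2 <= a ^ 2 -> pnorm x <= a.
Proof.
  intros Ha H. rewrite <- pnorm_sqr in H. assert (P := pnorm_nonneg x). nra.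
Qed.

Lemma pnorm_le_abs (x : pt) : pnorm x <= Rabs (c0 x) + Rabs (c1 x) + Rabs (c2 x).
Proof.
  assert (H0 := Rabs_pos (c0 x)). assert (H1 := Rabs_pos (c1 x)). assert (H2 := Rabs_pos (c2 x)).
  apply pnorm_le. lra.
  rewrite <- (pow2_abs (c0 x)), <- (pow2_abs (c1 x)), <- (pow2_abs (c2 x)). nra.
Qed.

Lemma coord_le_pnorm (i : axis) (x : pt) : Rabs (coord i x) <= pnorm x.
Proof.
  assert (E := pnorm_sqr x). rewrite <- (Rabs_pos_eq (pnorm x)) by apply pnorm_nonneg.
  generalize (pow2_ge_0 (c0 x)) (pow2_ge_0 (c1 x)) (pow2_ge_0 (c2 x)); intros.
  apply Rsqr_le_abs_0. unfold Rsqr. destruct i; simpl; lra.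
Qed.

Lemma cauchy_schwarz3 (a b c x y z : R) :
  (a * x + b * y + c * z) ^ 2 <= (a ^ 2 + b ^ 2 + c ^ 2) * (x ^ 2 + y ^ 2 + z ^ 2).
Proof.
  assert (0 <= (a * y - b * x) ^ 2 + (a * z - c * x) ^ 2 + (b * z - c * y) ^ 2)
    by (generalize (pow2_ge_0 (a * y - b * x)) (pow2_ge_0 (a * z - c * x)) (pow2_ge_0 (b * z - c * y)); lra).
  lra.
Qed.

Lemma pnorm_triang (x z : pt) : pnorm z <= pnorm x + pnorm (psub z x).
Proof.
  assert (P := pnorm_nonneg x). assert (Q := pnorm_nonneg (psub z x)).
  apply pnorm_le. lra.
  replace ((pnorm x + pnorm (psub z x)) ^ 2)
    with (pnorm x ^ 2 + pnorm (psub z x) ^ 2 + 2 * (pnorm x * pnorm (psub z x))) by ring.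
  assert (CS := cauchy_schwarz3 (c0 x) (c1 x) (c2 x) (c0 z - c0 x) (c1 z - c1 x) (c2 z - c2 x)).
  assert (E1 := pnorm_sqr x). assert (E2 := pnorm_sqr (psub z x)). simpl c0 in E2; simpl c1 in E2; simpl c2 in E2.
  assert (H : c0 x * (c0 z - c0 x) + c1 x * (c1 z - c1 x) + c2 x * (c2 z - c2 x) <= pnorm x * pnorm (psub z x)).
  { rewrite <- E1, <- E2 in CS. apply Rle_trans with (1 := Rle_abs _).
    rewrite <- (Rabs_pos_eq (pnorm x * pnorm (psub z x))) by now apply Rmult_le_pos.
    apply Rsqr_le_abs_0. unfold Rsqr. lra. }
  rewrite E1, E2. lra.
Qed.

Definition triple (p : (R * R) * R) : pt := mkpt (fst (fst p)) (snd (fst p)) (snd p).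

Definition coords (x : pt) : (R * R) * R := ((c0 x, c1 x), c2 x).

Lemma triple_coords (x : pt) : triple (coords x) = x.
Proof. now destruct x. Qed.

Lemma near_coords (x : pt) (e : R) : 0 < e ->
  locally (coords x) (fun p => pnorm (psub (triple p) x) < e).
Proof.
  intros He. assert (H : 0 < e / 3) by lra. exists (mkposreal _ H). intros [[a b] c] [[B0 B1] B2].
  change (Rabs (a - c0 x) < e / 3) in B0. change (Rabs (b - c1 x) < e / 3) in B1.
  change (Rabs (c - c2 x) < e / 3) in B2.
  eapply Rle_lt_trans; [apply pnorm_le_abs|]. simpl. lra.
Qed.

Lemma near_in_ball (Rad : R) (x : pt) : in_ball Rad x -> locally (coords x) (fun p => in_ball Rad (triple p)).
Proof.
  unfold in_ball. intros Hx. assert (H : 0 < Rad - pnorm x) by lra.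
  generalize (near_coords x _ H). apply filter_imp. intros p Hp. generalize (pnorm_triang x (triple p)). lra.
Qed.

Lemma cont_on_ball_iff (Rad : R) (h : pt -> R) :
  cont_on_ball Rad h <-> forall x, in_ball Rad x -> continuous (fun p => h (triple p)) (coords x).
Proof.
  split; intros H x Hx.
  - intros P [e He]. destruct (H x Hx e (cond_pos e)) as (d & D & Hd).
    rewrite triple_coords in He. apply (filter_imp _ _ (fun p Hp => He _ (Hd (triple p) Hp)) (near_coords x d D)).
  - intros eps He.
    destruct (proj1 (continuous_R_eps _ _) (H x Hx) (mkposreal _ He)) as (e & Hd). simpl in Hd.
    exists e. split; [apply e|]. intros y Hy. specialize (Hd (coords y)). rewrite !triple_coords in Hd. apply Hd.
    assert (B := fun i => Rle_lt_trans _ _ _ (coord_le_pnorm i (psub y x)) Hy).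
    exact (conj (conj (B X0) (B X1)) (B X2)).
Qed.

Lemma continuous_on_ball_comp {U : UniformSpace} (Rad : R) (h : pt -> R) (c : axis -> U -> R) (u : U) :
  cont_on_ball Rad h -> (forall i, continuous (c i) u) -> in_ball Rad (point (fun i => c i u)) ->
  continuous (fun z => h (point (fun i => c i z))) u.
Proof.
  intros Hh Hc Hu.
  apply (continuous_comp (fun z => ((c X0 z, c X1 z), c X2 z)) (fun p => h (triple p))); [cont|].
  exact (proj1 (cont_on_ball_iff Rad h) Hh _ Hu).
Qed.

(** The partial derivatives are carried as data [d], so that the Riesz system can be used as a set
    of algebraic rewrite rules on them. *)
Definition C1_scalar (Rad : R) (h : pt -> R) (d : axis -> pt -> R) : Prop :=
  forall i, cont_on_ball Rad (d i) /\
  forall x, in_ball Rad x -> is_derive (fun t => h (line i x t)) (coord i x) (d i x).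

Lemma increment_1d (f df : R -> R) (a b : R) (l eps : R) :
  (forall z, Rabs (z - a) <= Rabs (b - a) -> is_derive f z (df z) /\ Rabs (df z - l) <= eps) ->
  Rabs (f b - f a - l * (b - a)) <= eps * Rabs (b - a).
Proof.
  intros H.
  destruct (MVT_derive f df a b) as (c & Hc & E).
  - intros z Hz. now apply H, between_dist.
  - rewrite E. replace (df c * (b - a) - l * (b - a)) with ((df c - l) * (b - a)) by ring.
    rewrite Rabs_mult. apply Rmult_le_compat_r. apply Rabs_pos. now apply H, between_dist.
Qed.

Lemma norm_triple (q : (R * R) * R) : Rabs (fst (fst q)) <= norm q /\ Rabs (snd (fst q)) <= norm q /\ Rabs (snd q) <= norm q.
Proof.
  destruct q as [[a b] c].
  assert (H := proj1 (norm_prod (V := R_NormedModule) ((a, b) : prod_NormedModule _ R_NormedModule R_NormedModule) c)).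
  assert (H' := proj1 (norm_prod (U := R_NormedModule) (V := R_NormedModule) a b)).
  split; [|split].
  - exact (Rle_trans _ _ _ (Rle_trans _ _ _ (Rmax_l _ _) H') (Rle_trans _ _ _ (Rmax_l _ _) H)).
  - exact (Rle_trans _ _ _ (Rle_trans _ _ _ (Rmax_r _ _) H') (Rle_trans _ _ _ (Rmax_l _ _) H)).
  - exact (Rle_trans _ _ _ (Rmax_r _ _) H).
Qed.

(* The increment is split along the edges of a box. *)
Lemma C1_filterdiff (Rad : R) (h : pt -> R) (d : axis -> pt -> R) (x : pt) :
  C1_scalar Rad h d -> in_ball Rad x ->
  filterdiff (fun p => h (triple p)) (locally (coords x))
    (fun q : (R * R) * R => d X0 x * fst (fst q) + d X1 x * snd (fst q) + d X2 x * snd q).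
Proof.
  intros HC Hx. split.
  - split.
    + intros [[a b] c] [[a' b'] c']. simpl. unfold plus; simpl. ring.
    + intros k [[a b] c]. simpl. unfold scal; simpl. unfold mult; simpl. ring.
    + exists (1 + Rabs (d X0 x) + Rabs (d X1 x) + Rabs (d X2 x)).
      assert (P0 := Rabs_pos (d X0 x)). assert (P1 := Rabs_pos (d X1 x)). assert (P2 := Rabs_pos (d X2 x)).
      split; [lra|]. intros q. destruct (norm_triple q) as (N0 & N1 & N2).
      assert (N := Rle_trans _ _ _ (Rabs_pos _) N0).
      apply Rle_trans with (Rabs (d X0 x) * Rabs (fst (fst q)) + Rabs (d X1 x) * Rabs (snd (fst q)) + Rabs (d X2 x) * Rabs (snd q)).
      * rewrite <- !Rabs_mult. eapply Rle_trans; [apply Rabs_triang | apply Rplus_le_compat_r, Rabs_triang].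
      * assert (Rabs (d X0 x) * Rabs (fst (fst q)) <= Rabs (d X0 x) * norm q) by now apply Rmult_le_compat_l.
        assert (Rabs (d X1 x) * Rabs (snd (fst q)) <= Rabs (d X1 x) * norm q) by now apply Rmult_le_compat_l.
        assert (Rabs (d X2 x) * Rabs (snd q) <= Rabs (d X2 x) * norm q) by now apply Rmult_le_compat_l.
        lra.
  - intros x' Hx'. rewrite <- (is_filter_lim_locally_unique (V := prod_NormedModule _
      (prod_NormedModule _ R_NormedModule R_NormedModule) R_NormedModule) _ _ Hx'). intros eps. clear x' Hx'.
    assert (He : 0 < eps / 3) by (generalize (cond_pos eps); lra).
    assert (Near : forall i, locally (coords x) (fun p => Rabs (d i (triple p) - d i x) < eps / 3)).
    { intros i. generalize (proj1 (cont_on_ball_iff Rad (d i)) (proj1 (HC i)) x Hx (fun z => Rabs (z - d i x) < eps / 3)).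
      intros H. apply H. exists (mkposreal _ He). rewrite triple_coords. now intros z Hz. }
    destruct (filter_and _ _ (near_in_ball Rad x Hx) (filter_and _ _ (Near X0) (filter_and _ _ (Near X1) (Near X2)))) as [e Hbox].
    exists e. intros p Bp. destruct Bp as [[B0 B1] B2]. destruct p as [[y0 y1] y2]. destruct x as [x0 x1 x2].
    change (Rabs (y0 - x0) < e) in B0. change (Rabs (y1 - x1) < e) in B1. change (Rabs (y2 - x2) < e) in B2.
    assert (Q : forall a b c, Rabs (a - x0) < e -> Rabs (b - x1) < e -> Rabs (c - x2) < e ->
      in_ball Rad (mkpt a b c) /\ forall i, Rabs (d i (mkpt a b c) - d i (mkpt x0 x1 x2)) <= eps / 3).
    { intros a b c Ha Hb Hc. destruct (Hbox ((a, b), c)) as (H & H0 & H1 & H2); [repeat split; assumption|].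
      split; [exact H|]. intros []; left; assumption. }
    assert (Z : forall a : R, Rabs (a - a) < e) by (intros a; rewrite Rminus_diag, Rabs_R0; apply e).
    destruct (norm_triple (minus ((y0, y1), y2) ((x0, x1), x2))) as (N0 & N1 & N2).
    set (x := mkpt x0 x1 x2) in *.
    assert (I0 : Rabs (h (mkpt y0 y1 y2) - h (mkpt x0 y1 y2) - d X0 x * (y0 - x0)) <= eps / 3 * Rabs (y0 - x0)).
    { apply (increment_1d (fun z => h (mkpt z y1 y2)) (fun z => d X0 (mkpt z y1 y2))). intros z Hz.
      destruct (Q z y1 y2) as [H1 H2]; auto; [lra|]. split; [exact (proj2 (HC X0) _ H1) | auto]. }
    assert (I1 : Rabs (h (mkpt x0 y1 y2) - h (mkpt x0 x1 y2) - d X1 x * (y1 - x1)) <= eps / 3 * Rabs (y1 - x1)).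
    { apply (increment_1d (fun z => h (mkpt x0 z y2)) (fun z => d X1 (mkpt x0 z y2))). intros z Hz.
      destruct (Q x0 z y2) as [H1 H2]; auto; [lra|]. split; [exact (proj2 (HC X1) _ H1) | auto]. }
    assert (I2 : Rabs (h (mkpt x0 x1 y2) - h x - d X2 x * (y2 - x2)) <= eps / 3 * Rabs (y2 - x2)).
    { apply (increment_1d (fun z => h (mkpt x0 x1 z)) (fun z => d X2 (mkpt x0 x1 z))). intros z Hz.
      destruct (Q x0 x1 z) as [H1 H2]; auto; [lra|]. split; [exact (proj2 (HC X2) _ H1) | auto]. }
    set (n := norm (minus ((y0, y1), y2) ((x0, x1), x2))) in *.
    change (Rabs (y0 - x0) <= n) in N0. change (Rabs (y1 - x1) <= n) in N1. change (Rabs (y2 - x2) <= n) in N2.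
    change (Rabs (h (mkpt y0 y1 y2) - h x - (d X0 x * (y0 - x0) + d X1 x * (y1 - x1) + d X2 x * (y2 - x2))) <= eps * n).
    apply Rabs_le_between in I0, I1, I2. apply Rabs_le_between.
    assert (eps / 3 * Rabs (y0 - x0) <= eps / 3 * n) by (apply Rmult_le_compat_l; lra).
    assert (eps / 3 * Rabs (y1 - x1) <= eps / 3 * n) by (apply Rmult_le_compat_l; lra).
    assert (eps / 3 * Rabs (y2 - x2) <= eps / 3 * n) by (apply Rmult_le_compat_l; lra).
    lra.
Qed.

Lemma C1_cont_on_ball (Rad : R) (h : pt -> R) (d : axis -> pt -> R) :
  C1_scalar Rad h d -> cont_on_ball Rad h.
Proof.
  intros HC. apply cont_on_ball_iff. intros x Hx.
  exact (filterdiff_continuous _ _ (ex_intro _ _ (C1_filterdiff Rad h d x HC Hx))).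
Qed.

Lemma C1_chain (Rad : R) (h : pt -> R) (d : axis -> pt -> R) (g : axis -> R -> R) (g' : axis -> R) (s : R) :
  C1_scalar Rad h d -> (forall i, is_derive (g i) s (g' i)) ->
  in_ball Rad (point (fun i => g i s)) ->
  is_derive (fun u => h (point (fun i => g i u))) s
    (d X0 (point (fun i => g i s)) * g' X0 + d X1 (point (fun i => g i s)) * g' X1
     + d X2 (point (fun i => g i s)) * g' X2).
Proof.
  intros HC Hg Hx. set (x := point (fun i => g i s)) in *.
  assert (D2 := filterdiff_comp'_2 (g X0) (g X1) (fun a b => (a, b)) s _ _ (fun a b => (a, b)) (Hg X0) (Hg X1)
    (filterdiff_linear _ (is_linear_prod _ _ is_linear_fst is_linear_snd))).
  eapply filterdiff_ext_lin.
  - exact (filterdiff_comp'_2 _ _ (fun q z => h (triple (q, z))) s _ _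
      (fun q z => d X0 x * fst q + d X1 x * snd q + d X2 x * z) D2 (Hg X2) (C1_filterdiff Rad h d x HC Hx)).
  - intros y. unfold scal; simpl. unfold mult; simpl. ring.
Qed.

(** * Sphere integrals depending on a parameter *)

Definition cont3 (F : R -> R -> R -> R) (t : R) : Prop :=
  forall th ph, continuous (fun p : (R * R) * R => F (fst (fst p)) (snd (fst p)) (snd p)) ((t, th), ph).

Lemma cont3_slice (F : R -> R -> R -> R) (t : R) : cont3 F t -> cont2 (F t).
Proof.
  intros H th ph.
  apply (continuous_comp (fun p : R * R => ((t, fst p), snd p))
    (fun p : (R * R) * R => F (fst (fst p)) (snd (fst p)) (snd p))).
  - cont.
  - apply H.
Qed.

Lemma cont3_const_l (k : R -> R -> R) (t : R) : cont2 k -> cont3 (fun _ => k) t.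
Proof.
  intros H th ph.
  apply (continuous_comp (fun p : (R * R) * R => (snd (fst p), snd p)) (fun p => k (fst p) (snd p))).
  - cont.
  - apply H.
Qed.

Lemma cont3_mult (F G : R -> R -> R -> R) (t : R) :
  cont3 F t -> cont3 G t -> cont3 (fun t th ph => F t th ph * G t th ph) t.
Proof. intros H1 H2 th ph. apply continuous_R_mult; auto. Qed.

Lemma cont3_plus (F G : R -> R -> R -> R) (t : R) :
  cont3 F t -> cont3 G t -> cont3 (fun t th ph => F t th ph + G t th ph) t.
Proof. intros H1 H2 th ph. apply continuous_R_plus; auto. Qed.

Lemma sphere_inner_continuous (F : R -> R -> R -> R) (t0 th : R) :
  locally t0 (cont3 F) ->
  continuous (fun p : R * R => RInt (fun ph => sin (snd p) * F (fst p) (snd p) ph) 0 (2 * PI)) (t0, th).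
Proof.
  intros [d Hd].
  apply (continuous_RInt_param (U := prod_UniformSpace R_UniformSpace R_UniformSpace)
    (fun p ph => sin (snd p) * F (fst p) (snd p) ph)). apply two_PI_pos.
  exists d. intros [t th'] [Ht _] ph _. apply continuous_R_mult.
  - cont.
  - apply (Hd t Ht).
Qed.

(** Differentiation under each of the two iterated integrals. The outer one requires the inner
    derivative to be jointly continuous in [t] and [th], which [cont3] provides. *)
Lemma sphere_int_derive (F F' : R -> R -> R -> R) (t0 : R) :
  locally t0 (fun t => cont3 F t /\ cont3 F' t /\
    forall th ph, is_derive (fun u => F u th ph) t (F' t th ph)) ->
  is_derive (fun t => sphere_int (F t)) t0 (sphere_int (F' t0)).
Proof.
  intros H0. destruct (locally_locally _ _ H0) as [d Hd].
  unfold sphere_int.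
  apply (is_derive_RInt_param
    (fun t th => RInt (fun ph => sin th * F t th ph) 0 (2 * PI))
    (fun t th => RInt (fun ph => sin th * F' t th ph) 0 (2 * PI))).
  - apply PI_nonneg.
  - exists d. intros t Ht th _. specialize (Hd t Ht).
    destruct (locally_singleton _ _ Hd) as (C & C' & _). split.
    + apply (is_derive_RInt_param (fun t ph => sin th * F t th ph) (fun t ph => sin th * F' t th ph)).
      * apply two_PI_pos.
      * revert Hd. apply filter_imp. intros y (Cy & _ & Dy) ph _. split.
        -- eapply is_derive_eq. apply (is_derive_R_mult (fun _ => sin th) (fun u => F u th ph) y 0 (F' y th ph)).
           apply is_derive_R_const. apply Dy. cbv beta; ring.
        -- apply (cont2_slice_r (fun th ph => sin th * F y th ph)). now apply cont2_weight, cont3_slice.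
      * intros ph _. apply continuous_R_mult. apply continuous_const.
        apply (continuous_comp (fun p : R * R => ((fst p, th), snd p))
          (fun p : (R * R) * R => F' (fst (fst p)) (snd (fst p)) (snd p))).
        -- cont.
        -- apply C'.
    + apply cont2_RInt with (k := fun th ph => sin th * F t th ph). apply two_PI_pos.
      now apply cont2_weight, cont3_slice.
  - intros th _. apply (sphere_inner_continuous F').
    revert H0. apply filter_imp. tauto.
Qed.

(** * Fields along concentric spheres *)

Definition on_sphere (h : pt -> R) (t th ph : R) : R := h (point (fun i => t * dir th ph i)).

Lemma pnorm_ray (t th ph : R) : pnorm (point (fun i => t * dir th ph i)) = Rabs t.
Proof.
  assert (H := dir_norm th ph). unfold dot in H.
  assert (E := pnorm_sqr (point (fun i => t * dir th ph i))). simpl c0 in E; simpl c1 in E; simpl c2 in E.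
  assert (P := pnorm_nonneg (point (fun i => t * dir th ph i))).
  rewrite <- (Rabs_pos_eq (pnorm _)) by exact P. apply Rsqr_eq_abs_0. unfold Rsqr.
  transitivity (pnorm (point (fun i => t * dir th ph i)) ^ 2); [simpl; ring|]. rewrite E.
  transitivity (t * t * (dir th ph X0 * dir th ph X0 + dir th ph X1 * dir th ph X1 + dir th ph X2 * dir th ph X2)); [simpl; ring|].
  rewrite H. ring.
Qed.

Lemma on_sphere_cont3 (Rad : R) (h : pt -> R) (t : R) :
  cont_on_ball Rad h -> Rabs t < Rad -> cont3 (on_sphere h) t.
Proof.
  intros Hh Ht th ph.
  apply (continuous_on_ball_comp Rad h
    (fun i (p : (R * R) * R) => fst (fst p) * dir (snd (fst p)) (snd p) i)); auto.
  - intros i. apply continuous_R_mult.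
    + cont.
    + apply (cont3_const_l (fun th ph => dir th ph i) t (cont2_dir i)).
  - unfold in_ball. simpl. now rewrite pnorm_ray.
Qed.

Definition radial (d : axis -> pt -> R) (t th ph : R) : R :=
  dot (dir th ph) (fun i => on_sphere (d i) t th ph).

Lemma on_sphere_derive_radial (Rad : R) (h : pt -> R) (d : axis -> pt -> R) (t th ph : R) :
  C1_scalar Rad h d -> Rabs t < Rad ->
  is_derive (fun u => on_sphere h u th ph) t (radial d t th ph).
Proof.
  intros HC Ht. eapply is_derive_eq.
  - apply (C1_chain Rad h d (fun i u => u * dir th ph i) (dir th ph) t HC).
    + intros i. auto_derive; trivial; eqR; ring.
    + unfold in_ball. now rewrite pnorm_ray.
  - unfold radial, dot, on_sphere. ring.
Qed.

Lemma on_sphere_smooth (Rad : R) (h : pt -> R) (d : axis -> pt -> R) (t : R) :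
  C1_scalar Rad h d -> Rabs t < Rad ->
  smooth (on_sphere h t) (fun i th ph => t * on_sphere (d i) t th ph).
Proof.
  intros HC Ht.
  split; [|split; [|split; [|split]]].
  - apply cont3_slice, (on_sphere_cont3 Rad); auto. now apply (C1_cont_on_ball Rad h d).
  - intros i. apply cont2_mult; [apply cont2_const|].
    apply cont3_slice, (on_sphere_cont3 Rad); auto. apply HC.
  - intros th ph. eapply is_derive_eq.
    + apply (C1_chain Rad h d (fun i u => t * dir u ph i)
        (fun i => t * match i with X0 => - sin th | X1 => cos th * cos ph | X2 => cos th * sin ph end) th HC).
      * intros i. destruct i; simpl; auto_derive; trivial; eqR; ring.
      * unfold in_ball. now rewrite pnorm_ray.
    + unfold on_sphere. ring.
  - intros th ph. eapply is_derive_eq.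
    + apply (C1_chain Rad h d (fun i u => t * dir th u i)
        (fun i => t * match i with X0 => 0 | X1 => - sin th * sin ph | X2 => sin th * cos ph end) ph HC).
      * intros i. destruct i; simpl; auto_derive; trivial; eqR; ring.
      * unfold in_ball. now rewrite pnorm_ray.
    + unfold on_sphere. ring.
  - intros th. unfold on_sphere, point, dir. now rewrite cos_2PI, sin_2PI, cos_0, sin_0.
Qed.

Lemma locally_abs_lt (t Rad : R) : Rabs t < Rad -> locally t (fun u => Rabs u < Rad).
Proof.
  intros Ht. assert (H : 0 < Rad - Rabs t) by lra.
  exists (mkposreal _ H). intros u Hu.
  unfold ball in Hu; simpl in Hu. unfold AbsRing_ball, abs, minus, plus, opp in Hu; simpl in Hu.
  replace u with ((u + - t) + t) by ring.
  eapply Rle_lt_trans; [apply Rabs_triang|]. lra.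
Qed.

Lemma sphere_moment_derive (Rad : R) (h : pt -> R) (d : axis -> pt -> R) (K : R -> R -> R) (t : R) :
  C1_scalar Rad h d -> cont2 K -> Rabs t < Rad ->
  is_derive (fun u => sphere_int (fun th ph => K th ph * on_sphere h u th ph)) t
    (sphere_int (fun th ph => K th ph * radial d t th ph)).
Proof.
  intros HC HK Ht.
  apply (sphere_int_derive (fun u th ph => K th ph * on_sphere h u th ph)
    (fun u th ph => K th ph * radial d u th ph)).
  generalize (locally_abs_lt t Rad Ht). apply filter_imp. intros u Hu'.
  assert (Ch := C1_cont_on_ball Rad h d HC).
  split; [|split].
  - apply cont3_mult. now apply cont3_const_l. now apply (on_sphere_cont3 Rad).
  - apply cont3_mult. now apply cont3_const_l.
    apply cont3_plus; [apply cont3_plus|]; apply cont3_mult;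
      try apply (cont3_const_l (fun th ph => dir th ph _)), cont2_dir;
      apply (on_sphere_cont3 Rad); auto; apply HC.
  - intros th ph. eapply is_derive_eq.
    + apply (is_derive_R_mult (fun _ => K th ph) (fun u => on_sphere h u th ph)).
      apply is_derive_R_const. now apply (on_sphere_derive_radial Rad h d).
    + cbv beta; ring.
Qed.

(** * Zonal moments of harmonic gradients *)

Implicit Types (Rad : R) (v : axis -> pt -> R) (d : axis -> axis -> pt -> R).

(* [v] is the gradient of a harmonic function and [d j i] is the derivative of [v j] along axis [i]. *)
Definition harmonic_gradient Rad v d : Prop :=
  (forall j, C1_scalar Rad (v j) (d j)) /\
  (forall i j x, in_ball Rad x -> d i j x = d j i x) /\
  (forall x, in_ball Rad x -> d X0 X0 x + d X1 X1 x + d X2 X2 x = 0).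

(** The coefficient in [L_ij p(x.w) = p'(x.w) * ang x i j], where [L_ij = w_i d_j - w_j d_i]. *)
Definition ang (x : axis -> R) (i j : axis) (th ph : R) : R :=
  dir th ph i * x j - dir th ph j * x i.

Definition zonal (p : R -> R) (x : axis -> R) (th ph : R) : R := p (dot x (dir th ph)).

Definition moment (K : R -> R -> R) (h : pt -> R) (t : R) : R :=
  sphere_int (fun th ph => K th ph * on_sphere h t th ph).

Definition axis_eqb (i j : axis) : bool :=
  match i, j with X0, X0 => true | X1, X1 => true | X2, X2 => true | _, _ => false end.

Definition delta (i j : axis) : R := if axis_eqb i j then 1 else 0.

Definition cyclic (a b c : axis) : Prop :=
  (a = X0 /\ b = X1 /\ c = X2) \/ (a = X1 /\ b = X2 /\ c = X0) \/ (a = X2 /\ b = X0 /\ c = X1).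

Lemma smooth_ang (x : axis -> R) (i j : axis) :
  smooth (ang x i j) (fun k _ _ => delta k i * x j - delta k j * x i).
Proof.
  apply (smooth_ext _ _ _ _) with (3 := smooth_plus _ _ _ _
    (smooth_mult _ _ _ _ (smooth_dir i) (smooth_const (x j)))
    (smooth_mult _ _ _ _ (smooth_dir j) (smooth_const (- x i)))).
  - intros th ph. unfold ang. ring.
  - intros k th ph. unfold delta. destruct k, i, j; simpl; ring.
Qed.

Lemma cont2_zonal (p : R -> R) (x : axis -> R) :
  (forall u, continuous p u) -> cont2 (zonal p x).
Proof. intros H. apply cont2_comp; auto. cont2s. Qed.

Lemma cont2_ang (x : axis -> R) (i j : axis) : cont2 (ang x i j).
Proof. apply (smooth_ang x i j). Qed.

#[export] Hint Resolve cont2_zonal cont2_ang : cont.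

Lemma smooth_zonal (p p' : R -> R) (x : axis -> R) :
  (forall u, is_derive p u (p' u)) -> (forall u, continuous p' u) ->
  smooth (zonal p x) (fun i th ph => zonal p' x th ph * x i).
Proof. intros H1 H2. exact (smooth_comp p p' _ _ H1 H2 (smooth_dot x)). Qed.

Lemma on_sphere_cont2 (Rad : R) (h : pt -> R) (t : R) :
  cont_on_ball Rad h -> Rabs t < Rad -> cont2 (on_sphere h t).
Proof. intros H1 H2. now apply cont3_slice, (on_sphere_cont3 Rad). Qed.

Lemma in_ball_ray (Rad t th ph : R) : Rabs t < Rad -> in_ball Rad (point (fun i => t * dir th ph i)).
Proof. intros H. unfold in_ball. now rewrite pnorm_ray. Qed.

Lemma harmonic_gradient_cont Rad v d (t : R) :
  harmonic_gradient Rad v d -> Rabs t < Rad ->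
  (forall j, cont2 (on_sphere (v j) t)) /\ (forall j i, cont2 (on_sphere (d j i) t)) /\
  (forall j, cont2 (radial (d j) t)).
Proof.
  intros [HC _] Ht.
  assert (Cd : forall j i, cont2 (on_sphere (d j i) t)) by (intros j i; apply (on_sphere_cont2 Rad); auto; apply HC).
  split; [|split; auto].
  - intros j. apply (on_sphere_cont2 Rad); auto. apply (C1_cont_on_ball Rad _ (d j)), HC.
  - intros j. unfold radial. cont2s.
Qed.

(** Oriented as rewrite rules: they eliminate one diagonal and three off-diagonal derivatives, after
    which the pointwise identities fall to [ring]. *)
Lemma riesz_on_sphere Rad v d (t th ph : R) :
  harmonic_gradient Rad v d -> Rabs t < Rad ->
  let D := fun i j => on_sphere (d i j) t th ph in
  D X0 X0 = - D X1 X1 - D X2 X2 /\ D X0 X1 = D X1 X0 /\ D X1 X2 = D X2 X1 /\ D X2 X0 = D X0 X2.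
Proof.
  intros (_ & Hs & Htr) Ht D. assert (Hb := in_ball_ray Rad t th ph Ht).
  split; [|now repeat split; apply Hs]. specialize (Htr _ Hb). unfold D, on_sphere. lra.
Qed.

(** Lagrange's identity: the [ang] are, up to sign, the components of the cross product of two unit
    vectors. *)
Lemma lagrange_ang (x : axis -> R) (th ph : R) : dot x x = 1 ->
  1 - dot x (dir th ph) ^ 2 = ang x X0 X1 th ph ^ 2 + ang x X1 X2 th ph ^ 2 + ang x X2 X0 th ph ^ 2.
Proof.
  intros Hx. assert (H := dir_norm th ph). unfold ang.
  replace 1 with (dot x x * dot (dir th ph) (dir th ph)) by (rewrite Hx, H; ring).
  unfold dot. ring.
Qed.

(** On the sphere [E v_a = L_ba v_b + L_ca v_c] for the Euler operator [E]: vanishing curl turns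
    [w_b d_a v_b] into [w_b d_b v_a] and likewise for [c], and vanishing divergence supplies
    [w_a d_a v_a]. Both rotations are then moved onto the zonal factor. *)
Lemma moment_euler_1 Rad v d (p p' : R -> R)
    (x : axis -> R) (a b c : axis) (t : R) :
  harmonic_gradient Rad v d -> (forall u, is_derive p u (p' u)) -> (forall u, continuous p' u) ->
  cyclic a b c -> Rabs t < Rad ->
  t * sphere_int (fun th ph => zonal p x th ph * radial (d a) t th ph) =
  - (moment (fun th ph => zonal p' x th ph * ang x b a th ph) (v b) t
     + moment (fun th ph => zonal p' x th ph * ang x c a th ph) (v c) t).
Proof.
  intros Hv Hp Hp' Hc Ht. destruct (harmonic_gradient_cont Rad v d t Hv Ht) as (Cv & Cd & Cr).
  assert (Cp : forall u, continuous p u) by (intros u; exact (is_derive_continuous _ _ _ (Hp u))).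
  assert (Nu := fun i j k => null_rotation _ _ i j
    (smooth_mult _ _ _ _ (smooth_zonal p p' x Hp Hp') (on_sphere_smooth Rad (v k) (d k) t (proj1 Hv k) Ht))).
  unfold moment. rewrite <- sphere_int_plus, <- sphere_int_opp, <- sphere_int_scal by cont2s.
  apply (sphere_int_eq_mod _ _ _ (null_plus _ _ (Nu b a b) (Nu c a c))); [cont2s|].
  intros th ph. destruct (riesz_on_sphere Rad v d t th ph Hv Ht) as (T0 & S01 & S12 & S20).
  unfold radial, dot, ang.
  destruct Hc as [(-> & -> & ->)|[(-> & -> & ->)|(-> & -> & ->)]]; rewrite T0, ?S01, ?S12, ?S20; ring.
Qed.

(** The Euler relations tested against the kernels that [moment_euler_1] produces. The spherical
    Laplacian falls on the zonal factor, so that no second derivative of [v] occurs. *)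
Lemma moment_euler_2 Rad v d (p' p'' : R -> R)
    (x : axis -> R) (a b c : axis) (t : R) :
  harmonic_gradient Rad v d ->
  (forall u, is_derive p' u (p'' u)) -> (forall u, continuous p'' u) ->
  cyclic a b c -> dot x x = 1 -> Rabs t < Rad ->
  t * sphere_int (fun th ph => zonal p' x th ph * ang x b a th ph * radial (d b) t th ph
     + zonal p' x th ph * ang x c a th ph * radial (d c) t th ph) =
  moment (zonal (fun s => (1 - s ^ 2) * p'' s - 2 * s * p' s) x) (v a) t
  - (moment (fun th ph => zonal p' x th ph * ang x b a th ph) (v b) t
     + moment (fun th ph => zonal p' x th ph * ang x c a th ph) (v c) t).
Proof.
  intros Hv Hp Hp' Hc Hx Ht. destruct (harmonic_gradient_cont Rad v d t Hv Ht) as (Cv & Cd & Cr).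
  assert (Cp : forall u, continuous p' u) by (intros u; exact (is_derive_continuous _ _ _ (Hp u))).
  assert (Nu := fun e e' i j k => null_rotation _ _ i j
    (smooth_mult _ _ _ _ (smooth_mult _ _ _ _ (smooth_zonal p' p'' x Hp Hp') (smooth_ang x e e'))
      (on_sphere_smooth Rad (v k) (d k) t (proj1 Hv k) Ht))).
  assert (Cq : cont2 (zonal (fun s => (1 - s ^ 2) * p'' s - 2 * s * p' s) x))
    by (apply cont2_zonal; intros u; cont).
  unfold moment. rewrite <- sphere_int_plus, <- sphere_int_minus, <- sphere_int_scal by cont2s.
  (* The first four rotations integrate [E v_b = L_ab v_a + L_cb v_c] and
     [E v_c = L_ac v_a + L_bc v_b] by parts. The last three use the radial part of the curl,
     [L_ba v_c + L_ac v_b + L_cb v_a = 0], tested against [L_bc p]: it adds the missing [L_bc^2 p]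
     to [L_ab^2 p + L_ac^2 p], and the commutators leave the first-order moments of [v_b] and
     [v_c]. *)
  apply (sphere_int_eq_mod _ _ _ (null_plus _ _ (Nu b a a b a) (null_plus _ _ (Nu b a c b c)
    (null_plus _ _ (Nu c a a c a) (null_plus _ _ (Nu c a b c b) (null_plus _ _ (Nu b c b a c)
    (null_plus _ _ (Nu b c a c b) (Nu b c c b a)))))))); [cont2s|].
  intros th ph. destruct (riesz_on_sphere Rad v d t th ph Hv Ht) as (T0 & S01 & S12 & S20).
  unfold zonal at 3. rewrite (lagrange_ang x th ph Hx).
  fold (zonal p' x th ph) (zonal p'' x th ph).
  destruct Hc as [(-> & -> & ->)|[(-> & -> & ->)|(-> & -> & ->)]];
    unfold radial, dot, ang, delta, axis_eqb; rewrite T0, ?S01, ?S12, ?S20; ring.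
Qed.

(** The quotient [f t / t^N] has zero derivative. *)
Lemma euler_ode (f f' : R -> R) (N : nat) (Rad : R) :
  (forall t, 0 < t < Rad -> is_derive f t (f' t)) ->
  (forall t, 0 < t < Rad -> t * f' t = INR N * f t) ->
  forall s t, 0 < s < Rad -> 0 < t < Rad -> f s * t ^ N = f t * s ^ N.
Proof.
  intros H1 H2 s t Hs Ht.
  destruct (MVT_derive (fun u => f u * / u ^ N) (fun _ => 0) s t) as (c & _ & E).
  - intros u Hu. assert (Hu' : 0 < u < Rad) by (revert Hu; unfold Rmin, Rmax; destruct Rle_dec; lra).
    assert (HN : u ^ N <> 0) by (apply pow_nonzero; lra).
    eapply is_derive_eq.
    + exact (is_derive_R_mult f (fun u => / u ^ N) u _ _ (H1 u Hu') (is_derive_inv _ _ _ (is_derive_R_pow N u) HN)).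
    + replace (f' u) with (INR N * f u / u) by (rewrite <- H2 by assumption; field; lra).
      destruct N as [|N]; [simpl; field; lra|]. cbn [Nat.pred pow] in *.
      field. split; [|lra]. intros Z. apply HN. rewrite Z. ring.
  - assert (s ^ N <> 0) by (apply pow_nonzero; lra). assert (t ^ N <> 0) by (apply pow_nonzero; lra).
    assert (E' : f t * / t ^ N = f s * / s ^ N) by (cbv beta in E; lra).
    transitivity (f s * / s ^ N * (s ^ N * t ^ N)); [field; auto|]. rewrite <- E'. field; auto.
Qed.

Lemma moment_derive Rad v d (K : R -> R -> R) (a : axis) (t : R) :
  harmonic_gradient Rad v d -> cont2 K -> Rabs t < Rad ->
  is_derive (moment K (v a)) t (sphere_int (fun th ph => K th ph * radial (d a) t th ph)).
Proof. intros Hv HK Ht. apply (sphere_moment_derive Rad); auto. apply Hv. Qed.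

Lemma exists_cyclic (a : axis) : exists b c, cyclic a b c.
Proof. destruct a; [exists X1, X2 | exists X2, X0 | exists X0, X1]; unfold cyclic; tauto. Qed.

(* With [phi] the moment and [psi = t phi'], Legendre's equation gives [t psi' = N(N+1) phi - psi], so
   [t^(N+1) (psi - N phi)] is constant; it vanishes at [0]. *)
Lemma legendre_moment_euler Rad v d
    (N : nat) (x : axis -> R) (a : axis) (t : R) :
  harmonic_gradient Rad v d -> dot x x = 1 -> 0 < t < Rad ->
  t * sphere_int (fun th ph => zonal (leg N) x th ph * radial (d a) t th ph)
  = INR N * moment (zonal (leg N) x) (v a) t.
Proof.
  intros Hv Hx Ht. destruct (exists_cyclic a) as (b & c & Hc).
  set (phi := moment (zonal (leg N) x) (v a)).
  set (phi' := fun t => sphere_int (fun th ph => zonal (leg N) x th ph * radial (d a) t th ph)).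
  set (mb := moment (fun th ph => zonal (leg' N) x th ph * ang x b a th ph) (v b)).
  set (mc := moment (fun th ph => zonal (leg' N) x th ph * ang x c a th ph) (v c)).
  set (mb' := fun u => sphere_int (fun th ph => zonal (leg' N) x th ph * ang x b a th ph * radial (d b) u th ph)).
  set (mc' := fun u => sphere_int (fun th ph => zonal (leg' N) x th ph * ang x c a th ph * radial (d c) u th ph)).
  assert (Dphi : forall u, Rabs u < Rad -> is_derive phi u (phi' u))
    by (intros u Hu; apply (moment_derive Rad v d); auto with cont).
  assert (Db : forall u, Rabs u < Rad -> is_derive mb u (mb' u))
    by (intros u Hu; apply (moment_derive Rad v d); auto; cont2s).
  assert (Dc : forall u, Rabs u < Rad -> is_derive mc u (mc' u))
    by (intros u Hu; apply (moment_derive Rad v d); auto; cont2s).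
  assert (E1 : forall u, Rabs u < Rad -> u * phi' u = - (mb u + mc u)).
  { intros u Hu. apply (moment_euler_1 Rad v d (leg N) (leg' N)); auto with cont. apply leg_derive. }
  assert (E2 : forall u, Rabs u < Rad -> u * (mb' u + mc' u) = - (INR N * (INR N + 1)) * phi u - (mb u + mc u)).
  { intros u Hu. destruct (harmonic_gradient_cont Rad v d u Hv Hu) as (Cv & _ & Cr).
    unfold mb', mc'. rewrite <- sphere_int_plus by cont2s.
    rewrite (moment_euler_2 Rad v d (leg' N) (leg'' N) x a b c u) by (auto using leg'_derive with cont).
    fold mb mc. f_equal. unfold phi, moment. rewrite <- sphere_int_scal by cont2s.
    apply sphere_int_ext. intros th ph. unfold zonal.
    destruct (legendre_ode N (dot x (dir th ph))) as (_ & _ & E). rewrite E. ring. }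
  assert (Z : t ^ S N * (- (mb t + mc t) - INR N * phi t) = 0).
  { set (chi := fun u => u ^ S N * (- (mb u + mc u) - INR N * phi u)).
    transitivity (chi 0); [|unfold chi; simpl; ring].
    symmetry. apply (eq_is_derive (V := R_NormedModule) chi); [|lra].
    intros u Hu. assert (Hu' : Rabs u < Rad) by (rewrite Rabs_pos_eq; lra).
    specialize (E1 u Hu'). specialize (E2 u Hu').
    eapply is_derive_eq.
    - exact (is_derive_R_mult _ _ _ _ _ (is_derive_R_pow (S N) u) (is_derive_R_minus _ _ _ _ _
        (is_derive_R_opp _ _ _ (is_derive_R_plus _ _ _ _ _ (Db u Hu') (Dc u Hu')))
        (is_derive_R_mult _ _ _ _ _ (is_derive_R_const (INR N) u) (Dphi u Hu')))).
    - cbv beta. eqR. change (@zero R_NormedModule) with 0. rewrite S_INR. cbn [Nat.pred pow].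
      transitivity (u ^ N * ((INR N + 1) * (- (mb u + mc u) - INR N * phi u)
        - u * (mb' u + mc' u) - INR N * (u * phi' u))); [ring|].
      rewrite E1, E2. ring. }
  fold (phi' t). rewrite E1 by (rewrite Rabs_pos_eq; lra).
  apply Rmult_integral in Z. destruct Z as [Z|Z]; [|lra].
  exfalso. revert Z. apply pow_nonzero. lra.
Qed.

Lemma legendre_moment_homogeneous Rad v d
    (N : nat) (x : axis -> R) (a : axis) (s t : R) :
  harmonic_gradient Rad v d -> dot x x = 1 -> 0 < s < Rad -> 0 < t < Rad ->
  moment (zonal (leg N) x) (v a) s * t ^ N = moment (zonal (leg N) x) (v a) t * s ^ N.
Proof.
  intros Hv Hx. apply (euler_ode _ (fun t => sphere_int (fun th ph => zonal (leg N) x th ph * radial (d a) t th ph))).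
  - intros u Hu. apply (moment_derive Rad); auto with cont. rewrite Rabs_pos_eq; lra.
  - intros u Hu. now apply (legendre_moment_euler Rad).
Qed.

(** * Zonal approximation of the identity *)

Definition half_power (k : nat) (u : R) : R := ((1 + u) / 2) ^ k.

Lemma half_power_derive (k : nat) (u : R) :
  is_derive (half_power k) u (INR k / 2 * half_power (pred k) u).
Proof.
  unfold half_power. eapply is_derive_eq.
  - apply (is_derive_R_comp (fun w => w ^ k) (fun u => (1 + u) / 2) u (INR k * ((1 + u) / 2) ^ pred k) (/ 2)).
    + apply is_derive_R_pow.
    + auto_derive; trivial; eqR; field.
  - field.
Qed.

Lemma half_power_continuous (k : nat) (u : R) : continuous (half_power k) u.
Proof. exact (is_derive_continuous _ _ _ (half_power_derive k u)). Qed.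

#[export] Hint Resolve half_power_continuous : cont.

Lemma zonal_le_1 (x : axis -> R) (th ph : R) : dot x x = 1 -> -1 <= dot x (dir th ph) <= 1.
Proof.
  intros Hx. assert (H := dir_norm th ph).
  assert (CS := cauchy_schwarz3 (x X0) (x X1) (x X2) (dir th ph X0) (dir th ph X1) (dir th ph X2)).
  unfold dot in *.
  replace (x X0 ^ 2 + x X1 ^ 2 + x X2 ^ 2) with 1 in CS by (rewrite <- Hx; ring).
  replace (dir th ph X0 ^ 2 + dir th ph X1 ^ 2 + dir th ph X2 ^ 2) with 1 in CS by (rewrite <- H; ring).
  nra.
Qed.

(** The constant field [(1, 0, 0)] is a harmonic gradient; at radius 0 the left side of
    [moment_euler_2] vanishes and only the moment of the component [X0] survives. *)
Lemma zonal_laplacian_null (p' p'' : R -> R) (x : axis -> R) :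
  (forall u, is_derive p' u (p'' u)) -> (forall u, continuous p'' u) -> dot x x = 1 ->
  sphere_int (zonal (fun s => (1 - s ^ 2) * p'' s - 2 * s * p' s) x) = 0.
Proof.
  intros Hp Hp' Hx.
  set (v := fun (a : axis) (_ : pt) => match a with X0 => 1 | _ => 0 end).
  set (d := fun (_ _ : axis) (_ : pt) => 0).
  assert (Hv : harmonic_gradient 1 v d).
  { split; [|split]; [|reflexivity | intros; unfold d; ring].
    intros j i. split.
    - intros y _ eps He. exists 1. split; [lra|]. intros z _. unfold d. rewrite Rminus_0_r, Rabs_R0. exact He.
    - intros y _. exact (is_derive_R_const (v j y) (coord i y)). }
  assert (H0 : Rabs 0 < 1) by (rewrite Rabs_R0; lra).
  assert (E := moment_euler_2 1 v d p' p'' x X0 X1 X2 0 Hv Hp Hp' ltac:(unfold cyclic; tauto) Hx H0).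
  unfold moment, on_sphere, v in E. rewrite Rmult_0_l in E.
  rewrite !(sphere_int_ext (fun th ph => _ * 0) (fun _ _ => 0)) in E by (intros; ring).
  rewrite sphere_int_const in E.
  rewrite (sphere_int_ext _ (fun th ph => zonal (fun s => (1 - s ^ 2) * p'' s - 2 * s * p' s) x th ph * 1)) by (intros; ring).
  lra.
Qed.

(** The spherical Laplacian of [half_power (m+1)] is [(m+1)^2 half_power m - (m+1)(m+2) half_power
    (m+1)]. Its integral is zero, which gives the ratio of consecutive masses. *)
Lemma half_power_int (k : nat) (x : axis -> R) : dot x x = 1 ->
  sphere_int (zonal (half_power k) x) = 4 * PI / (INR k + 1).
Proof.
  intros Hx. induction k as [|m IH].
  - rewrite (sphere_int_ext _ (fun _ _ => 1)) by reflexivity.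
    rewrite sphere_int_const. simpl. field.
  - assert (Hm := pos_INR m).
    assert (Z := zonal_laplacian_null (fun u => INR (S m) / 2 * half_power m u)
      (fun u => INR (S m) / 2 * (INR m / 2 * half_power (pred m) u)) x).
    rewrite (sphere_int_ext _ (fun th ph => (INR m + 1) ^ 2 * zonal (half_power m) x th ph
       + (- ((INR m + 1) * (INR m + 2))) * zonal (half_power (S m)) x th ph)) in Z.
    + rewrite sphere_int_lin in Z by auto with cont.
      rewrite IH in Z. rewrite S_INR.
      apply Rmult_eq_reg_l with ((INR m + 1) * (INR m + 2)).
      2: apply Rmult_integral_contrapositive_currified; lra.
      transitivity ((INR m + 1) ^ 2 * (4 * PI / (INR m + 1))).
      * enough (0 = (INR m + 1) ^ 2 * (4 * PI / (INR m + 1)) + - ((INR m + 1) * (INR m + 2)) * sphere_int (zonal (half_power (S m)) x)) by lra.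
        symmetry. apply Z; auto.
        -- intros u. eapply is_derive_eq.
           apply (is_derive_R_mult (fun _ => INR (S m) / 2) (half_power m)).
           apply is_derive_R_const. apply half_power_derive. cbv beta; ring.
        -- intros u. cont.
      * field. lra.
    + intros th ph. unfold zonal, half_power. set (u := dot x (dir th ph)). rewrite S_INR.
      destruct m as [|m]; [simpl; field|]. rewrite S_INR. cbn [pred pow]. field.
Qed.

Lemma point_dist_sqr (x : axis -> R) (t th ph : R) : dot x x = 1 ->
  pnorm (psub (point (fun i => t * dir th ph i)) (point (fun i => t * x i))) ^ 2
  = t ^ 2 * (2 * (1 - dot x (dir th ph))).
Proof.
  intros Hx. rewrite pnorm_sqr. simpl c0; simpl c1; simpl c2.
  assert (H := dir_norm th ph).
  transitivity (t ^ 2 * (dot x x + dot (dir th ph) (dir th ph) - 2 * dot x (dir th ph))).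
  - unfold dot, dir. ring.
  - rewrite H, Hx. ring.
Qed.

Lemma in_ball_unit (Rad t : R) (x : axis -> R) : dot x x = 1 -> 0 <= t < Rad -> in_ball Rad (point (fun i => t * x i)).
Proof.
  intros Hx Ht. unfold in_ball. apply Rle_lt_trans with t; [|lra]. apply pnorm_le; [lra|].
  simpl c0; simpl c1; simpl c2. right. transitivity (t ^ 2 * dot x x); [unfold dot; ring | rewrite Hx; ring].
Qed.

(* [1 - s] with [s = x.w] is half the squared chord length, and
   [(1 - s)/2 * half_power k s = half_power k s - half_power (k+1) s] has small relative mass. *)
Lemma zonal_approx (Rad : R) (h : pt -> R) (t : R) (x : axis -> R) :
  cont_on_ball Rad h -> 0 < t < Rad -> dot x x = 1 ->
  is_lim_seq (fun k => (INR k + 1) / (4 * PI) * moment (zonal (half_power k) x) h t)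
    (h (point (fun i => t * x i))).
Proof.
  intros Hh Ht Hx. set (y := point (fun i => t * x i)).
  assert (Hta : Rabs t < Rad) by (rewrite Rabs_pos_eq; lra).
  assert (Ch := on_sphere_cont2 Rad h t Hh Hta).
  assert (P := PI_RGT_0).
  (* Near [y] the deviation is below [eps]. At distance at least [dl] the squared chord
     [2 t^2 (1 - s)] is at least [dl^2], so that a multiple of [1 - s] dominates the crude bound
     [M + |h y|]. *)
  assert (K1 : forall eps, 0 < eps -> exists C, 0 <= C /\ forall th ph, 0 <= th <= PI -> 0 <= ph <= 2 * PI ->
     Rabs (on_sphere h t th ph - h y) <= eps + C * (1 - dot x (dir th ph))).
  { intros eps He. destruct (Hh y (in_ball_unit Rad t x Hx ltac:(lra)) eps He) as (dl & D & Hd).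
    destruct (bounded_rectangle (on_sphere h t) 0 PI 0 (2 * PI) Ch) as (M & HM & HB).
    assert (N := Rabs_pos (h y)).
    exists ((M + Rabs (h y)) * (2 * t ^ 2) / dl ^ 2). split.
    { apply Rdiv_le_0_compat; nra. }
    intros th ph H1 H2. assert (Z := zonal_le_1 x th ph Hx).
    assert (E := point_dist_sqr x t th ph Hx). fold y in E.
    set (s := dot x (dir th ph)) in *.
    destruct (Rlt_dec (pnorm (psub (point (fun i => t * dir th ph i)) y)) dl) as [Hl|Hl].
    - apply Rle_trans with eps; [left; now apply Hd|].
      assert (0 <= (M + Rabs (h y)) * (2 * t ^ 2) / dl ^ 2 * (1 - s)); [|lra].
      apply Rmult_le_pos; [|lra]. apply Rdiv_le_0_compat; nra.
    - apply Rle_trans with (M + Rabs (h y)).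
      + unfold Rminus. eapply Rle_trans; [apply Rabs_triang|]. rewrite Rabs_Ropp.
        generalize (HB th ph H1 H2). lra.
      + set (q := pnorm (psub (point (fun i => t * dir th ph i)) y)) in *.
        assert (Hq : dl ^ 2 <= q ^ 2) by nra.
        assert (Hi : 1 <= (2 * t ^ 2 * (1 - s)) / dl ^ 2).
        { apply Rmult_le_reg_r with (dl ^ 2); [nra|]. unfold Rdiv. rewrite Rmult_assoc, Rinv_l, Rmult_1_r by nra. lra. }
        replace ((M + Rabs (h y)) * (2 * t ^ 2) / dl ^ 2 * (1 - s))
          with ((M + Rabs (h y)) * ((2 * t ^ 2 * (1 - s)) / dl ^ 2)) by (field; lra).
        nra. }
  apply is_lim_seq_spec. intros eps. assert (He : 0 < eps / 2) by (generalize (cond_pos eps); lra).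
  destruct (K1 _ He) as (C & HC & HB).
  destruct (nfloor_ex (4 * C / eps)) as [n0 Hn0].
  { apply Rdiv_le_0_compat; [lra | apply eps]. }
  exists n0. intros k Hk. assert (Hk' := le_INR _ _ Hk). assert (Hk0 := pos_INR k).
  assert (I1 := half_power_int k x Hx). assert (I2 := half_power_int (S k) x Hx). rewrite S_INR in I2.
  set (dev := fun th ph => zonal (half_power k) x th ph * (on_sphere h t th ph - h y)).
  assert (E : (INR k + 1) / (4 * PI) * moment (zonal (half_power k) x) h t - h y = (INR k + 1) / (4 * PI) * sphere_int dev).
  { unfold dev, moment.
    rewrite (sphere_int_ext (fun th ph => zonal (half_power k) x th ph * (on_sphere h t th ph - h y))
      (fun th ph => 1 * (zonal (half_power k) x th ph * on_sphere h t th ph) + (- h y) * zonal (half_power k) x th ph))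
      by (intros; ring).
    rewrite sphere_int_lin, I1 by cont2s. field. lra. }
  rewrite E, Rabs_mult, Rabs_pos_eq.
  2: { apply Rdiv_le_0_compat; lra. }
  (* As [1 - s = 2 (1 - (1 + s)/2)], integrating [eps/2 + C (1 - s)] against [half_power k] involves
     the masses of orders [k] and [k + 1]; normalised, the result is [eps/2 + 2 C / (k + 2)]. *)
  assert (B : Rabs (sphere_int dev) <= (eps / 2 + 2 * C) * (4 * PI / (INR k + 1)) + (- (2 * C)) * (4 * PI / (INR k + 1 + 1))).
  { rewrite <- I1, <- I2, <- sphere_int_lin by auto with cont. apply sphere_int_abs_le; [unfold dev; cont2s | cont2s |].
    - intros th ph H1 H2. unfold dev. specialize (HB th ph H1 H2). rewrite Rabs_mult.
      assert (Z := zonal_le_1 x th ph Hx).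
      assert (Q : 0 <= zonal (half_power k) x th ph) by (unfold zonal, half_power; apply pow_le; lra).
      rewrite (Rabs_pos_eq _ Q).
      apply Rle_trans with (zonal (half_power k) x th ph * (eps / 2 + C * (1 - dot x (dir th ph)))).
      + now apply Rmult_le_compat_l.
      + right. unfold zonal, half_power. cbn [pow]. field. }
  apply Rle_lt_trans with ((INR k + 1) / (4 * PI) * ((eps / 2 + 2 * C) * (4 * PI / (INR k + 1)) + (- (2 * C)) * (4 * PI / (INR k + 1 + 1)))).
  - apply Rmult_le_compat_l; auto. apply Rdiv_le_0_compat; lra.
  - replace ((INR k + 1) / (4 * PI) * ((eps / 2 + 2 * C) * (4 * PI / (INR k + 1)) + (- (2 * C)) * (4 * PI / (INR k + 1 + 1))))
      with (eps / 2 + 2 * C / (INR k + 2)) by (field; lra).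
    assert (Heps := cond_pos eps).
    assert (2 * C / (INR k + 2) < eps / 2); [|lra].
    apply Rmult_lt_reg_r with (INR k + 2); [lra|]. unfold Rdiv at 1. rewrite Rmult_assoc, Rinv_l, Rmult_1_r by lra.
    assert (4 * C / eps < INR k + 1) by lra.
    assert (4 * C < (INR k + 1) * eps).
    { replace (4 * C) with (4 * C / eps * eps) by (field; lra). now apply Rmult_lt_compat_r. }
    nra.
Qed.

(** * Rotation about the zeroth axis *)

(* [Re ((p - i q) (a + i b)^n)]. *)
Fixpoint sector (n : nat) (p q a b : R) : R :=
  match n with
  | O => p
  | S m => a * sector m p q a b + b * sector m q (- p) a b
  end.

Lemma sector_lin (n : nat) (k l p q p' q' a b : R) :
  sector n (k * p + l * p') (k * q + l * q') a b = k * sector n p q a b + l * sector n p' q' a b.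
Proof.
  revert p q p' q'. induction n as [|n IH]; intros p q p' q'; simpl; trivial.
  replace (- (k * p + l * p')) with (k * - p + l * - p') by ring. rewrite !IH. ring.
Qed.

Lemma sector_opp (n : nat) (p q a b : R) : sector n (- p) (- q) a b = - sector n p q a b.
Proof.
  replace (- p) with (-1 * p + 0 * p) by ring. replace (- q) with (-1 * q + 0 * q) by ring.
  rewrite sector_lin. ring.
Qed.

(** Passing from [(p, q)] to [(q, - p)] multiplies [p - i q] by [i], so [sector n p q] and
    [sector n q (- p)] are the real part and minus the imaginary part of [(p - i q) z^n]. The claim
    is then [(z z')^n = z^n z'^n]. *)
Lemma sector_mult (n : nat) (p q a b c d : R) :
  sector n p q (a * c - b * d) (a * d + b * c) = sector n (sector n p q a b) (sector n q (- p) a b) c d.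
Proof.
  revert p q. induction n as [|n IH]; intros p q; simpl; trivial.
  rewrite !IH, !sector_opp.
  set (P := sector n p q a b). set (Q := sector n q (- p) a b).
  replace (- (a * P + b * Q)) with (a * - P + - b * Q) by ring.
  replace (a * Q + b * - P) with (a * Q + - b * P) by ring.
  replace (sector n (a * P + b * Q) (a * Q + - b * P) c d)
    with (sector n (a * P + b * Q) (a * Q + b * - P) c d) by (f_equal; ring).
  rewrite !sector_lin. ring.
Qed.

Definition wave (k : nat) (p q s : R) : R := p * cos (INR k * s) + q * sin (INR k * s).

Lemma wave_mean (k : nat) (p q : R) : RInt (wave (S k) p q) (- PI) PI = 0.
Proof.
  assert (Hk : 0 < INR (S k)) by (apply lt_0_INR; lia).
  assert (P := PI_RGT_0).
  assert (E : sin (INR (S k) * PI) = 0).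
  { apply sin_eq_0_1. exists (Z.of_nat (S k)). now rewrite INR_IZR_INZ. }
  rewrite (RInt_FTC (fun s => (p * sin (INR (S k) * s) - q * cos (INR (S k) * s)) / INR (S k)) (wave (S k) p q)).
  - replace (INR (S k) * - PI) with (- (INR (S k) * PI)) by ring. rewrite sin_neg, cos_neg, E. eqR. field. lra.
  - lra.
  - intros s _. unfold wave. set (w := INR (S k)) in *. clearbody w. auto_derive; trivial. eqR. field. lra.
  - intros s _. unfold wave. cont.
Qed.

(** The values of [x.w] while [x] turns about axis 0: [s] is the angle, and [c], [d1], [d2] depend
    on [x] and [w]. *)
Definition circ (c d1 d2 s : R) : R := c + d1 * cos s + d2 * sin s.

Definition leg_mode (c d1 d2 : R) (n k : nat) (p q : R) : R :=
  RInt (fun s => leg n (circ c d1 d2 s) * wave k p q s) (- PI) PI.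

Lemma ex_leg_mode (c d1 d2 : R) (n k : nat) (p q : R) :
  ex_RInt (fun s => leg n (circ c d1 d2 s) * wave k p q s) (- PI) PI.
Proof. apply ex_RInt_everywhere. intros s. unfold circ, wave. cont. Qed.

(** Bonnet's recursion, in which multiplication of a mode by [cos s] or [sin s] splits into the two
    neighbouring modes. *)
Lemma leg_mode_rec (c d1 d2 : R) (n k : nat) (p q : R) :
  (INR n + 1) * leg_mode c d1 d2 (S n) (S k) p q =
    (2 * INR n + 1) * (c * leg_mode c d1 d2 n (S k) p q
      + d1 / 2 * (leg_mode c d1 d2 n (S (S k)) p q + leg_mode c d1 d2 n k p q)
      + d2 / 2 * (leg_mode c d1 d2 n (S (S k)) (- q) p - leg_mode c d1 d2 n k (- q) p))
    - INR n * leg_mode c d1 d2 (pred n) (S k) p q.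
Proof.
  set (M := fun n k p q s => leg n (circ c d1 d2 s) * wave k p q s).
  assert (EM : forall n k p q, ex_RInt (M n k p q) (- PI) PI) by (intros; apply ex_leg_mode).
  set (m := 2 * INR n + 1).
  transitivity (RInt (fun s => 1 * ((m * c) * M n (S k) p q s + (m * (d1 / 2)) * (1 * M n (S (S k)) p q s + 1 * M n k p q s))
    + 1 * ((m * (d2 / 2)) * (1 * M n (S (S k)) (- q) p s + (-1) * M n k (- q) p s) + (- INR n) * M (pred n) (S k) p q s)) (- PI) PI).
  - etransitivity; [symmetry; exact (RInt_R_scal _ _ _ (INR n + 1) (EM (S n) (S k) p q))|].
    apply RInt_ext_R. intros s. unfold M, m, wave.
    replace (INR k * s) with (INR (S k) * s - s) by (rewrite S_INR; ring).
    replace (INR (S (S k)) * s) with (INR (S k) * s + s) by (rewrite !S_INR; ring).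
    rewrite cos_plus, cos_minus, sin_plus, sin_minus, <- Rmult_assoc.
    replace ((INR n + 1) * leg (S n) (circ c d1 d2 s)) with
      ((2 * INR n + 1) * (circ c d1 d2 s * leg n (circ c d1 d2 s)) - INR n * leg (pred n) (circ c d1 d2 s))
      by (generalize (leg_mult_id n (circ c d1 d2 s)); lra).
    unfold circ at 1. field.
  - rewrite !RInt_lin by (auto using ex_RInt_lin). unfold leg_mode, M, m. eqR. ring.
Qed.

(* Only the leading coefficient of [leg n] contributes to its [n]-th Fourier mode on a circle. *)
Lemma leg_fourier (n : nat) : exists kappa, forall c d1 d2 p q : R,
  (forall k, (n < k)%nat -> leg_mode c d1 d2 n k p q = 0) /\
  leg_mode c d1 d2 n n p q = kappa * sector n p q d1 d2.
Proof.
  induction n as [n IH] using (well_founded_induction lt_wf).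
  destruct n as [|n].
  - exists (2 * PI). intros c d1 d2 p q.
    assert (E : forall k, leg_mode c d1 d2 0 k p q = RInt (wave k p q) (- PI) PI).
    { intros k. apply RInt_ext_R. intros s. unfold leg; simpl (fst _). ring. }
    split.
    + intros [|k] Hk; [lia|]. rewrite E. apply wave_mean.
    + rewrite E, (RInt_ext_R _ (fun _ => p)).
      * rewrite RInt_constant. simpl. eqR; ring.
      * intros s. unfold wave. simpl INR. rewrite Rmult_0_l, cos_0, sin_0. ring.
  - destruct (IH n) as (kap & Hn); [lia|]. destruct (IH (pred n)) as (kap' & Hp); [lia|].
    assert (HN := pos_INR n).
    (* The leading coefficients of [leg (S n)] and [leg n] have quotient [(2n+1)/(n+1)]; the further
       1/2 is the share of one neighbouring mode. *)
    exists ((2 * INR n + 1) / (2 * (INR n + 1)) * kap). intros c d1 d2 p q. split.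
    + intros [|k] Hk; [lia|]. apply Rmult_eq_reg_l with (INR n + 1); [|lra].
      rewrite leg_mode_rec, !(proj1 (Hn _ _ _ _ _)), (proj1 (Hp _ _ _ _ _)) by lia. ring.
    + apply Rmult_eq_reg_l with (INR n + 1); [|lra].
      rewrite leg_mode_rec, !(proj2 (Hn _ _ _ _ _)), !(proj1 (Hn _ _ _ _ _)), (proj1 (Hp _ _ _ _ _)) by lia.
      simpl sector. rewrite <- (Ropp_involutive p) at 2. rewrite sector_opp. field. lra.
Qed.

Definition rot (x : axis -> R) (s : R) (i : axis) : R :=
  match i with
  | X0 => x X0
  | X1 => x X1 * cos s - x X2 * sin s
  | X2 => x X1 * sin s + x X2 * cos s
  end.

Lemma rot_norm (x : axis -> R) (s : R) : dot (rot x s) (rot x s) = dot x x.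
Proof.
  unfold dot, rot. assert (E := sin_cos_sqr s).
  transitivity (x X0 * x X0 + (sin s * sin s + cos s * cos s) * (x X1 * x X1 + x X2 * x X2)); [ring|].
  rewrite E. ring.
Qed.

Lemma rot_0 (x : axis -> R) (i : axis) : rot x 0 i = x i.
Proof. destruct i; simpl; rewrite ?cos_0, ?sin_0; ring. Qed.

Lemma cont3_rot_dot (x : axis -> R) (s : R) : cont3 (fun s th ph => dot (rot x s) (dir th ph)) s.
Proof.
  intros th ph. unfold dot, rot, dir. cont.
Qed.

Lemma cont3_zonal_rot (p : R -> R) (x : axis -> R) (s : R) : (forall u, continuous p u) ->
  cont3 (fun s => zonal p (rot x s)) s.
Proof. intros Hp th ph. apply continuous_R_comp; auto. apply (cont3_rot_dot x s th ph). Qed.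

Lemma sphere_int_fubini (F : R -> R -> R -> R) (a b : R) : a <= b -> (forall s, cont3 F s) ->
  RInt (fun s => sphere_int (F s)) a b = sphere_int (fun th ph => RInt (fun s => F s th ph) a b).
Proof.
  intros Hab HF. unfold sphere_int.
  set (G := fun s th => RInt (fun ph => sin th * F s th ph) 0 (2 * PI)).
  transitivity (RInt (fun th => RInt (fun s => G s th) a b) 0 PI).
  - apply (fubini G); auto using PI_nonneg.
    intros s th. apply (sphere_inner_continuous F). apply filter_forall. apply HF.
  - apply RInt_ext_R. intros th. unfold G.
    transitivity (RInt (fun ph => RInt (fun s => sin th * F s th ph) a b) 0 (2 * PI)).
    + apply (fubini (fun s ph => sin th * F s th ph)); auto using two_PI_pos.
      intros s ph. apply continuous_R_mult; [apply continuous_const|].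
      apply (continuous_comp (fun p : R * R => ((fst p, th), snd p))
        (fun p : (R * R) * R => F (fst (fst p)) (snd (fst p)) (snd p))); [cont | apply HF].
    + apply RInt_ext_R. intros ph.
      apply RInt_R_scal, ex_RInt_everywhere. intros s.
      apply (continuous_comp (fun s : R => ((s, th), ph))
        (fun p : (R * R) * R => F (fst (fst p)) (snd (fst p)) (snd p))); [cont | apply HF].
Qed.

Lemma moment_rot_derive (Rad : R) (h : pt -> R) (p p' : R -> R) (x : axis -> R) (t s : R) :
  (forall u, is_derive p u (p' u)) -> (forall u, continuous p' u) ->
  cont_on_ball Rad h -> Rabs t < Rad ->
  is_derive (fun s => moment (zonal p (rot x s)) h t) s
    (- moment (fun th ph => zonal p' (rot x s) th ph * ang (rot x s) X1 X2 th ph) h t).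
Proof.
  intros Hp Hp' Hh Ht.
  assert (Cp : forall u, continuous p u) by (intros u; exact (is_derive_continuous _ _ _ (Hp u))).
  assert (Ch := on_sphere_cont2 Rad h t Hh Ht).
  set (F' := fun s th ph => zonal p' (rot x s) th ph
     * (rot x s X1 * dir th ph X2 + - rot x s X2 * dir th ph X1) * on_sphere h t th ph).
  apply is_derive_eq with (sphere_int (F' s)).
  - apply (sphere_int_derive (fun s th ph => zonal p (rot x s) th ph * on_sphere h t th ph) F').
    apply filter_forall. intros u. split; [|split].
    + apply cont3_mult; [now apply cont3_zonal_rot | now apply cont3_const_l].
    + apply cont3_mult; [apply cont3_mult; [now apply cont3_zonal_rot|] | now apply cont3_const_l].
      intros th ph. unfold rot, dir. cont.
    + intros th ph. eapply is_derive_eq.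
      * apply (is_derive_R_mult (fun u => zonal p (rot x u) th ph) (fun _ => on_sphere h t th ph)).
        -- apply (is_derive_R_comp p (fun u => dot (rot x u) (dir th ph))); [apply Hp|].
           unfold dot, rot. auto_derive; trivial.
        -- apply is_derive_R_const.
      * unfold F', zonal. cbv beta. set (q := p' (dot (rot x u) (dir th ph))).
        unfold rot. simpl (dir th ph X1). simpl (dir th ph X2). eqR. ring.
  - unfold moment. rewrite <- sphere_int_opp.
    + apply sphere_int_ext. intros th ph. unfold F', ang. ring.
    + cont2s.
Qed.

(** Pointwise: by Cauchy-Schwarz and Lagrange's identity the rotation coefficient is at most
    [sqrt ((1 - s^2)(u1^2 + u2^2))], and Sonin's inequality bounds [(1 - s^2) P'^2] by [N(N+1)]. *)
Lemma tangential_bound (g : R -> R -> R) (N : nat) (x : axis -> R) (u1 u2 B : R) :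
  cont2 g -> dot x x = 1 -> 0 <= B ->
  (forall th ph, 0 <= th <= PI -> 0 <= ph <= 2 * PI -> Rabs (g th ph) <= B) ->
  Rabs (sphere_int (fun th ph => zonal (leg' N) x th ph * (u1 * ang x X0 X1 th ph + u2 * ang x X0 X2 th ph) * g th ph))
  <= 4 * PI * (sqrt (INR N * (INR N + 1) * (u1 ^ 2 + u2 ^ 2)) * B).
Proof.
  intros Cg Hx HB Hg. apply sphere_int_abs_const.
  - cont2s.
  - intros th ph H1 H2. rewrite Rabs_mult.
    apply Rmult_le_compat; try apply Rabs_pos; auto.
    rewrite <- sqrt_Rsqr_abs. apply sqrt_le_1_alt. unfold Rsqr.
    assert (SB := sonin_bound N _ (zonal_le_1 x th ph Hx)). fold (zonal (leg' N) x th ph) in SB.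
    assert (LG := lagrange_ang x th ph Hx).
    assert (Z20 : ang x X2 X0 th ph ^ 2 = ang x X0 X2 th ph ^ 2) by (unfold ang; ring).
    rewrite Z20 in LG.
    set (D := zonal (leg' N) x th ph) in *. set (l1 := ang x X0 X1 th ph) in *. set (l2 := ang x X0 X2 th ph) in *.
    set (l3 := ang x X1 X2 th ph) in *. set (s := dot x (dir th ph)) in *.
    assert (HN : 0 <= INR N * (INR N + 1)) by (generalize (pos_INR N); nra).
    assert (S1 : (1 - s ^ 2) * D ^ 2 <= INR N * (INR N + 1)).
    { assert (0 <= INR N * (INR N + 1) * leg N s ^ 2) by (apply Rmult_le_pos; [auto | apply pow2_ge_0]). lra. }
    assert (CS : (u1 * l1 + u2 * l2) ^ 2 <= (u1 ^ 2 + u2 ^ 2) * (1 - s ^ 2)).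
    { assert (0 <= (u1 * l2 - u2 * l1) ^ 2 + (u1 ^ 2 + u2 ^ 2) * l3 ^ 2).
      { generalize (pow2_ge_0 (u1 * l2 - u2 * l1)) (pow2_ge_0 u1) (pow2_ge_0 u2) (pow2_ge_0 l3). nra. }
      rewrite LG. lra. }
    replace (D * (u1 * l1 + u2 * l2) * (D * (u1 * l1 + u2 * l2))) with (D ^ 2 * (u1 * l1 + u2 * l2) ^ 2) by ring.
    apply Rle_trans with (D ^ 2 * ((u1 ^ 2 + u2 ^ 2) * (1 - s ^ 2))).
    + apply Rmult_le_compat_l; auto. apply pow2_ge_0.
    + replace (D ^ 2 * ((u1 ^ 2 + u2 ^ 2) * (1 - s ^ 2))) with ((1 - s ^ 2) * D ^ 2 * (u1 ^ 2 + u2 ^ 2)) by ring.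
      apply Rmult_le_compat_r; auto. generalize (pow2_ge_0 u1) (pow2_ge_0 u2). lra.
Qed.

(** [f 0] is minus the mean of [f s - f 0], and [|s| <= PI] throughout. This is the origin of [PI]
    under the square root of the degree bounds. *)
Lemma mean_zero_bound (f f' : R -> R) (m : R) :
  (forall s, is_derive f s (f' s)) -> (forall s, Rabs (f' s) <= m) ->
  RInt f (- PI) PI = 0 -> Rabs (f 0) <= PI * m.
Proof.
  intros Hf Hm HI. assert (P := PI_RGT_0).
  assert (Cf : forall s, continuous f s) by (intros s; exact (is_derive_continuous _ _ _ (Hf s))).
  assert (Ex : ex_RInt f (- PI) PI) by now apply ex_RInt_everywhere.
  assert (m0 : 0 <= m) by (apply Rle_trans with (2 := Hm 0); apply Rabs_pos).
  assert (B : forall s, - PI <= s <= PI -> Rabs (f s - f 0) <= PI * m).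
  { intros s Hs. destruct (MVT_derive f f' 0 s) as (c & _ & E).
    - intros; apply Hf.
    - rewrite E, Rabs_mult, Rmult_comm. apply Rmult_le_compat; auto; try apply Rabs_pos.
      unfold Rabs; destruct Rcase_abs; lra. }
  assert (Ec := ex_RInt_const (V := R_NormedModule) (- PI) PI (f 0) : ex_RInt (fun _ : R => f 0) (- PI) PI).
  assert (H := abs_RInt_le_const (fun s => 1 * f s + -1 * f 0) (- PI) PI (PI * m) ltac:(lra) (ex_RInt_lin f _ 1 (-1) _ _ Ex Ec)).
  rewrite RInt_lin, HI, RInt_constant in H by auto.
  replace (1 * 0 + -1 * ((PI - - PI) * f 0)) with (- (2 * PI * f 0)) in H by ring.
  rewrite Rabs_Ropp, Rabs_mult, (Rabs_pos_eq (2 * PI)) in H by lra.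
  apply Rmult_le_reg_l with (2 * PI); [lra|]. replace (2 * PI * (PI * m)) with ((PI - - PI) * (PI * m)) by ring.
  apply H. intros s Hs. replace (1 * f s + -1 * f 0) with (f s - f 0) by ring. auto.
Qed.

Definition sectoral (N : nat) (p q th ph : R) : R := sector N p q (dir th ph X1) (dir th ph X2).

(* [(sector N p q, sector N q (- p))] is the gradient of [sector (N + 1) p q / (N + 1)]. *)
Definition sectoral_moment (N : nat) (p q : R) (v : axis -> pt -> R) (t : R) : R :=
  moment (sectoral N p q) (v X1) t + moment (sectoral N q (- p)) (v X2) t.

Definition no_sectoral (N : nat) (v : axis -> pt -> R) (t : R) : Prop :=
  forall p q, sectoral_moment N p q v t = 0.

Lemma cont2_sector (N : nat) (p q : R) : cont2 (sectoral N p q).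
Proof. unfold sectoral. revert p q. induction N as [|N IH]; intros p q; simpl sector; cont2s. Qed.

#[export] Hint Resolve cont2_sector : cont.

(** After Fubini, averaging [P_N] of the rotating product against a wave of frequency [N] gives, by
    [leg_fourier], a multiple of a sectoral harmonic of [w]. The dependence on [x] sits in the
    coefficients [Xr] and [Xi], to which [no_sectoral] applies. *)
Lemma rot_mean_zero Rad v (N : nat) (x : axis -> R) (t e1 e2 : R) :
  (forall j, cont_on_ball Rad (v j)) -> Rabs t < Rad -> no_sectoral N v t ->
  RInt (fun s => wave N e1 e2 s * moment (zonal (leg N) (rot x s)) (v X1) t
    + wave N e2 (- e1) s * moment (zonal (leg N) (rot x s)) (v X2) t) (- PI) PI = 0.
Proof.
  intros Hv Ht J. assert (P := PI_RGT_0).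
  assert (C1 := on_sphere_cont2 Rad _ t (Hv X1) Ht). assert (C2 := on_sphere_cont2 Rad _ t (Hv X2) Ht).
  unfold no_sectoral, sectoral_moment, moment in *.
  set (w1 := on_sphere (v X1) t) in *. set (w2 := on_sphere (v X2) t) in *.
  set (F := fun s th ph => zonal (leg N) (rot x s) th ph * (wave N e1 e2 s * w1 th ph + wave N e2 (- e1) s * w2 th ph)).
  assert (CF : forall s, cont3 F s).
  { intros s. assert (Cw : forall p q, cont3 (fun s _ _ => wave N p q s) s) by (intros p q th ph; unfold wave; cont).
    apply cont3_mult; [apply cont3_zonal_rot; auto with cont|].
    apply cont3_plus; apply cont3_mult; auto; now apply cont3_const_l. }
  transitivity (RInt (fun s => sphere_int (F s)) (- PI) PI).
  - apply RInt_ext_R. intros s. rewrite <- sphere_int_lin by cont2s.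
    apply sphere_int_ext. intros th ph. unfold F. ring.
  - rewrite sphere_int_fubini by (auto; lra).
    destruct (leg_fourier N) as (kappa & HK).
    set (Xr := sector N e1 e2 (x X1) (- x X2)). set (Xi := sector N e2 (- e1) (x X1) (- x X2)).
    rewrite <- (Rmult_0_r kappa), <- (J Xr Xi), <- sphere_int_plus, <- sphere_int_scal by cont2s.
    apply sphere_int_ext. intros th ph.
    set (c := x X0 * dir th ph X0).
    set (d1 := x X1 * dir th ph X1 - - x X2 * dir th ph X2).
    set (d2 := x X1 * dir th ph X2 + - x X2 * dir th ph X1).
    transitivity (w1 th ph * leg_mode c d1 d2 N N e1 e2 + w2 th ph * leg_mode c d1 d2 N N e2 (- e1)).
    + unfold leg_mode. rewrite <- RInt_lin by apply ex_leg_mode.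
      apply RInt_ext_R. intros s. unfold F, zonal.
      replace (dot (rot x s) (dir th ph)) with (circ c d1 d2 s) by (unfold circ, c, d1, d2, dot, rot; ring).
      ring.
    + rewrite !(proj2 (HK _ _ _ _ _)). unfold d1, d2. rewrite !sector_mult, sector_opp. fold Xr Xi. unfold sectoral. ring.
Qed.

Lemma projected_bound Rad v d (N : nat)
    (x : axis -> R) (t e1 e2 B : R) :
  harmonic_gradient Rad v d -> dot x x = 1 -> 0 < t < Rad -> 0 <= B ->
  (forall th ph, Rabs (on_sphere (v X0) t th ph) <= B) -> no_sectoral N v t ->
  Rabs (e1 * moment (zonal (leg N) x) (v X1) t + e2 * moment (zonal (leg N) x) (v X2) t)
  <= PI * (4 * PI * (sqrt (INR N * (INR N + 1) * (e1 ^ 2 + e2 ^ 2)) * B)).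
Proof.
  intros Hv Hx Ht HB Hg HN.
  assert (Hta : Rabs t < Rad) by (rewrite Rabs_pos_eq; lra).
  assert (Cv : forall j, cont_on_ball Rad (v j)) by (intros j; apply (C1_cont_on_ball Rad _ (d j)), Hv).
  destruct (harmonic_gradient_cont Rad v d t Hv Hta) as (Cs & _ & _).
  set (a := fun s => moment (zonal (leg N) (rot x s)) (v X1) t).
  set (b := fun s => moment (zonal (leg N) (rot x s)) (v X2) t).
  set (M := fun i j k s => moment (fun th ph => zonal (leg' N) (rot x s) th ph * ang (rot x s) i j th ph) (v k) t).
  assert (CM : forall i j k s, cont2 (fun th ph => zonal (leg' N) (rot x s) th ph * ang (rot x s) i j th ph * on_sphere (v k) t th ph)).
  { intros i j k s. cont2s. }
  assert (Da : forall s, is_derive a s (- M X1 X2 X1 s)).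
  { intros s. exact (moment_rot_derive Rad (v X1) (leg N) (leg' N) x t s (leg_derive N) (leg'_continuous N) (Cv X1) Hta). }
  assert (Db : forall s, is_derive b s (- M X1 X2 X2 s)).
  { intros s. exact (moment_rot_derive Rad (v X2) (leg N) (leg' N) x t s (leg_derive N) (leg'_continuous N) (Cv X2) Hta). }
  assert (Ea : forall s, INR N * a s = M X1 X2 X2 s - M X0 X1 X0 s).
  { intros s. unfold a. rewrite <- (legendre_moment_euler Rad v d) by (auto; now rewrite rot_norm).
    rewrite (moment_euler_1 Rad v d (leg N) (leg' N) _ X1 X2 X0 t) by
      (auto using leg_derive with cont; unfold cyclic; tauto).
    fold (M X2 X1 X2 s) (M X0 X1 X0 s).
    enough (M X2 X1 X2 s = - M X1 X2 X2 s) by lra.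
    unfold M, moment. rewrite <- sphere_int_opp by apply CM.
    apply sphere_int_ext. intros th ph. unfold ang. ring. }
  assert (Eb : forall s, INR N * b s = - M X1 X2 X1 s - M X0 X2 X0 s).
  { intros s. unfold b. rewrite <- (legendre_moment_euler Rad v d) by (auto; now rewrite rot_norm).
    rewrite (moment_euler_1 Rad v d (leg N) (leg' N) _ X2 X0 X1 t) by
      (auto using leg_derive with cont; unfold cyclic; tauto).
    fold (M X0 X2 X0 s) (M X1 X2 X1 s). ring. }
  (* [f] is the real part of [(e1 - i e2) e^(iNs) (a + i b)]. The exponential is an integrating
     factor for [N a + b' = alpha], [N b - a' = beta]: the derivative of [f] contains only moments
     of [v0], and [f 0] is the combination to be bounded. *)
  set (f := fun s => wave N e1 e2 s * a s + wave N e2 (- e1) s * b s).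
  set (u1 := wave N e2 (- e1)). set (u2 := wave N (- e1) (- e2)).
  assert (Dw : forall p q s, is_derive (wave N p q) s (INR N * wave N q (- p) s))
    by (intros p q s; unfold wave; auto_derive; trivial; eqR; ring).
  replace (e1 * moment (zonal (leg N) x) (v X1) t + e2 * moment (zonal (leg N) x) (v X2) t) with (f 0).
  - apply (mean_zero_bound f (fun s => - (u1 s * M X0 X1 X0 s + u2 s * M X0 X2 X0 s))).
    + intros s. eapply is_derive_eq.
      * exact (is_derive_R_plus _ _ _ _ _ (is_derive_R_mult _ _ _ _ _ (Dw e1 e2 s) (Da s))
          (is_derive_R_mult _ _ _ _ _ (Dw e2 (- e1) s) (Db s))).
      * transitivity (u1 s * (INR N * a s) + u2 s * (INR N * b s) - wave N e1 e2 s * M X1 X2 X1 s - u1 s * M X1 X2 X2 s);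
          [unfold u1, u2; ring|].
        rewrite Ea, Eb. unfold u1, u2, wave. ring.
    + intros s. rewrite Rabs_Ropp.
      replace (e1 ^ 2 + e2 ^ 2) with (u1 s ^ 2 + u2 s ^ 2).
      * unfold M, moment. rewrite <- sphere_int_lin by apply CM.
        rewrite (sphere_int_ext _ (fun th ph => zonal (leg' N) (rot x s) th ph
          * (u1 s * ang (rot x s) X0 X1 th ph + u2 s * ang (rot x s) X0 X2 th ph) * on_sphere (v X0) t th ph))
          by (intros; ring).
        apply (tangential_bound (on_sphere (v X0) t) N (rot x s) (u1 s) (u2 s) B); auto.
        now rewrite rot_norm.
      * unfold u1, u2, wave. assert (E := sin_cos_sqr (INR N * s)).
        transitivity ((e1 ^ 2 + e2 ^ 2) * (sin (INR N * s) * sin (INR N * s) + cos (INR N * s) * cos (INR N * s))); [ring|].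
        rewrite E. ring.
    + exact (rot_mean_zero Rad v N x t e1 e2 Cv Hta HN).
  - unfold f, wave. rewrite Rmult_0_r, cos_0, sin_0.
    assert (R0 : forall k, moment (zonal (leg N) (rot x 0)) (v k) t = moment (zonal (leg N) x) (v k) t).
    { intros k. unfold moment. apply sphere_int_ext. intros th ph. unfold zonal, dot. now rewrite !rot_0. }
    unfold a, b. rewrite !R0. ring.
Qed.

(** * The estimate for harmonic gradients *)

Lemma PI_sqr_le : PI ^ 2 <= 10.4.
Proof.
  (* A partial sum of the Leibniz series; it gives [PI <= 3.21], and [3.21^2 < 10.4]. *)
  assert (H := proj2 (PI_ineq 8)). assert (P := PI_RGT_0).
  unfold tg_alt, PI_tg in H. simpl in H.
  assert (PI <= 3.21) by (field_simplify in H; lra). nra.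
Qed.

Definition growth (N : nat) : R := (INR N + 1) * (2 * INR N + 1) * (INR N + 2).

Lemma growth_sum (n : nat) (t : R) : 0 <= t < 1 ->
  sum_f_R0 (fun N => growth N * t ^ N) n <= (2 + 10 * t) / (1 - t) ^ 4.
Proof.
  intros Ht.
  (* the exact value of [sum_(N >= m) growth N t^(N-m)], from the finite differences of [growth] *)
  set (tail := fun m : R => (m + 1) * (2 * m + 1) * (m + 2) / (1 - t)
     + (6 * m ^ 2 + 20 * m + 16) * t / (1 - t) ^ 2 + (12 * m + 26) * t ^ 2 / (1 - t) ^ 3 + 12 * t ^ 3 / (1 - t) ^ 4).
  assert (E : sum_f_R0 (fun N => growth N * t ^ N) n = (2 + 10 * t) / (1 - t) ^ 4 - t ^ (S n) * tail (INR n + 1)).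
  { induction n as [|n IH].
    - unfold growth, tail. simpl. field. lra.
    - rewrite tech5, IH. unfold growth, tail. rewrite S_INR. cbn [pow]. field. lra. }
  rewrite E. assert (0 <= t ^ S n * tail (INR n + 1)); [|lra].
  assert (Hn := pos_INR n). assert (I : forall k, 0 <= / (1 - t) ^ k).
  { intros k. left. apply Rinv_0_lt_compat, pow_lt. lra. }
  apply Rmult_le_pos; [now apply pow_le|]. unfold tail, Rdiv.
  replace (/ (1 - t)) with (/ (1 - t) ^ 1) by (f_equal; ring).
  assert (T2 := pow_le t 2 (proj1 Ht)). assert (T3 := pow_le t 3 (proj1 Ht)).
  repeat apply Rplus_le_le_0_compat; (apply Rmult_le_pos; [|apply I]); repeat apply Rmult_le_pos; try lra; nra.
Qed.

Lemma growth_dominates (N : nat) : (1 <= N)%nat ->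
  (2 * INR N + 1) * sqrt (1 + PI ^ 2 * (INR N * (INR N + 1))) <= sqrt (2 / 3) * growth N.
Proof.
  intros HN. assert (H1 : 1 <= INR N) by (apply (le_INR 1); auto).
  assert (P := PI_sqr_le). unfold growth.
  apply Rle_trans with ((2 * INR N + 1) * (sqrt (2 / 3) * ((INR N + 1) * (INR N + 2)))); [|right; ring].
  apply Rmult_le_compat_l; [lra|].
  rewrite <- (sqrt_pow2 ((INR N + 1) * (INR N + 2))) by nra.
  rewrite <- sqrt_mult_alt by lra. apply sqrt_le_1_alt.
  set (s := INR N * (INR N + 1)). assert (Hs : 2 <= s) by (unfold s; nra).
  assert (H2 : s + 4 <= (INR N + 1) * (INR N + 2)) by (unfold s; nra).
  apply Rle_trans with (1 + 10.4 * s); [nra|].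
  apply Rle_trans with (2 / 3 * (s + 4) ^ 2).
  (* The difference of the two sides is [2/3 ((s - 3.8)^2 + 0.06)], which explains the constant 10.4
     chosen as bound of [PI^2]. *)
  - assert (0 <= (s - 3.8) ^ 2) by apply pow2_ge_0. nra.
  - apply Rmult_le_compat_l; [lra|]. apply pow_incr. lra.
Qed.

Lemma sphere_int_sum (c : nat -> R) (k : nat -> R -> R -> R) (n : nat) : (forall i, cont2 (k i)) ->
  cont2 (fun th ph => sum_f_R0 (fun i => c i * k i th ph) n) /\
  sphere_int (fun th ph => sum_f_R0 (fun i => c i * k i th ph) n) = sum_f_R0 (fun i => c i * sphere_int (k i)) n.
Proof.
  intros Hk. induction n as [|n [IH1 IH2]].
  - simpl. split; [cont2s | now apply sphere_int_scal].
  - simpl. split; [cont2s|]. rewrite sphere_int_plus, IH2, sphere_int_scal by (auto; cont2s). reflexivity.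
Qed.

Lemma half_power_moment (Rad : R) (h : pt -> R) (x : axis -> R) (k : nat) (t : R) :
  cont_on_ball Rad h -> Rabs t < Rad ->
  (INR k + 1) / (4 * PI) * moment (zonal (half_power k) x) h t =
  sum_f_R0 (fun N => (2 * INR N + 1) * kernel_coef k N / (4 * PI) * moment (zonal (leg N) x) h t) k.
Proof.
  intros Hh Ht. assert (Ch := on_sphere_cont2 Rad h t Hh Ht). assert (P := PI_RGT_0). assert (Hk := pos_INR k).
  unfold moment.
  rewrite (sphere_int_ext (fun th ph => zonal (half_power k) x th ph * on_sphere h t th ph)
    (fun th ph => sum_f_R0 (fun N => (2 * INR N + 1) * kernel_coef k N / (INR k + 1)
       * (zonal (leg N) x th ph * on_sphere h t th ph)) k)).
  - rewrite (proj2 (sphere_int_sum _ (fun N th ph => zonal (leg N) x th ph * on_sphere h t th ph) k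
      ltac:(intros; cbv beta; cont2s))).
    rewrite scal_sum. apply sum_eq. intros i _. field. lra.
  - intros th ph. unfold zonal, half_power. rewrite kernel_expansion. unfold kernel_sum.
    rewrite Rmult_comm, scal_sum. apply sum_eq. intros i _. ring.
Qed.

(** Degree 0 of the Euler relation: the moment does not change with the radius, and at radius 0 its
    integrand is constant. *)
Lemma mean_value Rad v d (x : axis -> R) (a : axis) (t : R) :
  harmonic_gradient Rad v d -> dot x x = 1 -> 0 < t < Rad ->
  moment (zonal (leg 0) x) (v a) t = 4 * PI * v a origin.
Proof.
  intros Hv Hx Ht.
  assert (D : forall u, 0 <= u < Rad -> is_derive (moment (zonal (leg 0) x) (v a)) u
    (sphere_int (fun th ph => zonal (leg 0) x th ph * radial (d a) u th ph))).
  { intros u Hu. apply (moment_derive Rad); auto with cont. rewrite Rabs_pos_eq; lra. }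
  (* The Euler relation [u * phi' u = 0] says nothing at [u = 0]; this form of the mean value
     theorem asks for the derivative only inside the interval, and for continuity at its ends. *)
  destruct (MVT_gen (moment (zonal (leg 0) x) (v a)) 0 t (fun _ => 0)) as (c & _ & E).
  - rewrite Rmin_left, Rmax_right by lra. intros u Hu. eapply is_derive_eq; [apply D; lra|].
    assert (E := legendre_moment_euler Rad v d 0 x a u Hv Hx). simpl INR in E.
    apply Rmult_eq_reg_l with u; [|lra]. rewrite E by lra. ring.
  - rewrite Rmin_left, Rmax_right by lra. intros u Hu. apply derivable_continuous_pt.
    eexists. apply is_derive_Reals, D. lra.
  - transitivity (moment (zonal (leg 0) x) (v a) 0); [lra|].
    rewrite <- sphere_int_const. unfold moment. apply sphere_int_ext. intros th ph.
    unfold zonal, on_sphere, point, origin, leg; simpl. rewrite !Rmult_0_l. ring.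
Qed.

(** Moment bounds hold at radii [t < Rad] only; this passes them to the limit [t -> Rad]. *)
Lemma le_limit_pow (a b Rad r : R) (N : nat) : r < Rad ->
  (forall t, r < t < Rad -> a * t ^ N <= b) -> a * Rad ^ N <= b.
Proof.
  intros Hr H. destruct (Rle_dec (a * Rad ^ N) b) as [|Hn]; [assumption|exfalso].
  assert (C : continuous (fun t => a * t ^ N) Rad) by cont.
  assert (Hp : 0 < a * Rad ^ N - b) by lra.
  destruct (proj1 (continuous_R_eps _ _) C (mkposreal _ Hp)) as (e & He). simpl in He.
  set (t := Rmax ((r + Rad) / 2) (Rad - e / 2)).
  assert (E := cond_pos e).
  assert (T1 : (r + Rad) / 2 <= t) by apply Rmax_l. assert (T2 : Rad - e / 2 <= t) by apply Rmax_r.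
  assert (T3 : t < Rad) by (apply Rmax_lub_lt; lra).
  specialize (H t ltac:(lra)).
  assert (B : ball Rad e t).
  { unfold ball; simpl. unfold AbsRing_ball, abs, minus, plus, opp; simpl. rewrite Rabs_left; lra. }
  specialize (He t B). apply Rabs_def2 in He. lra.
Qed.

(** Cauchy-Schwarz in the plane for [(|e0|, sqrt (e1^2 + e2^2))] and [(1, p sqrt q)]. It merges the
    bound on the scalar component with the one on the two others. *)
Lemma cauchy_schwarz_bound (e0 e1 e2 p q : R) :
  e0 ^ 2 + e1 ^ 2 + e2 ^ 2 = 1 -> 0 <= q -> Rabs e0 + p * sqrt (q * (e1 ^ 2 + e2 ^ 2)) <= sqrt (1 + p ^ 2 * q).
Proof.
  intros He Hq.
  assert (He' : 0 <= e1 ^ 2 + e2 ^ 2) by nra.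
  rewrite sqrt_mult by auto.
  assert (S1 := pow2_sqrt q Hq). assert (S2 := pow2_sqrt _ He').
  set (a := sqrt q) in *. set (b := sqrt (e1 ^ 2 + e2 ^ 2)) in *.
  assert (A := pow2_abs e0).
  apply Rle_trans with (1 := Rle_abs _). rewrite <- sqrt_Rsqr_abs. apply sqrt_le_1_alt. unfold Rsqr.
  rewrite <- S1.
  assert (0 <= (Rabs e0 * (p * a) - b) ^ 2) by apply pow2_ge_0.
  assert (Rabs e0 ^ 2 + b ^ 2 = 1) by (rewrite A, S2; lra).
  nra.
Qed.

(** Testing against all unit vectors [e] controls the Euclidean length of the vector of moments,
    instead of each component separately. *)
Lemma component_bound Rad (B : R) v d
    (N : nat) (x e : axis -> R) (r : R) :
  harmonic_gradient Rad v d -> 0 <= B -> (forall y, in_ball Rad y -> Rabs (v X0 y) <= B) ->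
  (forall N t, (1 <= N)%nat -> 0 < t < Rad -> no_sectoral N v t) ->
  dot x x = 1 -> dot e e = 1 -> (1 <= N)%nat -> 0 < r < Rad ->
  Rabs (dot e (fun a => moment (zonal (leg N) x) (v a) r))
  <= 4 * PI * (sqrt (1 + PI ^ 2 * (INR N * (INR N + 1))) * B) * (r / Rad) ^ N.
Proof.
  intros Hv HB Hg HN Hx He H1 Hr. assert (P := PI_RGT_0).
  set (C := 4 * PI * (sqrt (1 + PI ^ 2 * (INR N * (INR N + 1))) * B)).
  set (m := fun t => dot e (fun a => moment (zonal (leg N) x) (v a) t)). fold (m r).
  assert (Hm : forall t, 0 < t < Rad -> Rabs (m t) <= C).
  { intros t Ht. assert (Hta : Rabs t < Rad) by (rewrite Rabs_pos_eq; lra).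
    assert (Hg' : forall th ph, Rabs (on_sphere (v X0) t th ph) <= B)
      by (intros th ph; apply Hg; now apply in_ball_ray).
    assert (B1 := projected_bound Rad v d N x t (e X1) (e X2) B Hv Hx Ht HB Hg' (HN N t H1 Ht)).
    assert (B0 : Rabs (moment (zonal (leg N) x) (v X0) t) <= 4 * PI * B).
    { unfold moment. apply sphere_int_abs_const.
      - destruct (harmonic_gradient_cont Rad v d t Hv Hta) as (Cs & _ & _). cont2s.
      - intros th ph _ _. rewrite Rabs_mult. rewrite <- (Rmult_1_l B).
        apply Rmult_le_compat; try apply Rabs_pos; auto. apply leg_le_1. now apply zonal_le_1. }
    unfold m, dot. rewrite Rplus_assoc. eapply Rle_trans; [apply Rabs_triang|]. rewrite Rabs_mult.
    assert (CS := cauchy_schwarz_bound (e X0) (e X1) (e X2) PI (INR N * (INR N + 1))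
      ltac:(rewrite <- He; unfold dot; ring) ltac:(generalize (pos_INR N); nra)).
    apply Rle_trans with (4 * PI * B * (Rabs (e X0) + PI * sqrt (INR N * (INR N + 1) * (e X1 ^ 2 + e X2 ^ 2)))).
    - assert (Rabs (e X0) * Rabs (moment (zonal (leg N) x) (v X0) t) <= Rabs (e X0) * (4 * PI * B))
        by (apply Rmult_le_compat_l; auto; apply Rabs_pos). lra.
    - unfold C. replace (4 * PI * (sqrt (1 + PI ^ 2 * (INR N * (INR N + 1))) * B)) with
        (4 * PI * B * sqrt (1 + PI ^ 2 * (INR N * (INR N + 1)))) by ring.
      apply Rmult_le_compat_l; auto. apply Rmult_le_pos; lra. }
  assert (L : Rabs (m r) * Rad ^ N <= C * r ^ N).
  { apply (le_limit_pow _ _ Rad r); [lra|]. intros t Ht.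
    assert (E : m r * t ^ N = m t * r ^ N).
    { unfold m, dot. rewrite !Rmult_plus_distr_r, !Rmult_assoc.
      rewrite !(legendre_moment_homogeneous Rad v d N x _ r t Hv Hx) by lra. ring. }
    rewrite <- (Rabs_pos_eq (t ^ N)) by (apply pow_le; lra).
    rewrite <- Rabs_mult, E, Rabs_mult, (Rabs_pos_eq (r ^ N)) by (apply pow_le; lra).
    apply Rmult_le_compat_r; [apply pow_le; lra|]. apply Hm. lra. }
  assert (HR : 0 < Rad ^ N) by (apply pow_lt; lra).
  apply Rmult_le_reg_r with (Rad ^ N); auto.
  replace (C * (r / Rad) ^ N * Rad ^ N) with (C * r ^ N); auto.
  unfold Rdiv. rewrite Rpow_mult_distr, pow_inv. field. lra.
Qed.

(** Since the weights [kernel_coef k N] lie in [[0, 1]], the kernel averages satisfy a bound uniform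
    in [k]; only afterwards does [k] tend to infinity. *)
Lemma core_estimate Rad (B : R) v d
    (x e : axis -> R) (r : R) :
  harmonic_gradient Rad v d -> 0 <= B -> (forall y, in_ball Rad y -> Rabs (v X0 y) <= B) ->
  (forall N t, (1 <= N)%nat -> 0 < t < Rad -> no_sectoral N v t) ->
  dot x x = 1 -> dot e e = 1 -> 0 < r < Rad ->
  Rabs (dot e (fun a => v a (point (fun i => r * x i)) - v a origin))
  <= sqrt (2 / 3) * (2 * r * Acoef r Rad / (Rad - r) ^ 4) * B.
Proof.
  intros Hv HB Hg HN Hx He Hr. assert (P := PI_RGT_0).
  assert (Hra : Rabs r < Rad) by (rewrite Rabs_pos_eq; lra).
  assert (Cv : forall j, cont_on_ball Rad (v j)) by (intros j; apply (C1_cont_on_ball Rad _ (d j)), Hv).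
  set (q := fun a k => (INR k + 1) / (4 * PI) * moment (zonal (half_power k) x) (v a) r - v a origin).
  set (bound := sqrt (2 / 3) * (2 * r * Acoef r Rad / (Rad - r) ^ 4) * B).
  assert (Lq : forall a, is_lim_seq (q a) (v a (point (fun i => r * x i)) - v a origin)).
  { intros a. apply (is_lim_seq_minus' _ (fun _ => v a origin)); [|apply is_lim_seq_const].
    now apply (zonal_approx Rad). }
  assert (Ls : is_lim_seq (fun k => dot e (fun a => q a k)) (dot e (fun a => v a (point (fun i => r * x i)) - v a origin))).
  { unfold dot. repeat apply is_lim_seq_plus'; apply (is_lim_seq_mult' (fun _ => _)); auto; apply is_lim_seq_const. }
  assert (Bk : forall k, Rabs (dot e (fun a => q a k)) <= bound).
  { intros k. set (tau := r / Rad).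
    assert (Ht : 0 <= tau < 1).
    { unfold tau. split; [apply Rdiv_le_0_compat; lra|].
      apply Rmult_lt_reg_r with Rad; [lra|]. unfold Rdiv. rewrite Rmult_assoc, Rinv_l; lra. }
    set (term := fun N => (2 * INR N + 1) * kernel_coef k N / (4 * PI) * dot e (fun a => moment (zonal (leg N) x) (v a) r)).
    (* [kernel_coef k 0 = 1] and the mean value property make the degree 0 term the value at the
       origin, so subtracting that value removes exactly this term. The [2] subtracted in the bound
       below is likewise [growth 0]. *)
    assert (E : dot e (fun a => q a k) = sum_f_R0 term k - term 0%nat).
    { assert (T0 : term 0%nat = dot e (fun a => v a origin)).
      { unfold term, dot. rewrite !(mean_value Rad v d) by auto. simpl. field. lra. }
      rewrite T0. unfold q.
      set (g := fun a N => (2 * INR N + 1) * kernel_coef k N / (4 * PI) * moment (zonal (leg N) x) (v a) r).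
      rewrite (sum_eq term (fun N => g X0 N * e X0 + g X1 N * e X1 + g X2 N * e X2)) by (intros; unfold term, g, dot; ring).
      rewrite !sum_plus, <- !scal_sum. unfold g. rewrite <- !(half_power_moment Rad) by auto. unfold dot. ring. }
    assert (T : forall n, Rabs (sum_f_R0 term n - term 0%nat) <= sqrt (2 / 3) * B * (sum_f_R0 (fun N => growth N * tau ^ N) n - 2)).
    { induction n as [|n IH].
      - simpl. unfold growth; simpl. unfold Rminus at 1. rewrite Rplus_opp_r, Rabs_R0. right. ring.
      - rewrite !tech5.
        replace (sum_f_R0 term n + term (S n) - term 0%nat) with ((sum_f_R0 term n - term 0%nat) + term (S n)) by ring.
        eapply Rle_trans; [apply Rabs_triang|].
        assert (Rabs (term (S n)) <= sqrt (2 / 3) * B * (growth (S n) * tau ^ S n)); [|lra].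
        assert (CB := component_bound Rad B v d (S n) x e r Hv HB Hg HN Hx He ltac:(lia) Hr). fold tau in CB.
        assert (GD := growth_dominates (S n) ltac:(lia)).
        assert (KC := kernel_coef_bound k (S n)).
        assert (HNn := pos_INR (S n)).
        assert (Tn : 0 <= tau ^ S n) by (apply pow_le; lra).
        unfold term. rewrite Rabs_mult, Rabs_pos_eq.
        2: { apply Rdiv_le_0_compat; [apply Rmult_le_pos|]; lra. }
        set (sq := sqrt (1 + PI ^ 2 * (INR (S n) * (INR (S n) + 1)))) in *.
        assert (Hsq : 0 <= sq) by apply sqrt_pos.
        apply Rle_trans with ((2 * INR (S n) + 1) * kernel_coef k (S n) / (4 * PI) * (4 * PI * (sq * B) * tau ^ S n)).
        + apply Rmult_le_compat_l; auto.
          apply Rdiv_le_0_compat; [apply Rmult_le_pos|]; lra.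
        + assert (Q : 0 <= B * tau ^ S n) by now apply Rmult_le_pos.
          replace ((2 * INR (S n) + 1) * kernel_coef k (S n) / (4 * PI) * (4 * PI * (sq * B) * tau ^ S n))
            with (kernel_coef k (S n) * ((2 * INR (S n) + 1) * sq * (B * tau ^ S n))) by (field; lra).
          replace (sqrt (2 / 3) * B * (growth (S n) * tau ^ S n)) with (1 * (sqrt (2 / 3) * growth (S n) * (B * tau ^ S n))) by ring.
          apply Rmult_le_compat; try lra; [|now apply Rmult_le_compat_r].
          apply Rmult_le_pos; [apply Rmult_le_pos; lra | exact Q]. }
    rewrite E. eapply Rle_trans; [apply T|]. unfold bound.
    assert (G := growth_sum k tau Ht).
    replace (sqrt (2 / 3) * (2 * r * Acoef r Rad / (Rad - r) ^ 4) * B)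
      with (sqrt (2 / 3) * B * ((2 + 10 * tau) / (1 - tau) ^ 4 - 2)).
    - apply Rmult_le_compat_l; [|lra]. apply Rmult_le_pos; [apply sqrt_pos | exact HB].
    (* The factorisation behind [Acoef]: [2 + 10 tau - 2 (1 - tau)^4 = 2 tau (3 - tau)(3 - tau +
       tau^2)]. *)
    - unfold tau, Acoef. field. lra. }
  apply (is_lim_seq_le (fun k => Rabs (dot e (fun a => q a k))) (fun _ => bound)
    (Rabs (dot e (fun a => v a (point (fun i => r * x i)) - v a origin))) bound).
  - exact Bk.
  - apply (is_lim_seq_abs _ (Finite _) Ls).
  - apply is_lim_seq_const.
Qed.

(** * Spherical coordinates in iterated integrals *)

Definition cont_disc (rho : R) (g : R -> R -> R) : Prop :=
  forall x y, x ^ 2 + y ^ 2 < rho ^ 2 -> continuous (fun p : R * R => g (fst p) (snd p)) (x, y).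

Lemma cont_disc_comp {U : UniformSpace} (rho : R) (g : R -> R -> R) (f k : U -> R) (u : U) :
  cont_disc rho g -> continuous f u -> continuous k u -> f u ^ 2 + k u ^ 2 < rho ^ 2 ->
  continuous (fun p => g (f p) (k p)) u.
Proof. intros Hg Hf Hk H. apply (continuous_comp_2 f k g); auto. Qed.

Lemma in_ball_sqr (rho : R) (x : pt) : 0 < rho ->
  (in_ball rho x <-> c0 x ^ 2 + c1 x ^ 2 + c2 x ^ 2 < rho ^ 2).
Proof.
  intros Hr. unfold in_ball. rewrite <- pnorm_sqr. generalize (pnorm_nonneg x). split; nra.
Qed.

Lemma cont_disc_on_ball (rho : R) (g : R -> R -> R) : 0 < rho -> cont_disc rho g ->
  cont_on_ball rho (fun p => g (c0 p) (c1 p)).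
Proof.
  intros Hr Hg. apply cont_on_ball_iff. intros x Hx. apply (in_ball_sqr rho x Hr) in Hx. unfold triple; simpl.
  apply (cont_disc_comp rho g); [auto | cont | cont |]. cbn [fst snd coords]. generalize (pow2_ge_0 (c2 x)). lra.
Qed.

Lemma disc_open (rho x y : R) : x ^ 2 + y ^ 2 < rho ^ 2 ->
  locally (x, y) (fun p : R * R => fst p ^ 2 + snd p ^ 2 < rho ^ 2).
Proof.
  intros H.
  assert (C : continuous (fun p : R * R => fst p ^ 2 + snd p ^ 2) (x, y)).
  { cont. }
  assert (Hp : 0 < rho ^ 2 - (x ^ 2 + y ^ 2)) by lra.
  destruct (proj1 (continuous_R_eps _ _) C (mkposreal _ Hp)) as (e & He). simpl fst in He; simpl snd in He.
  exists e. intros p Hq. specialize (He p Hq). apply Rabs_def2 in He. simpl pos in He. lra.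
Qed.

Lemma square_scale (s u : R) : 0 <= u <= 1 -> (s * u) ^ 2 <= s ^ 2.
Proof.
  intros Hu. rewrite Rpow_mult_distr. assert (P := pow2_ge_0 s). assert (u ^ 2 <= 1) by nra. nra.
Qed.

(* [s * int_0^1 g x (s u) du = int_0^s g x], in a form with fixed end points. *)
Definition primitive (g : R -> R -> R) (x s : R) : R := s * RInt (fun u => g x (s * u)) 0 1.

Lemma primitive_eq (rho : R) (g : R -> R -> R) (x s : R) : cont_disc rho g -> x ^ 2 + s ^ 2 < rho ^ 2 ->
  primitive g x s = RInt (g x) 0 s.
Proof.
  intros Hg Hs. unfold primitive.
  assert (E := RInt_comp (V := R_CompleteNormedModule) (g x) (fun u => s * u) (fun _ => s) 0 1).
  rewrite Rmult_0_r, Rmult_1_r in E. rewrite <- E.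
  - symmetry. apply (RInt_R_scal (fun u => g x (s * u)) 0 1 s).
    apply ex_RInt_cont; [lra|]. intros u Hu. apply (cont_disc_comp rho g); [auto | cont | cont |].
    cbv beta. generalize (square_scale s u Hu). lra.
  - rewrite Rmin_left, Rmax_right by lra. intros u Hu.
    apply continuous_slice, Hg. generalize (square_scale s u Hu). lra.
  - intros u _. split; [auto_derive; trivial; ring | apply continuous_const].
Qed.

Lemma primitive_cont (rho : R) (g : R -> R -> R) : cont_disc rho g -> cont_disc rho (primitive g).
Proof.
  intros Hg x s Hs. unfold primitive. apply continuous_R_mult; [apply continuous_snd|].
  apply (continuous_RInt_param (U := prod_UniformSpace R_UniformSpace R_UniformSpace)
    (fun p u => g (fst p) (snd p * u))); [lra|].
  generalize (disc_open rho x s Hs). apply filter_imp. intros [x' s'] Hp u Hu. simpl in Hp.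
  apply (cont_disc_comp rho g); [auto | cont | cont |].
  cbn [fst snd]. generalize (square_scale s' u Hu). lra.
Qed.

(** Stated for functions on [pt] that ignore the third coordinate, so that [C1_chain] yields the
    derivatives along polar curves. *)
Lemma primitive_C1 (rho : R) (g gx : R -> R -> R) : 0 < rho ->
  cont_disc rho g -> cont_disc rho gx ->
  (forall x y, x ^ 2 + y ^ 2 < rho ^ 2 -> is_derive (fun z => g z y) x (gx x y)) ->
  C1_scalar rho (fun p => primitive g (c0 p) (c1 p))
    (fun i p => match i with X0 => primitive gx (c0 p) (c1 p) | X1 => g (c0 p) (c1 p) | X2 => 0 end).
Proof.
  intros Hr Hg Hgx Hd i. split.
  - destruct i.
    + apply (cont_disc_on_ball rho (primitive gx)); auto. now apply primitive_cont.
    + now apply cont_disc_on_ball.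
    + apply (cont_disc_on_ball rho (fun _ _ => 0)); auto. intros x y _. apply continuous_const.
  - intros p Hp. apply (in_ball_sqr rho p Hr) in Hp.
    assert (Hp' : c0 p ^ 2 + c1 p ^ 2 < rho ^ 2) by (generalize (pow2_ge_0 (c2 p)); lra).
    destruct p as [x s z]; simpl in Hp'. destruct i; simpl.
    + unfold primitive. eapply is_derive_eq.
      * apply (is_derive_R_mult (fun _ => s)); [apply is_derive_R_const|].
        apply (is_derive_RInt_param (fun x u => g x (s * u)) (fun x u => gx x (s * u)) 0 1 x); [lra| |].
        -- assert (L : locally x (fun t => t ^ 2 + s ^ 2 < rho ^ 2)).
           { destruct (disc_open rho x s Hp') as [e He]. exists e. intros t Ht. apply (He (t, s)).
             split; [exact Ht | apply ball_center]. }
           revert L. apply filter_imp. intros t Ht u Hu. assert (Q := square_scale s u Hu). split.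
           ++ apply Hd. lra.
           ++ apply (cont_disc_comp rho g); [auto | cont | cont | cbv beta; lra].
        -- intros u Hu. assert (Q := square_scale s u Hu).
           apply (cont_disc_comp rho gx); [auto | cont | cont | cbn [fst snd]; lra].
      * cbv beta. ring.
    + assert (L : locally s (fun t => x ^ 2 + t ^ 2 < rho ^ 2)).
      { destruct (disc_open rho x s Hp') as [e He]. exists e. intros t Ht. apply (He (x, t)).
        split; [apply ball_center | exact Ht]. }
      apply (is_derive_ext_loc (fun t => RInt (g x) 0 t)).
      * revert L. apply filter_imp. intros t Ht. symmetry. now apply (primitive_eq rho).
      * apply (is_derive_RInt (V := R_NormedModule) (g x) (fun t => RInt (g x) 0 t) 0 s).
        -- revert L. apply filter_imp. intros t Ht. apply (RInt_correct (V := R_CompleteNormedModule)).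
           apply (ex_RInt_continuous (V := R_CompleteNormedModule)). intros w Hw.
           apply continuous_slice, Hg.
           assert (w ^ 2 <= t ^ 2).
           { revert Hw. unfold Rmin, Rmax. destruct Rle_dec; intros; nra. }
           lra.
        -- apply continuous_slice, Hg. exact Hp'.
    + apply is_derive_R_const.
Qed.

Lemma polar_in_disc (rho t ph : R) : Rabs t < rho -> (t * cos ph) ^ 2 + (t * sin ph) ^ 2 < rho ^ 2.
Proof.
  intros H. assert (E := sin_cos_sqr ph).
  replace ((t * cos ph) ^ 2 + (t * sin ph) ^ 2) with (t ^ 2 * (sin ph * sin ph + cos ph * cos ph)) by ring.
  rewrite E, Rmult_1_r, <- pow2_abs. generalize (Rabs_pos t). nra.
Qed.

Lemma cont_disc_polar (rho : R) (g : R -> R -> R) (t ph : R) : cont_disc rho g -> Rabs t < rho ->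
  continuous (fun p : R * R => g (fst p * cos (snd p)) (fst p * sin (snd p))) (t, ph).
Proof.
  intros Hg Ht. apply (cont_disc_comp rho g); [auto | cont | cont | now apply polar_in_disc].
Qed.

Lemma sqrt_disc (a x : R) : -a <= x <= a -> x ^ 2 + sqrt (a ^ 2 - x ^ 2) ^ 2 = a ^ 2.
Proof. intros H. rewrite pow2_sqrt; [ring | nra]. Qed.

Lemma half_disc_continuous (rho a : R) (g : R -> R -> R) (x : R) : 0 <= a < rho -> cont_disc rho g -> -a <= x <= a ->
  continuous (fun x => primitive g x (sqrt (a ^ 2 - x ^ 2))) x.
Proof.
  intros Ha Hg Hx.
  apply (cont_disc_comp rho (primitive g)); [now apply primitive_cont | cont | |rewrite sqrt_disc by assumption; nra].
  apply (continuous_R_comp (fun x => a ^ 2 - x ^ 2) sqrt); [cont | apply continuous_sqrt].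
Qed.

(* Substitute [x = a cos ph]; the derivative in [a] of the resulting integral simplifies because
   [d/dph (cos ph * primitive g (a cos ph) (a sin ph))] integrates to [0]. *)
Lemma half_disc_polar (rho a : R) (g gx : R -> R -> R) : 0 <= a < rho ->
  cont_disc rho g -> cont_disc rho gx ->
  (forall x y, x ^ 2 + y ^ 2 < rho ^ 2 -> is_derive (fun z => g z y) x (gx x y)) ->
  RInt (fun x => primitive g x (sqrt (a ^ 2 - x ^ 2))) (- a) a =
  RInt (fun t => t * RInt (fun ph => g (t * cos ph) (t * sin ph)) 0 PI) 0 a.
Proof.
  intros Ha Hg Hgx Hd. assert (P := PI_RGT_0).
  assert (HC := primitive_C1 rho g gx ltac:(lra) Hg Hgx Hd).
  set (E := fun t ph => primitive g (t * cos ph) (t * sin ph)).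
  set (Ex := fun t ph => primitive gx (t * cos ph) (t * sin ph)).
  set (G := fun t ph => g (t * cos ph) (t * sin ph)).
  assert (CE := fun t ph => cont_disc_polar rho _ t ph (primitive_cont rho g Hg)).
  assert (CEx := fun t ph => cont_disc_polar rho _ t ph (primitive_cont rho gx Hgx)).
  assert (CG := fun t ph => cont_disc_polar rho g t ph Hg).
  assert (Bp : forall t ph, Rabs t < rho ->
     in_ball rho (point (fun i => match i with X0 => t * cos ph | X1 => t * sin ph | X2 => 0 end))).
  { intros t ph Ht. apply in_ball_sqr; [lra|]. simpl c0; simpl c1; simpl c2.
    generalize (polar_in_disc rho t ph Ht). lra. }
  assert (DEt : forall t ph, Rabs t < rho -> is_derive (fun t => E t ph) t (Ex t ph * cos ph + G t ph * sin ph)).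
  { intros t ph Ht. eapply is_derive_eq.
    - apply (C1_chain rho _ _ (fun i t => match i with X0 => t * cos ph | X1 => t * sin ph | X2 => 0 end)
        (fun i => match i with X0 => cos ph | X1 => sin ph | X2 => 0 end) t HC); [|now apply Bp].
      intros i. destruct i; auto_derive; trivial; eqR; ring.
    - unfold Ex, G. simpl. ring. }
  assert (DEp : forall t ph, Rabs t < rho -> is_derive (fun ph => E t ph) ph (Ex t ph * (- t * sin ph) + G t ph * (t * cos ph))).
  { intros t ph Ht. eapply is_derive_eq.
    - apply (C1_chain rho _ _ (fun i ph => match i with X0 => t * cos ph | X1 => t * sin ph | X2 => 0 end)
        (fun i => match i with X0 => - t * sin ph | X1 => t * cos ph | X2 => 0 end) ph HC); [|now apply Bp].
      intros i. destruct i; auto_derive; trivial; eqR; ring.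
    - unfold Ex, G. simpl. ring. }
  set (Phi := (fun t => RInt (fun ph => t * sin ph * E t ph) 0 PI) : R -> R).
  set (dF := fun t ph => sin ph * E t ph + t * sin ph * (Ex t ph * cos ph + G t ph * sin ph)).
  assert (CdF : forall t ph, Rabs t < rho -> continuous (fun p : R * R => dF (fst p) (snd p)) (t, ph)).
  { intros t ph Ht. specialize (CE t ph Ht). specialize (CEx t ph Ht). specialize (CG t ph Ht).
    unfold dF, E, Ex, G. cont. }
  assert (CtG : forall t ph, Rabs t < rho -> continuous (fun p : R * R => fst p * G (fst p) (snd p)) (t, ph)).
  { intros t ph Ht. specialize (CG t ph Ht). unfold G. cont. }
  assert (DPhi : forall t, Rabs t < rho -> is_derive Phi t (RInt (fun ph => t * G t ph) 0 PI)).
  { intros t Ht. eapply is_derive_eq.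
    - apply (is_derive_RInt_param (fun t ph => t * sin ph * E t ph) dF); [lra| |].
      + generalize (locally_abs_lt t rho Ht). apply filter_imp. intros u Hu ph _. split.
        * eapply is_derive_eq.
          -- apply (is_derive_R_mult (fun u => u * sin ph) (fun u => E u ph) u (sin ph)).
             auto_derive; trivial; eqR; ring. now apply DEt.
          -- unfold dF. cbv beta. ring.
        * assert (C := is_derive_continuous _ _ _ (DEp u ph Hu)). cont.
      + intros ph _. now apply CdF.
    - set (K := fun ph => cos ph * E t ph).
      set (dK := fun ph => - sin ph * E t ph + cos ph * (Ex t ph * (- t * sin ph) + G t ph * (t * cos ph))).
      assert (CdK : forall ph, continuous dK ph).
      { intros ph. apply (continuous_slice (fun t ph => - sin ph * E t ph + cos ph * (Ex t ph * (- t * sin ph) + G t ph * (t * cos ph)))).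
        specialize (CE t ph Ht). specialize (CEx t ph Ht). specialize (CG t ph Ht). unfold E, Ex, G. cont. }
      assert (IK : RInt dK 0 PI = 0).
      { rewrite (RInt_FTC K).
        - unfold K, E, primitive. rewrite sin_PI, sin_0, !Rmult_0_r, !Rmult_0_l. eqR; ring.
        - lra.
        - intros ph _. apply (is_derive_R_mult cos (fun ph => E t ph)); [|now apply DEp].
          auto_derive; trivial; eqR; ring.
        - intros ph _. apply CdK. }
      assert (XdF : ex_RInt (dF t) 0 PI).
      { apply ex_RInt_everywhere. intros ph. now apply continuous_slice, CdF. }
      assert (XtG : ex_RInt (fun ph => t * G t ph) 0 PI).
      { apply ex_RInt_everywhere. intros ph. apply (continuous_slice (fun t ph => t * G t ph)). now apply CtG. }
      transitivity (1 * RInt (fun ph => t * G t ph) 0 PI + (-1) * RInt dK 0 PI); [|rewrite IK; eqR; ring].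
      rewrite <- RInt_lin; auto using ex_RInt_everywhere.
      apply RInt_ext_R. intros ph. unfold dF, dK. assert (S2 := sin_cos_sqr ph).
        transitivity (sin ph * E t ph + t * sin ph * (Ex t ph * cos ph) + t * G t ph * (sin ph * sin ph)); [ring|].
        replace (sin ph * sin ph) with (1 - cos ph * cos ph) by lra. ring.
  }
  transitivity (Phi a).
  - set (k := fun x => primitive g x (sqrt (a ^ 2 - x ^ 2))).
    assert (Ek := RInt_comp (V := R_CompleteNormedModule) k (fun ph => a * cos ph) (fun ph => - a * sin ph) 0 PI).
    cbv beta in Ek. rewrite cos_0, cos_PI, Rmult_1_r in Ek. replace (a * -1) with (- a) in Ek by ring.
    (* As [sin] is nonnegative on [[0, PI]], the substitution turns [sqrt (a^2 - x^2)] into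
       [a sin ph]; the infinite slope of the square root at the end points disappears. *)
    assert (KE : forall ph, 0 <= ph <= PI -> k (a * cos ph) = E a ph).
    { intros ph Hph. unfold k, E. f_equal.
      assert (Hs : 0 <= sin ph) by (apply sin_ge_0; lra).
      assert (S2 := sin_cos_sqr ph).
      replace (a ^ 2 - (a * cos ph) ^ 2) with ((a * sin ph) ^ 2).
      - apply sqrt_pow2. apply Rmult_le_pos; lra.
      - transitivity (a * a * (sin ph * sin ph)); [ring|].
        replace (sin ph * sin ph) with (1 - cos ph * cos ph) by lra. ring. }
    assert (Xk : ex_RInt (fun ph => a * sin ph * E a ph) 0 PI).
    { apply ex_RInt_everywhere. intros ph.
      assert (C := is_derive_continuous _ _ _ (DEp a ph ltac:(rewrite Rabs_pos_eq; lra))). cont. }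
    transitivity (- RInt k a (- a)).
    + symmetry. apply (RInt_R_swap k a (- a)).
      apply ex_RInt_swap. apply ex_RInt_cont; [lra|]. intros x Hx. now apply (half_disc_continuous rho).
    + rewrite <- Ek.
      * transitivity (- RInt (fun ph => (-1) * (a * sin ph * E a ph)) 0 PI).
        -- f_equal. apply RInt_ext_in; [lra|].
           intros ph Hph. rewrite KE by lra. change (- a * sin ph * E a ph = -1 * (a * sin ph * E a ph)). ring.
        -- rewrite RInt_R_scal by auto. unfold Phi. eqR. ring.
      * intros ph _. apply (half_disc_continuous rho); auto.
        destruct (COS_bound ph). nra.
      * intros ph _. split; [auto_derive; trivial; eqR; ring | cont].
  - transitivity (RInt (fun t => RInt (fun ph => t * G t ph) 0 PI) 0 a).
    + rewrite (RInt_FTC Phi (fun t => RInt (fun ph => t * G t ph) 0 PI)).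
      * assert (Z : Phi 0 = 0).
        { unfold Phi. rewrite (RInt_ext_R _ (fun _ => 0)) by (intros; ring). rewrite RInt_constant. eqR; ring. }
        rewrite Z. eqR. ring.
      * lra.
      * intros t Ht. apply DPhi. rewrite Rabs_pos_eq; lra.
      * intros t Ht. apply (continuous_RInt_param (U := R_UniformSpace) (fun t ph => t * G t ph)); [lra|].
        generalize (locally_abs_lt t rho ltac:(rewrite Rabs_pos_eq; lra)). apply filter_imp. intros u Hu ph _. now apply CtG.
    + apply RInt_ext_in; [lra|]. intros t Ht. apply (RInt_R_scal (fun ph => G t ph)), ex_RInt_everywhere.
      intros ph. apply continuous_slice, CG. rewrite Rabs_pos_eq; lra.
Qed.

(** Continuity of [k] on the closed interval secures integrability, so that [Rint] does not fall
    back to its default value 0. *)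
Lemma Rint_eq (g k : R -> R) (a b : R) : a <= b ->
  (forall x, a <= x <= b -> g x = k x) -> (forall x, a <= x <= b -> continuous k x) ->
  Rint g a b = RInt k a b.
Proof.
  intros Hab E C.
  assert (Xk : ex_RInt k a b) by now apply ex_RInt_cont.
  assert (Xg : ex_RInt g a b).
  { apply (ex_RInt_ext k); auto. rewrite Rmin_left, Rmax_right by assumption. intros x Hx. symmetry. apply E. lra. }
  rewrite <- (RInt_ext_in g k) by (auto; intros; apply E; lra). unfold Rint. destruct excluded_middle_informative as [H|H].
  - symmetry. apply RInt_Reals.
  - exfalso. apply H. exists (ex_RInt_Reals_0 _ _ _ Xg). trivial.
Qed.

Lemma cont_disc_reflect (rho : R) (g : R -> R -> R) : cont_disc rho g -> cont_disc rho (fun x y => g x (- y)).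
Proof.
  intros Hg x y H. apply (cont_disc_comp rho g); [auto | cont | cont |].
  cbn [fst snd]. replace ((- y) ^ 2) with (y ^ 2) by ring. exact H.
Qed.

Lemma symmetric_slice (rho : R) (g : R -> R -> R) (x s : R) : cont_disc rho g -> 0 <= s -> x ^ 2 + s ^ 2 < rho ^ 2 ->
  (forall y, - s <= y <= s -> continuous (g x) y) /\
  RInt (g x) (- s) s = primitive g x s + primitive (fun x y => g x (- y)) x s.
Proof.
  intros Hg Hs H.
  assert (C : forall y, - s <= y <= s -> continuous (g x) y).
  { intros y Hy. apply continuous_slice, Hg. nra. }
  split; auto.
  assert (X1 : ex_RInt (g x) (- s) 0) by (apply ex_RInt_cont; [lra | intros; apply C; lra]).
  assert (X2 : ex_RInt (g x) 0 s) by (apply ex_RInt_cont; [lra | intros; apply C; lra]).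
  rewrite (primitive_eq rho g), (primitive_eq rho (fun x y => g x (- y))) by (auto; now apply cont_disc_reflect).
  assert (E := RInt_Chasles (V := R_CompleteNormedModule) (g x) (- s) 0 s X1 X2).
  change (RInt (g x) (- s) 0 + RInt (g x) 0 s = RInt (g x) (- s) s) in E.
  rewrite <- E, Rplus_comm. f_equal.
  assert (X3 : ex_RInt (fun y => g x (- y)) 0 s).
  { apply ex_RInt_cont; auto. intros y Hy. apply (continuous_comp Ropp (g x)); [|apply C; lra].
    apply continuous_R_opp, continuous_id. }
  assert (X4 : ex_RInt (g x) (-1 * 0 + 0) (-1 * s + 0)).
  { replace (-1 * 0 + 0) with 0 by ring. replace (-1 * s + 0) with (- s) by ring. now apply ex_RInt_swap. }
  assert (E2 := RInt_comp_lin (V := R_CompleteNormedModule) (g x) (-1) 0 0 s X4).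
  replace (-1 * 0 + 0) with 0 in E2 by ring. replace (-1 * s + 0) with (- s) in E2 by ring.
  transitivity (- RInt (g x) 0 (- s)).
  - symmetry. apply RInt_R_swap. now apply ex_RInt_swap.
  - rewrite <- E2.
    transitivity (- RInt (fun y => -1 * g x (- y)) 0 s); [|rewrite RInt_R_scal by auto; eqR; ring].
    f_equal. apply RInt_ext_R. intros y. replace (-1 * y + 0) with (- y) by ring. reflexivity.
Qed.

(** The two primitives account for the upper half-disc and for the reflected lower one;
    [ph -> 2 PI - ph] carries the latter to the angles between [PI] and [2 PI]. *)
Lemma disc_polar (rho a : R) (g gx : R -> R -> R) : 0 <= a < rho ->
  cont_disc rho g -> cont_disc rho gx ->
  (forall x y, x ^ 2 + y ^ 2 < rho ^ 2 -> is_derive (fun z => g z y) x (gx x y)) ->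
  RInt (fun x => primitive g x (sqrt (a ^ 2 - x ^ 2)) + primitive (fun x y => g x (- y)) x (sqrt (a ^ 2 - x ^ 2))) (- a) a =
  RInt (fun t => t * RInt (fun ph => g (t * cos ph) (t * sin ph)) 0 (2 * PI)) 0 a.
Proof.
  intros Ha Hg Hgx Hd. assert (P := PI_RGT_0).
  set (gm := fun x y => g x (- y)).
  assert (Hgm : cont_disc rho gm) by now apply cont_disc_reflect.
  assert (Hgxm : cont_disc rho (fun x y => gx x (- y))) by now apply cont_disc_reflect.
  assert (Hdm : forall x y, x ^ 2 + y ^ 2 < rho ^ 2 -> is_derive (fun z => gm z y) x (gx x (- y))).
  { intros x y H. apply Hd. replace ((- y) ^ 2) with (y ^ 2) by ring. exact H. }
  assert (X : forall k, cont_disc rho k -> ex_RInt (fun x => primitive k x (sqrt (a ^ 2 - x ^ 2))) (- a) a).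
  { intros k Hk. apply ex_RInt_cont; [lra|]. intros x Hx. now apply (half_disc_continuous rho). }
  transitivity (1 * RInt (fun x => primitive g x (sqrt (a ^ 2 - x ^ 2))) (- a) a
    + 1 * RInt (fun x => primitive gm x (sqrt (a ^ 2 - x ^ 2))) (- a) a).
  - rewrite <- RInt_lin by auto. apply RInt_ext_R. intros x. ring.
  - rewrite (half_disc_polar rho a g gx), (half_disc_polar rho a gm (fun x y => gx x (- y))) by auto.
    assert (Y : forall k, cont_disc rho k -> forall t, 0 <= t <= a ->
       continuous (fun t => t * RInt (fun ph => k (t * cos ph) (t * sin ph)) 0 PI) t).
    { intros k Hk t Ht. apply continuous_R_mult; [cont|].
      apply (continuous_RInt_param (U := R_UniformSpace) (fun t ph => k (t * cos ph) (t * sin ph))); [lra|].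
      generalize (locally_abs_lt t rho ltac:(rewrite Rabs_pos_eq; lra)). apply filter_imp. intros u Hu ph _.
      now apply (cont_disc_polar rho k). }
    rewrite <- RInt_lin by (apply ex_RInt_cont; [lra | now apply Y]).
    apply RInt_ext_in; [lra|]. intros t Ht.
    set (G := fun ph => g (t * cos ph) (t * sin ph)).
    assert (X' : forall k, cont_disc rho k -> forall p q, ex_RInt (fun ph => k (t * cos ph) (t * sin ph)) p q).
    { intros k Hk p q. apply ex_RInt_everywhere. intros ph.
      apply (continuous_slice (fun t ph => k (t * cos ph) (t * sin ph))), (cont_disc_polar rho k); auto.
      rewrite Rabs_pos_eq; lra. }
    assert (XG := X' g Hg).
    assert (E : RInt (fun ph => gm (t * cos ph) (t * sin ph)) 0 PI = RInt G PI (2 * PI)).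
    { assert (EL := RInt_comp_lin (V := R_CompleteNormedModule) G (-1) (2 * PI) 0 PI (XG _ _)).
      replace (-1 * 0 + 2 * PI) with (2 * PI) in EL by ring. replace (-1 * PI + 2 * PI) with PI in EL by ring.
      transitivity (- RInt G (2 * PI) PI).
      - rewrite <- EL.
        transitivity (- RInt (fun ph => (-1) * gm (t * cos ph) (t * sin ph)) 0 PI).
        + symmetry. rewrite RInt_R_scal by auto. eqR. ring.
        + f_equal. apply RInt_ext_R. intros ph. unfold G, gm.
          replace (-1 * ph + 2 * PI) with (- ph + 2 * INR 1 * PI) by (simpl; ring).
          rewrite cos_period, sin_period, cos_neg, sin_neg.
          change (-1 * g (t * cos ph) (- (t * sin ph)) = -1 * g (t * cos ph) (t * - sin ph)).
          do 2 f_equal. ring.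
      - apply RInt_R_swap, XG. }
    assert (EC := RInt_Chasles (V := R_CompleteNormedModule) G 0 PI (2 * PI) (XG _ _) (XG _ _)).
    change (RInt G 0 PI + RInt G PI (2 * PI) = RInt G 0 (2 * PI)) in EC.
    rewrite E, <- EC. fold G. eqR. ring.
Qed.

Lemma slab_in_ball (Rad x0 t ph : R) : 0 < Rad -> x0 ^ 2 + t ^ 2 < Rad ^ 2 -> in_ball Rad (mkpt x0 (t * cos ph) (t * sin ph)).
Proof.
  intros HR H. apply in_ball_sqr; auto. simpl c0; simpl c1; simpl c2.
  replace (x0 ^ 2 + (t * cos ph) ^ 2 + (t * sin ph) ^ 2) with (x0 ^ 2 + t ^ 2 * (sin ph * sin ph + cos ph * cos ph)) by ring.
  rewrite sin_cos_sqr. lra.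
Qed.

Lemma sphere_slab_cont (Rad : R) (h : pt -> R) : 0 < Rad -> cont_on_ball Rad h ->
  cont_disc Rad (fun x0 t => t * RInt (fun ph => h (mkpt x0 (t * cos ph) (t * sin ph))) 0 (2 * PI)) /\
  (forall x0 t ph, x0 ^ 2 + t ^ 2 < Rad ^ 2 ->
     continuous (fun p : (R * R) * R => h (mkpt (fst (fst p)) (snd (fst p) * cos (snd p)) (snd (fst p) * sin (snd p)))) ((x0, t), ph)).
Proof.
  intros HR Hh.
  assert (C : forall x0 t ph, x0 ^ 2 + t ^ 2 < Rad ^ 2 ->
     continuous (fun p : (R * R) * R => h (mkpt (fst (fst p)) (snd (fst p) * cos (snd p)) (snd (fst p) * sin (snd p)))) ((x0, t), ph)).
  { intros x0 t ph H.
    apply (continuous_on_ball_comp Rad h (fun i (p : (R * R) * R) =>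
      match i with X0 => fst (fst p) | X1 => snd (fst p) * cos (snd p) | X2 => snd (fst p) * sin (snd p) end)); auto.
    - intros []; cont.
    - now apply slab_in_ball. }
  split; auto.
  intros x0 t H. apply continuous_R_mult; [apply continuous_snd|].
  apply (continuous_RInt_param (U := prod_UniformSpace R_UniformSpace R_UniformSpace)
    (fun p ph => h (mkpt (fst p) (snd p * cos ph) (snd p * sin ph)))); [apply two_PI_pos|].
  generalize (disc_open Rad x0 t H). apply filter_imp. intros [u w] Hu ph _. now apply C.
Qed.

(** Two planar polar substitutions: in the plane [(x1, x2)] at fixed [x0], then on the half-disc of
    pairs [(x0, t)], where [t] is the distance from axis 0. The Jacobian [t] of the first becomes
    [t sin th] under the second and so provides the weight of [sphere_int]. *)
Lemma ballint_spherical (Rad : R) (h : pt -> R) (d : axis -> pt -> R) (rho : R) :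
  C1_scalar Rad h d -> 0 <= rho < Rad ->
  ballint h rho = RInt (fun t => t ^ 2 * sphere_int (on_sphere h t)) 0 rho.
Proof.
  intros HC Hr. assert (P := PI_RGT_0). assert (HR : 0 < Rad) by lra.
  assert (Ch := C1_cont_on_ball Rad h d HC).
  set (G := fun x0 t => t * RInt (fun ph => h (mkpt x0 (t * cos ph) (t * sin ph))) 0 (2 * PI)).
  set (Gx := fun x0 t => t * RInt (fun ph => d X0 (mkpt x0 (t * cos ph) (t * sin ph))) 0 (2 * PI)).
  destruct (sphere_slab_cont Rad h HR Ch) as [CG C3].
  destruct (sphere_slab_cont Rad (d X0) HR (proj1 (HC X0))) as [CGx C3x].
  fold G in CG. fold Gx in CGx.
  assert (DG : forall x y, x ^ 2 + y ^ 2 < Rad ^ 2 -> is_derive (fun z => G z y) x (Gx x y)).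
  { intros x y H. unfold G, Gx. eapply is_derive_eq.
    - apply (is_derive_R_mult (fun _ => y)); [apply is_derive_R_const|].
      apply (is_derive_RInt_param (fun x0 ph => h (mkpt x0 (y * cos ph) (y * sin ph)))
        (fun x0 ph => d X0 (mkpt x0 (y * cos ph) (y * sin ph)))); [apply two_PI_pos| |].
      + destruct (disc_open Rad x y H) as [e He]. exists e. intros u Hu ph _.
        assert (Hu' : u ^ 2 + y ^ 2 < Rad ^ 2) by (apply (He (u, y)); split; [exact Hu | apply ball_center]).
        split.
        * apply (proj2 (HC X0) (mkpt u (y * cos ph) (y * sin ph))). now apply slab_in_ball.
        * apply (continuous_slice_r (U := prod_UniformSpace R_UniformSpace R_UniformSpace)
            (fun p ph => h (mkpt (fst p) (snd p * cos ph) (snd p * sin ph))) (u, y)). now apply C3.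
      + intros ph _.
        apply (continuous_comp (fun p : R * R => ((fst p, y), snd p))
          (fun p : (R * R) * R => d X0 (mkpt (fst (fst p)) (snd (fst p) * cos (snd p)) (snd (fst p) * sin (snd p))))).
        * cont.
        * now apply C3x.
    - cbv beta. ring. }
  transitivity (RInt (fun x0 => primitive G x0 (sqrt (rho ^ 2 - x0 ^ 2))) (- rho) rho).
  - unfold ballint. apply Rint_eq; [lra | | intros x Hx; now apply (half_disc_continuous Rad)].
    intros x0 Hx0. set (a := sqrt (rho ^ 2 - x0 ^ 2)).
    assert (Hx2 : x0 ^ 2 <= rho ^ 2) by nra.
    assert (Ea : a ^ 2 = rho ^ 2 - x0 ^ 2) by (apply pow2_sqrt; lra).
    assert (Ha0 : 0 <= a) by apply sqrt_pos.
    (* The radius of the slice of the open ball of radius [Rad]: the closed disc of radius [a] has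
       to lie strictly inside a disc on which [g] is C^1. *)
    set (R' := sqrt (Rad ^ 2 - x0 ^ 2)).
    assert (ER : R' ^ 2 = Rad ^ 2 - x0 ^ 2) by (apply pow2_sqrt; nra).
    assert (HaR : a < R') by (apply sqrt_lt_1_alt; nra).
    set (g := fun x1 x2 => h (mkpt x0 x1 x2)).
    assert (Cg : forall k, cont_on_ball Rad k -> cont_disc R' (fun x1 x2 => k (mkpt x0 x1 x2))).
    { intros k Hk x1 x2 H. apply (continuous_on_ball_comp Rad k (fun i (p : R * R) =>
        match i with X0 => x0 | X1 => fst p | X2 => snd p end)); auto.
      - intros []; cont.
      - apply in_ball_sqr; auto. simpl c0; simpl c1; simpl c2. simpl fst; simpl snd. lra. }
    assert (Dg : forall x y, x ^ 2 + y ^ 2 < R' ^ 2 -> is_derive (fun z => g z y) x (d X1 (mkpt x0 x y))).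
    { intros x y H. apply (proj2 (HC X1) (mkpt x0 x y)). apply in_ball_sqr; auto. simpl c0; simpl c1; simpl c2. lra. }
    rewrite (primitive_eq Rad) by (auto; rewrite Ea; nra).
    change (RInt (G x0) 0 a) with (RInt (fun t => t * RInt (fun ph => g (t * cos ph) (t * sin ph)) 0 (2 * PI)) 0 a).
    rewrite <- (disc_polar R' a g _ (conj Ha0 HaR) (Cg h Ch) (Cg _ (proj1 (HC X1))) Dg).
    apply Rint_eq; [lra| |].
    + intros x1 Hx1.
      assert (Es : sqrt (rho ^ 2 - x0 ^ 2 - x1 ^ 2) = sqrt (a ^ 2 - x1 ^ 2)) by (rewrite Ea; f_equal; ring).
      rewrite Es.
      destruct (symmetric_slice R' g x1 (sqrt (a ^ 2 - x1 ^ 2))) as [C1 E1].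
      { now apply (Cg h). } { apply sqrt_pos. } { rewrite sqrt_disc by assumption. nra. }
      rewrite <- E1. apply Rint_eq; auto.
      generalize (sqrt_pos (a ^ 2 - x1 ^ 2)). lra.
    + intros x1 Hx1. apply continuous_R_plus; apply (half_disc_continuous R'); auto.
      * now apply (Cg h).
      * now apply cont_disc_reflect, (Cg h).
  - rewrite (half_disc_polar Rad rho G Gx) by auto.
    apply RInt_ext_in; [lra|]. intros t Ht.
    assert (Hta : Rabs t < Rad) by (rewrite Rabs_pos_eq; lra).
    transitivity (t * (t * sphere_int (on_sphere h t))); [|eqR; ring].
    apply (f_equal (Rmult t)).
    etransitivity; [|exact (RInt_R_scal _ 0 PI t (ex_sphere_inner _ (on_sphere_cont2 Rad h t Ch Hta)))].
    apply RInt_ext_R. intros th. unfold G. rewrite Rmult_assoc. apply (f_equal (Rmult t)).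
    rewrite (RInt_R_scal (on_sphere h t th)) by (apply ex_RInt_cont2, (on_sphere_cont2 Rad); auto).
    apply (f_equal (Rmult (sin th))). apply RInt_ext_R. intros ph.
    unfold on_sphere, point, dir. now rewrite <- !Rmult_assoc.
Qed.

(** * The hyperholomorphic constants *)

Lemma deriv1_eq (g : R -> R) (t l : R) : is_derive g t l -> deriv1 g t = l.
Proof.
  intros H. apply is_derive_Reals in H. unfold deriv1. destruct excluded_middle_informative as [E|E].
  - apply (uniqueness_limite g t); [|exact H]. exact (proj2_sig (constructive_indefinite_description _ E)).
  - exfalso. apply E. now exists l.
Qed.

(* [g] is a polynomial function of degree at most [n] with [n]-th coefficient [c]. *)
Fixpoint has_lead (n : nat) (c : R) (g : R -> R) : Prop :=
  match n with
  | O => forall s, g s = c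
  | S m => exists g', (forall s, is_derive g s (g' s)) /\ has_lead m (INR n * c) g'
  end.

Lemma has_lead_ext (n : nat) (c c' : R) (f g : R -> R) :
  c = c' -> (forall s, f s = g s) -> has_lead n c f -> has_lead n c' g.
Proof. intros -> E. now rewrite (functional_extensionality _ _ E). Qed.

Lemma has_lead_scal (n : nat) (c k : R) (g : R -> R) :
  has_lead n c g -> has_lead n (k * c) (fun s => k * g s).
Proof.
  revert c g. induction n as [|n IH]; intros c g H.
  - simpl in *. intros s. now rewrite H.
  - destruct H as (g' & H1 & H2). exists (fun s => k * g' s). split.
    + intros s. eapply is_derive_eq; [apply (is_derive_R_mult (fun _ => k) g); [apply is_derive_R_const | apply H1] | cbv beta; ring].
    + eapply has_lead_ext; [| |exact (IH _ _ H2)]; [cbv beta; ring | reflexivity].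
Qed.

Lemma has_lead_plus (n : nat) (c d : R) (f g : R -> R) :
  has_lead n c f -> has_lead n d g -> has_lead n (c + d) (fun s => f s + g s).
Proof.
  revert c d f g. induction n as [|n IH]; intros c d f g Hf Hg.
  - simpl in *. intros s. now rewrite Hf, Hg.
  - destruct Hf as (f' & F1 & F2), Hg as (g' & G1 & G2). exists (fun s => f' s + g' s). split.
    + intros s. now apply is_derive_R_plus.
    + eapply has_lead_ext; [| |exact (IH _ _ _ _ F2 G2)]; [cbv beta; ring | reflexivity].
Qed.

Lemma has_lead_mult (n m : nat) (c d : R) (f g : R -> R) :
  has_lead n c f -> has_lead m d g -> has_lead (n + m) (c * d) (fun s => f s * g s).
Proof.
  (* Induction on the total degree, because Leibniz's rule lowers either factor. *)
  assert (H : forall k n m, (n + m = k)%nat -> forall (c d : R) f g,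
    has_lead n c f -> has_lead m d g -> has_lead k (c * d) (fun s => f s * g s)).
  { clear. induction k as [|k IH]; intros n m E c d f g Hf Hg.
    - assert (n = 0%nat) by lia. assert (m = 0%nat) by lia. subst. simpl in *. intros s. now rewrite Hf, Hg.
    - destruct n as [|n].
      + simpl in E. subst m. simpl in Hf. eapply has_lead_ext; [reflexivity | | apply has_lead_scal, Hg].
        intros s. simpl. now rewrite Hf.
      + destruct m as [|m].
        * assert (n = k) by lia. subst n. simpl in Hg.
          apply has_lead_ext with (d * c) (fun s => d * f s); [ring | intros s; rewrite Hg; ring |].
          now apply has_lead_scal.
        * destruct Hf as (f' & F1 & F2), Hg as (g' & G1 & G2). exists (fun s => f' s * g s + f s * g' s). split.
          -- intros s. now apply is_derive_R_mult.
          -- assert (L1 : has_lead k (INR (S n) * c * d) (fun s => f' s * g s)).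
             { apply (IH n (S m)); [lia | exact F2 | now exists g']. }
             assert (L2 : has_lead k (c * (INR (S m) * d)) (fun s => f s * g' s)).
             { apply (IH (S n) m); [lia | now exists f' | exact G2]. }
             eapply has_lead_ext; [| |exact (has_lead_plus _ _ _ _ _ L1 L2)]; [|reflexivity].
             rewrite <- E, plus_INR. ring. }
  now apply H.
Qed.

Lemma nderiv_lead (j n : nat) (c : R) (g : R -> R) :
  has_lead (j + n) c g -> c <> 0 -> exists c', c' <> 0 /\ has_lead n c' (nderiv j g).
Proof.
  revert n c. induction j as [|j IH]; intros n c H Hc.
  - now exists c.
  - destruct (IH (S n) c) as (c' & Hc' & (g' & D & L)); auto.
    { now replace (j + S n)%nat with (S j + n)%nat by lia. }
    exists (INR (S n) * c'). split.
    + apply Rmult_integral_contrapositive_currified; auto. apply not_0_INR. lia.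
    + eapply has_lead_ext; [reflexivity | | exact L]. intros s. symmetry. simpl. now apply deriv1_eq.
Qed.

(** [(s^2 - 1)^m] has degree [2 m], and [m] derivatives from Rodrigues' formula plus [m] more leave
    a constant. Only its being nonzero is recorded, as the vanishing of an inner product is
    insensitive to scale. *)
Lemma sectoral_legendre (m : nat) : exists c, c <> 0 /\ forall t, nderiv m (Legendre m) t = c.
Proof.
  assert (Q : has_lead (m + m) 1 (fun s => (s ^ 2 - 1) ^ m)).
  { assert (Q1 : has_lead 2 1 (fun s => s ^ 2 - 1)).
    { exists (fun s => 2 * s). split.
      - intros s. auto_derive; trivial; eqR; ring.
      - exists (fun _ => 2). split; [intros s; auto_derive; trivial; eqR; ring | simpl; intros; ring]. }
    induction m as [|m IH].
    - simpl. reflexivity.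
    - replace (S m + S m)%nat with (2 + (m + m))%nat by lia.
      eapply has_lead_ext; [| |exact (has_lead_mult _ _ _ _ _ _ Q1 IH)]; [ring | reflexivity]. }
  destruct (nderiv_lead m m 1 _ Q R1_neq_R0) as (c & Hc & L).
  assert (K : / (2 ^ m * INR (fact m)) <> 0).
  { apply Rinv_neq_0_compat, Rmult_integral_contrapositive_currified; [apply pow_nonzero; lra | apply INR_fact_neq_0]. }
  assert (L2 : has_lead (m + 0) (/ (2 ^ m * INR (fact m)) * c) (Legendre m)).
  { rewrite Nat.add_0_r. exact (has_lead_scal _ _ _ _ L). }
  destruct (nderiv_lead m 0 _ _ L2) as (c' & Hc' & L'); [now apply Rmult_integral_contrapositive_currified|].
  exists c'. split; auto.
Qed.

Lemma sector_scale (n : nat) (p q r a b : R) : sector n p q (r * a) (r * b) = r ^ n * sector n p q a b.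
Proof.
  revert p q. induction n as [|n IH]; intros p q; simpl; [ring|]. rewrite !IH. ring.
Qed.

(** De Moivre: for [c = cos u] and [s = sin u] these are [cos (n u)] and [sin ((n+1) u)]. Both sides
    obey the Chebyshev recursion, so two consecutive degrees are carried through the induction. *)
Lemma sector_chebyshev (n : nat) (c s : R) : c ^ 2 + s ^ 2 = 1 ->
  sector n 1 0 c s = ChebT n c /\ sector (S n) 0 1 c s = s * ChebU n c.
Proof.
  intros H. assert (Q : s * s = 1 - c * c) by lra.
  assert (A : forall m p q, sector (S (S m)) p q c s = 2 * c * sector (S m) p q c s - sector m p q c s).
  { intros m p q. simpl. rewrite sector_opp.
    transitivity (c * c * sector m p q c s + 2 * c * s * sector m q (- p) c s - s * s * sector m p q c s);
      [ring | rewrite Q; ring]. }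
  assert (B : (sector n 1 0 c s = ChebT n c /\ sector (S n) 0 1 c s = s * ChebU n c) /\
              (sector (S n) 1 0 c s = ChebT (S n) c /\ sector (S (S n)) 0 1 c s = s * ChebU (S n) c)).
  { induction n as [|n [[I1 I2] [I3 I4]]].
    - rewrite A. simpl. lra.
    - split; [tauto|]. rewrite (A n), (A (S n)), I1, I2, I3, I4. simpl. split; ring. }
  tauto.
Qed.

Lemma sectoral_radius (x : pt) : rad x * sqrt (1 - cos_th1 x ^ 2) = rho12 x.
Proof.
  unfold cos_th1, rho12. assert (E := pnorm_sqr x). fold (rad x) in E. assert (P := pnorm_nonneg x). fold (rad x) in P.
  destruct (Req_EM_T (rad x) 0) as [H|H].
  - rewrite H, Rmult_0_l. rewrite H in E.
    replace (c1 x ^ 2 + c2 x ^ 2) with 0 by (generalize (pow2_ge_0 (c0 x)) (pow2_ge_0 (c1 x)) (pow2_ge_0 (c2 x)); lra).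
    now rewrite sqrt_0.
  - rewrite <- (sqrt_pow2 (rad x)) at 1 by exact P. rewrite <- sqrt_mult_alt by apply pow2_ge_0.
    f_equal. transitivity (rad x ^ 2 - c0 x ^ 2); [field; exact H | rewrite E; ring].
Qed.

Lemma sectoral_cos_sin (n : nat) (x : pt) :
  rho12 x ^ S n * ChebT (S n) (cos_th2 x) = sector (S n) 1 0 (c1 x) (c2 x) /\
  rho12 x ^ S n * (sin_th2 x * ChebU n (cos_th2 x)) = sector (S n) 0 1 (c1 x) (c2 x).
Proof.
  assert (E : rho12 x ^ 2 = c1 x ^ 2 + c2 x ^ 2) by (apply pow2_sqrt; nra).
  unfold cos_th2, sin_th2. destruct (Req_EM_T (rho12 x) 0) as [H|H].
  (* On axis 0 the conventional angle is harmless: both sides carry a positive power of 0. *)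
  - rewrite H in *.
    assert (Z1 : c1 x = 0) by nra. assert (Z2 : c2 x = 0) by nra. rewrite Z1, Z2.
    simpl. split; ring.
  - assert (N : (c1 x / rho12 x) ^ 2 + (c2 x / rho12 x) ^ 2 = 1).
    { apply Rmult_eq_reg_r with (rho12 x ^ 2); [|now apply pow_nonzero].
      transitivity (c1 x ^ 2 + c2 x ^ 2); [field; exact H | lra]. }
    rewrite <- (proj1 (sector_chebyshev (S n) _ _ N)), <- (proj2 (sector_chebyshev n _ _ N)), <- !sector_scale.
    split; f_equal; field; exact H.
Qed.

(** Up to one nonzero factor these are the real and imaginary parts of [(x1 + i x2)^(n+1)]:
    polynomials that do not depend on [x0]. *)
Lemma sectoral_functions (n : nat) : exists c, c <> 0 /\
  (forall x, rU n x = c * sector (S n) 1 0 (c1 x) (c2 x)) /\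
  (forall x, rV n x = c * sector (S n) 0 1 (c1 x) (c2 x)).
Proof.
  destruct (sectoral_legendre (S n)) as (c & Hc & L). exists c. split; auto.
  assert (R : forall x, rad x ^ S n * assocLegendre (S n) (S n) (cos_th1 x) = c * rho12 x ^ S n).
  { intros x. unfold assocLegendre. rewrite L, <- sectoral_radius, Rpow_mult_distr. ring. }
  split; intros x.
  - unfold rU. rewrite R, <- (proj1 (sectoral_cos_sin n x)). ring.
  - unfold rV. rewrite R, <- (proj2 (sectoral_cos_sin n x)). ring.
Qed.

Lemma sector_derive (n : nat) (p q a b : R) :
  is_derive (fun t => sector n p q t b) a (INR n * sector (pred n) p q a b) /\
  is_derive (fun t => sector n p q a t) b (INR n * sector (pred n) q (- p) a b).
Proof.
  revert p q. induction n as [|n IH]; intros p q.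
  - split; (eapply is_derive_eq; [exact (is_derive_R_const _ _) | simpl; ring]).
  - assert (Dt : forall u, is_derive (fun t : R => t) u 1) by (intros u; apply (is_derive_id (K := R_AbsRing))).
    assert (K : forall p q, INR n * sector n p q a b = INR n * (a * sector (pred n) p q a b + b * sector (pred n) q (- p) a b))
      by (intros; destruct n; [simpl; ring | reflexivity]).
    destruct (IH p q) as [D1 D2]. destruct (IH q (- p)) as [D3 D4]. cbn [pred].
    rewrite S_INR, !Rmult_plus_distr_r, !K. split; eapply is_derive_eq.
    + exact (is_derive_R_plus _ _ _ _ _ (is_derive_R_mult _ _ _ _ _ (Dt a) D1) (is_derive_R_mult _ _ _ _ _ (is_derive_R_const b a) D3)).
    + cbv beta. ring.
    + exact (is_derive_R_plus _ _ _ _ _ (is_derive_R_mult _ _ _ _ _ (is_derive_R_const a b) D2) (is_derive_R_mult _ _ _ _ _ (Dt b) D4)).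
    + cbv beta. ring.
Qed.

(** As [rU] and [rV] do not depend on [x0], the constants have no scalar part, and the product only
    sees the components [- c1] and [- c2] of the conjugate of [F], with the kernels of
    [sectoral_moment]. *)
Lemma hyper_const_products (n : nat) : exists c, c <> 0 /\ forall (F : pt -> pt) x,
  let E := fun p q => c * (sector n p q (c1 x) (c2 x) * - c1 (F x) + sector n q (- p) (c1 x) (c2 x) * - c2 (F x)) in
  sc_prod F (Xc n) x = E 1 0 /\ sc_prod F (Yc n) x = E 0 1.
Proof.
  destruct (sectoral_functions n) as (c & Hc & HU & HV).
  exists (c * INR (S n) / 2). split.
  { assert (INR (S n) <> 0) by (apply not_0_INR; lia). intros E. apply Hc.
    apply Rmult_eq_reg_r with (INR (S n)); auto. lra. }
  intros F x E.
  assert (D : forall h p q, (forall x, h x = c * sector (S n) p q (c1 x) (c2 x)) -> pd0 h x = 0 /\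
    pd1 h x = c * (INR (S n) * sector n p q (c1 x) (c2 x)) /\ pd2 h x = c * (INR (S n) * sector n q (- p) (c1 x) (c2 x))).
  { intros h p q Hh. destruct (sector_derive (S n) p q (c1 x) (c2 x)) as [D1 D2].
    unfold pd0, pd1, pd2. split; [|split]; apply deriv1_eq;
      (eapply is_derive_ext; [intros t; symmetry; apply Hh | cbn [line0 line1 line2 c1 c2]]).
    - apply is_derive_R_const.
    - eapply is_derive_eq; [exact (is_derive_R_mult _ _ _ _ _ (is_derive_R_const c _) D1) | cbn [pred]; ring].
    - eapply is_derive_eq; [exact (is_derive_R_mult _ _ _ _ _ (is_derive_R_const c _) D2) | cbn [pred]; ring]. }
  destruct (D _ _ _ HU) as (U0 & U1 & U2). destruct (D _ _ _ HV) as (V0 & V1 & V2).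
  unfold sc_prod, Xc, Yc, Sc, qmul, qconj, toQ, half, Dbar_scalar, E.
  cbn [q0 q1 q2 q3 c0 c1 c2]. rewrite U0, U1, U2, V0, V1, V2. split; field.
Qed.

(** * Orthogonality to the hyperholomorphic constants as vanishing of sectoral moments *)

Lemma cont_on_ball_mult (Rad : R) (h k : pt -> R) :
  cont_on_ball Rad h -> cont_on_ball Rad k -> cont_on_ball Rad (fun x => h x * k x).
Proof. rewrite !cont_on_ball_iff. intros H K x Hx. apply continuous_R_mult; auto. Qed.

Lemma cont_on_ball_plus (Rad : R) (h k : pt -> R) :
  cont_on_ball Rad h -> cont_on_ball Rad k -> cont_on_ball Rad (fun x => h x + k x).
Proof. rewrite !cont_on_ball_iff. intros H K x Hx. apply continuous_R_plus; auto. Qed.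

Lemma cont_on_ball_const (Rad c : R) : cont_on_ball Rad (fun _ => c).
Proof. rewrite cont_on_ball_iff. intros x Hx. apply continuous_const. Qed.

Lemma C1_scalar_mult (Rad : R) (h k : pt -> R) (d e : axis -> pt -> R) :
  C1_scalar Rad h d -> C1_scalar Rad k e ->
  C1_scalar Rad (fun x => h x * k x) (fun i x => d i x * k x + h x * e i x).
Proof.
  intros H K i. assert (Ch := C1_cont_on_ball Rad h d H). assert (Ck := C1_cont_on_ball Rad k e K).
  destruct (H i) as [H1 H2]. destruct (K i) as [K1 K2]. split.
  - apply cont_on_ball_plus; now apply cont_on_ball_mult.
  - intros x Hx. eapply is_derive_eq; [apply is_derive_R_mult; [now apply H2 | now apply K2]|].
    cbv beta. destruct i, x; reflexivity.
Qed.

Lemma C1_scalar_plus (Rad : R) (h k : pt -> R) (d e : axis -> pt -> R) :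
  C1_scalar Rad h d -> C1_scalar Rad k e ->
  C1_scalar Rad (fun x => h x + k x) (fun i x => d i x + e i x).
Proof.
  intros H K i. destruct (H i) as [H1 H2]. destruct (K i) as [K1 K2]. split.
  - now apply cont_on_ball_plus.
  - intros x Hx. apply is_derive_R_plus; [now apply H2 | now apply K2].
Qed.

Lemma C1_scalar_const (Rad c : R) : C1_scalar Rad (fun _ => c) (fun _ _ => 0).
Proof. intros i. split; [apply cont_on_ball_const | intros x _; apply is_derive_R_const]. Qed.

Lemma cont_on_ball_opp (Rad : R) (h : pt -> R) : cont_on_ball Rad h -> cont_on_ball Rad (fun x => - h x).
Proof. rewrite !cont_on_ball_iff. intros H x Hx. apply continuous_R_opp. auto. Qed.

Lemma cont_on_ball_sector (Rad : R) (n : nat) (p q : R) : cont_on_ball Rad (fun x => sector n p q (c1 x) (c2 x)).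
Proof.
  revert p q. induction n as [|n IH]; intros p q; simpl; [apply cont_on_ball_const|].
  apply cont_on_ball_plus; apply cont_on_ball_mult; auto; apply cont_on_ball_iff; intros x _; simpl; cont.
Qed.

Definition sector_grad (n : nat) (p q : R) (i : axis) (x : pt) : R :=
  match i with
  | X0 => 0
  | X1 => INR n * sector (pred n) p q (c1 x) (c2 x)
  | X2 => INR n * sector (pred n) q (- p) (c1 x) (c2 x)
  end.

Lemma C1_scalar_sector (Rad : R) (n : nat) (p q : R) :
  C1_scalar Rad (fun x => sector n p q (c1 x) (c2 x)) (sector_grad n p q).
Proof.
  intros i; split.
  - destruct i; unfold sector_grad; try apply cont_on_ball_mult; auto using cont_on_ball_const, cont_on_ball_sector.
  - intros x _. destruct (sector_derive n p q (c1 x) (c2 x)) as [D1 D2].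
    destruct i; [exact (is_derive_R_const (sector n p q (c1 x) (c2 x)) (c0 x)) | exact D1 | exact D2].
Qed.

Lemma smooth_sectoral (m : nat) (p q : R) :
  smooth (sectoral (S m) p q) (fun i th ph => INR (S m) *
    match i with X0 => 0 | X1 => sectoral m p q th ph | X2 => sectoral m q (- p) th ph end).
Proof.
  assert (H1 : Rabs 1 < 2) by (rewrite Rabs_R1; lra).
  assert (E : forall th ph, point (fun i => 1 * dir th ph i) = point (dir th ph)).
  { intros th ph. unfold point. now rewrite !Rmult_1_l. }
  (* Sectoral harmonics are restrictions of polynomials; the ball of radius 2 is just one that
     contains the unit sphere. *)
  apply (smooth_ext _ _ _ _) with (3 := on_sphere_smooth 2 _ _ 1 (C1_scalar_sector 2 (S m) p q) H1).
  - intros th ph. unfold on_sphere. now rewrite E.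
  - intros i th ph. unfold on_sphere. rewrite E. destruct i; unfold sector_grad, sectoral; cbn [pred c1 c2 point]; ring.
Qed.

(* Along spheres [E v1 = L01 v0 - L12 v2] and [E v2 = L02 v0 + L12 v1], with [E] the Euler operator
   and [Lij] the infinitesimal rotations; integrating by parts the [v0]-terms cancel. *)
Lemma sectoral_euler Rad v d (m : nat) (p q t : R) :
  harmonic_gradient Rad v d -> Rabs t < Rad ->
  t * sphere_int (fun th ph => sectoral (S m) p q th ph * radial (d X1) t th ph
    + sectoral (S m) q (- p) th ph * radial (d X2) t th ph) =
  INR (S m) * sectoral_moment (S m) p q v t.
Proof.
  intros Hv Ht. destruct (harmonic_gradient_cont Rad v d t Hv Ht) as (Cv & Cd & Cr).
  assert (Nu := fun p q i j k => null_rotation _ _ i j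
    (smooth_mult _ _ _ _ (smooth_sectoral m p q) (on_sphere_smooth Rad (v k) (d k) t (proj1 Hv k) Ht))).
  unfold sectoral_moment, moment. rewrite <- sphere_int_plus, <- !sphere_int_scal by cont2s.
  apply (sphere_int_eq_mod _ _ _ (null_plus _ _ (Nu p q X0 X1 X0) (null_plus _ _ (Nu p q X2 X1 X2)
    (null_plus _ _ (Nu q (- p) X0 X2 X0) (Nu q (- p) X1 X2 X1))))); [cont2s|].
  intros th ph. destruct (riesz_on_sphere Rad v d t th ph Hv Ht) as (T0 & S01 & S12 & S20).
  assert (E : forall p q, sectoral (S m) p q th ph = dir th ph X1 * sectoral m p q th ph + dir th ph X2 * sectoral m q (- p) th ph)
    by reflexivity.
  assert (O : sectoral m (- p) (- q) th ph = - sectoral m p q th ph) by apply sector_opp.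
  unfold radial, dot. rewrite !E, O, T0, ?S01, ?S12, ?S20. ring.
Qed.

Lemma sectoral_homogeneous Rad v d (m : nat) (p q s t : R) :
  harmonic_gradient Rad v d -> 0 < s < Rad -> 0 < t < Rad ->
  sectoral_moment (S m) p q v s * t ^ S m = sectoral_moment (S m) p q v t * s ^ S m.
Proof.
  intros Hv. apply (euler_ode (sectoral_moment (S m) p q v) (fun t =>
    sphere_int (fun th ph => sectoral (S m) p q th ph * radial (d X1) t th ph + sectoral (S m) q (- p) th ph * radial (d X2) t th ph)));
    intros u Hu; assert (Hua : Rabs u < Rad) by (rewrite Rabs_pos_eq; lra).
  - destruct (harmonic_gradient_cont Rad v d u Hv Hua) as (_ & _ & Cr). rewrite sphere_int_plus by cont2s.
    apply is_derive_R_plus; apply (moment_derive Rad v d); auto with cont.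
  - now apply (sectoral_euler Rad v d).
Qed.

(** Homogeneity gives [J t = K t^N], so the integral up to [rho] is [c K rho^(2N+3) / (2N+3)]. Its
    absolute value grows with [rho], and it can tend to 0 only if [K = 0]. *)
Lemma homogeneous_vanishes (Rad c : R) (N : nat) (J : R -> R) : 0 < Rad -> c <> 0 ->
  (forall s t, 0 < s < Rad -> 0 < t < Rad -> J s * t ^ N = J t * s ^ N) ->
  (forall eps, 0 < eps -> exists delta, 0 < delta /\ forall rho, 0 < rho -> Rad - delta < rho < Rad ->
     Rabs (RInt (fun t => t ^ 2 * (c * (t ^ N * J t))) 0 rho) < eps) ->
  forall t, 0 < t < Rad -> J t = 0.
Proof.
  intros HR Hc HJ HL. set (t0 := Rad / 2). assert (Ht0 : 0 < t0 < Rad) by (unfold t0; lra).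
  assert (P0 : 0 < t0 ^ N) by (apply pow_lt; lra).
  set (K := J t0 / t0 ^ N).
  assert (E : forall t, 0 < t < Rad -> J t = K * t ^ N).
  { intros t Ht. unfold K. apply Rmult_eq_reg_r with (t0 ^ N); [|lra].
    rewrite (HJ t t0 Ht Ht0). field. lra. }
  (* One [N] from the kernel, one from [J], and 2 from the Jacobian. *)
  set (q := (N + N + 2)%nat).
  assert (I : forall rho, 0 < rho < Rad -> RInt (fun t => t ^ 2 * (c * (t ^ N * J t))) 0 rho = c * K * (rho ^ S q / INR (S q))).
  { intros rho Hr.
    assert (Hq : INR (S q) <> 0) by (apply not_0_INR; lia).
    transitivity (RInt (fun t => c * K * t ^ q) 0 rho).
    - apply RInt_ext_in; [lra|]. intros t Ht.
      rewrite E by lra. unfold q. rewrite !pow_add. eqR. ring.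
    - rewrite (RInt_FTC (fun t => c * K * (t ^ S q / INR (S q)))).
      + rewrite pow_ne_zero by lia. unfold Rdiv. eqR. ring.
      + lra.
      + intros t _. eapply is_derive_eq.
        * exact (is_derive_R_mult _ _ _ _ _ (is_derive_R_const (c * K) t)
            (is_derive_R_mult _ _ _ _ _ (is_derive_R_pow (S q) t) (is_derive_R_const (/ INR (S q)) t))).
        * cbv beta. cbn [pred]. field. exact Hq.
      + intros t _. cont. }
  intros t Ht. rewrite E by assumption. enough (K = 0) as -> by ring.
  destruct (Req_dec K 0) as [|HK]; [assumption|exfalso].
  assert (HS : 0 < INR (S q)) by (apply lt_0_INR; lia).
  assert (Pq : 0 < t0 ^ S q) by (apply pow_lt; lra).
  set (eps := Rabs (c * K) * (t0 ^ S q / INR (S q))).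
  assert (He : 0 < eps).
  { apply Rmult_lt_0_compat; [apply Rabs_pos_lt, Rmult_integral_contrapositive_currified; auto | now apply Rdiv_lt_0_compat]. }
  destruct (HL eps He) as (delta & Hd & H).
  set (rho := Rmax t0 (Rad - delta / 2)).
  assert (R1 : t0 <= rho) by apply Rmax_l. assert (R2 : Rad - delta / 2 <= rho) by apply Rmax_r.
  assert (R3 : rho < Rad) by (apply Rmax_lub_lt; lra).
  specialize (H rho ltac:(lra) ltac:(lra)). rewrite I in H by lra.
  rewrite Rabs_mult in H. revert H. apply Rle_not_lt. unfold eps.
  apply Rmult_le_compat_l; [apply Rabs_pos|].
  apply Rle_trans with (2 := Rle_abs _). apply Rmult_le_compat_r; [left; now apply Rinv_0_lt_compat|].
  apply pow_incr. lra.
Qed.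

(** Only the scalar part is normalised at the origin: the bound [S] concerns [Sc (f - f(0))],
    whereas the orthogonality is about [f] itself and involves its other two components
    unshifted. *)
Definition conj_field (f : pt -> pt) (j : axis) (x : pt) : R :=
  match j with X0 => c0 (f x) - c0 (f origin) | X1 => - c1 (f x) | X2 => - c2 (f x) end.

Definition pd (i : axis) (g : pt -> R) (x : pt) : R :=
  match i with X0 => pd0 g x | X1 => pd1 g x | X2 => pd2 g x end.

Definition conj_field_grad (f : pt -> pt) (j i : axis) (x : pt) : R :=
  match j with X0 => pd i (fun y => c0 (f y)) x | X1 => - pd i (fun y => c1 (f y)) x | X2 => - pd i (fun y => c2 (f y)) x end.

Lemma C1_on_ball_scalar (Rad : R) (f : pt -> pt) (k : pt -> R) : C1_on_ball Rad f -> (k = c0 \/ k = c1 \/ k = c2) ->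
  C1_scalar Rad (fun x => k (f x)) (fun i => pd i (fun y => k (f y))).
Proof.
  intros Hf Hk. destruct (Hf k Hk) as (D & C0 & C1 & C2).
  intros i. split; [destruct i; assumption|].
  intros x Hx. destruct (D x Hx) as ((l0 & L0) & (l1 & L1) & (l2 & L2)).
  apply is_derive_Reals in L0, L1, L2. destruct i; simpl.
  - rewrite (deriv1_eq _ _ _ L0 : pd0 _ x = l0). exact L0.
  - rewrite (deriv1_eq _ _ _ L1 : pd1 _ x = l1). exact L1.
  - rewrite (deriv1_eq _ _ _ L2 : pd2 _ x = l2). exact L2.
Qed.

Lemma monogenic_harmonic_gradient (Rad : R) (f : pt -> pt) :
  monogenic Rad f -> harmonic_gradient Rad (conj_field f) (conj_field_grad f).
Proof.
  intros [HC HD].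
  assert (S0 := C1_on_ball_scalar Rad f c0 HC ltac:(tauto)).
  assert (S1 := C1_on_ball_scalar Rad f c1 HC ltac:(tauto)).
  assert (S2 := C1_on_ball_scalar Rad f c2 HC ltac:(tauto)).
  (* The four quaternionic components of [D f = 0]: the first is the divergence of [conj_field], the
     others are its curl, up to sign. *)
  assert (R : forall x, in_ball Rad x ->
    pd0 (fun y => c0 (f y)) x - pd1 (fun y => c1 (f y)) x - pd2 (fun y => c2 (f y)) x = 0 /\
    pd0 (fun y => c1 (f y)) x + pd1 (fun y => c0 (f y)) x = 0 /\
    pd0 (fun y => c2 (f y)) x + pd2 (fun y => c0 (f y)) x = 0 /\
    pd1 (fun y => c2 (f y)) x - pd2 (fun y => c1 (f y)) x = 0).
  { intros x Hx. specialize (HD x Hx).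
    assert (E0 := f_equal q0 HD). assert (E1 := f_equal q1 HD). assert (E2 := f_equal q2 HD). assert (E3 := f_equal q3 HD).
    unfold Dop, qadd, qmul, toQ, pdA, e1, e2, qzero in E0, E1, E2, E3. cbn [q0 q1 q2 q3 c0 c1 c2] in E0, E1, E2, E3.
    repeat split; lra. }
  split; [|split].
  - intros j i. destruct j; split.
    + apply S0.
    + intros x Hx. eapply is_derive_eq; [apply is_derive_R_minus; [now apply S0 | apply is_derive_R_const] | simpl; ring].
    + apply cont_on_ball_opp, S1.
    + intros x Hx. apply is_derive_R_opp. now apply S1.
    + apply cont_on_ball_opp, S2.
    + intros x Hx. apply is_derive_R_opp. now apply S2.
  - intros i j x Hx. destruct (R x Hx) as (R0 & R1 & R2 & R3). destruct i, j; simpl; lra.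
  - intros x Hx. destruct (R x Hx) as (R0 & _). simpl. lra.
Qed.

Lemma sectoral_moment_vanishes (Rad c : R) (f G : pt -> pt) v d
    (m : nat) (p q t : R) :
  harmonic_gradient Rad v d -> c <> 0 -> L2_inner_is Rad f G 0 ->
  (forall x, sc_prod f G x = c * (sector (S m) p q (c1 x) (c2 x) * v X1 x + sector (S m) q (- p) (c1 x) (c2 x) * v X2 x)) ->
  0 < t < Rad -> sectoral_moment (S m) p q v t = 0.
Proof.
  intros Hv Hc HG E Ht.
  assert (D : exists dG, C1_scalar Rad (sc_prod f G) dG).
  { rewrite (functional_extensionality _ _ E). eexists.
    exact (C1_scalar_mult Rad _ _ _ _ (C1_scalar_const Rad c) (C1_scalar_plus Rad _ _ _ _
      (C1_scalar_mult Rad _ _ _ _ (C1_scalar_sector Rad (S m) p q) (proj1 Hv X1))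
      (C1_scalar_mult Rad _ _ _ _ (C1_scalar_sector Rad (S m) q (- p)) (proj1 Hv X2)))). }
  destruct D as [dG D].
  apply (homogeneous_vanishes Rad c (S m) (sectoral_moment (S m) p q v)); auto; [lra| |].
  - intros s u Hs Hu. now apply (sectoral_homogeneous Rad v d).
  - intros eps He. destruct (HG eps He) as (delta & Hdl & H).
    exists delta. split; auto. intros rho Hr0 Hr. specialize (H rho Hr).
    rewrite Rminus_0_r, (ballint_spherical Rad _ _ rho D) in H by lra.
    rewrite (RInt_ext_in _ (fun t => t ^ 2 * sphere_int (on_sphere (sc_prod f G) t))); auto; [lra|].
    intros u Hu. apply (f_equal (Rmult (u ^ 2))).
    destruct (harmonic_gradient_cont Rad v d u Hv ltac:(rewrite Rabs_pos_eq; lra)) as (Cv & _ & _).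
    unfold sectoral_moment, moment. rewrite <- sphere_int_plus, <- !sphere_int_scal by cont2s.
    apply sphere_int_ext. intros th ph. unfold on_sphere at 3. rewrite E. cbn [c1 c2 point].
    rewrite !sector_scale. unfold sectoral, on_sphere. ring.
Qed.

(** The two families of constants supply the coefficients [(1, 0)] and [(0, 1)], and the moment is
    linear in [(p, q)]. Index [N] matches degree [N], since differentiation lowers the degree
    [N + 1] of [rU N] and [rV N]. *)
Lemma orth_no_sectoral (Rad : R) (f : pt -> pt) (N : nat) (t : R) :
  monogenic Rad f -> orth_hyper_consts Rad f -> (1 <= N)%nat -> 0 < t < Rad ->
  no_sectoral N (conj_field f) t.
Proof.
  intros Hm Ho HN Ht p q. destruct N as [|m]; [lia|].
  assert (Hv := monogenic_harmonic_gradient Rad f Hm).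
  destruct (harmonic_gradient_cont Rad _ _ t Hv ltac:(rewrite Rabs_pos_eq; lra)) as (Cv & _ & _).
  destruct (Ho (S m) HN) as [OX OY]. destruct (hyper_const_products (S m)) as (c & Hc & HP).
  assert (JX := sectoral_moment_vanishes Rad c f _ _ _ m 1 0 t Hv Hc OX (fun x => proj1 (HP f x)) Ht).
  assert (JY := sectoral_moment_vanishes Rad c f _ _ _ m 0 1 t Hv Hc OY (fun x => proj2 (HP f x)) Ht).
  transitivity (p * sectoral_moment (S m) 1 0 (conj_field f) t + q * sectoral_moment (S m) 0 1 (conj_field f) t);
    [|rewrite JX, JY; ring].
  unfold sectoral_moment, moment. rewrite <- !sphere_int_plus, <- sphere_int_lin by cont2s.
  apply sphere_int_ext. intros th ph. unfold sectoral.
  replace (sector (S m) p q) with (sector (S m) (p * 1 + q * 0) (p * 0 + q * 1)) by (f_equal; ring).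
  replace (sector (S m) q (- p)) with (sector (S m) (p * 0 + q * 1) (p * - (1) + q * - 0)) by (f_equal; ring).
  rewrite !sector_lin. ring.
Qed.

(* M(f - f(0), r) <= C is written as: |f(x) - f(0)| <= C for all |x| = r;
   the supremum over B_R is handled by quantifying over every upper bound S. *)
Theorem theorem3 (Rad : R) (f : pt -> pt)
  (HR : 0 < Rad) (Hmono : monogenic Rad f) (HL2 : in_L2 Rad f)
  (Horth : orth_hyper_consts Rad f)
  (r : R) (hr0 : 0 <= r) (hrR : r < Rad)
  (S : R)
  (HS : forall xi : pt, pnorm xi < Rad -> Rabs (Sc (toQ (psub (f xi) (f origin)))) <= S) :
  forall x : pt, pnorm x = r ->
    pnorm (psub (f x) (f origin))
      <= sqrt (2 / 3) * (2 * r * Acoef r Rad / (Rad - r) ^ 4) * S.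
Proof.
  intros x Hx.
  assert (Ex := pnorm_sqr x). rewrite Hx in Ex.
  (* At the centre the direction [x / r] is meaningless, and both sides of the estimate vanish. *)
  destruct (Req_dec r 0) as [Hr|Hr].
  - assert (x = origin).
    { rewrite Hr in Ex. destruct x as [a b c]; simpl in Ex. unfold origin. f_equal; nra. }
    subst x. right. transitivity 0.
    + apply Rle_antisym; [|apply pnorm_nonneg]. apply pnorm_le; [lra|]. simpl. right. ring.
    + rewrite Hr. unfold Rdiv. ring.
  - assert (Hr' : 0 < r < Rad) by lra.
    assert (Hv := monogenic_harmonic_gradient Rad f Hmono).
    assert (HB : forall y, in_ball Rad y -> Rabs (conj_field f X0 y) <= S) by exact HS.
    assert (HS0 : 0 <= S).
    { apply Rle_trans with (1 := Rabs_pos _) (2 := HB x ltac:(unfold in_ball; lra)). }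
    set (u := fun i => coord i x / r).
    assert (Hu : dot u u = 1).
    { unfold dot, u. simpl. apply Rmult_eq_reg_r with (r ^ 2); [|apply pow_nonzero; lra].
      transitivity (c0 x ^ 2 + c1 x ^ 2 + c2 x ^ 2); [field; lra | lra]. }
    assert (Ep : point (fun i => r * u i) = x).
    { destruct x as [a b c]. unfold point, u. simpl. f_equal; field; lra. }
    assert (CE := fun e He => core_estimate Rad S (conj_field f) (conj_field_grad f) u e r Hv HS0 HB
      (fun N t => orth_no_sectoral Rad f N t Hmono Horth) Hu He Hr').
    set (w := psub (f x) (f origin)). assert (Ew := pnorm_sqr w). assert (Pw := pnorm_nonneg w).
    (* If [w] vanishes it offers no direction to test against; any unit vector then shows that the
       bound is nonnegative. *)
    destruct (Req_dec (pnorm w) 0) as [Hw|Hw].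
    + rewrite Hw. eapply Rle_trans; [apply Rabs_pos|].
      apply (CE (fun i => match i with X0 => 1 | _ => 0 end)). unfold dot. ring.
    (* The direction of the conjugate of [w]: its signs match those of [conj_field], so the test
       returns [pnorm w]. *)
    + set (e := fun i => match i with X0 => c0 w / pnorm w | X1 => - c1 w / pnorm w | X2 => - c2 w / pnorm w end).
      assert (He : dot e e = 1).
      { unfold dot, e. apply Rmult_eq_reg_r with (pnorm w ^ 2); [|now apply pow_nonzero].
        transitivity (c0 w ^ 2 + c1 w ^ 2 + c2 w ^ 2); [field; exact Hw | lra]. }
      specialize (CE e He). rewrite Ep in CE.
      apply Rle_trans with (2 := CE). apply Rle_trans with (2 := Rle_abs _). right.
      unfold dot, e, conj_field. apply Rmult_eq_reg_r with (pnorm w); auto.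
      transitivity (pnorm w ^ 2); [ring|]. rewrite Ew. unfold w; simpl. field. exact Hw.
Qed.
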